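(* Let $K\subseteq\mathbb{R}^d$ be compact, $\alpha\in[0,1)$, and let $\eta\in\mathrm{IP}(K)$ be an irrigation plan. Then $$\mathbf{I}_\alpha(\eta)=\bar{\mathbf{E}}_\alpha(\eta).$$ Moreover, if $\eta$ is essentially simple, then $$\mathbf{I}_\alpha(\eta)=\mathbf{E}_\alpha(\eta).$$
   Context: $\Gamma=\Gamma(K)$ is the space of $1$-Lipschitz curves $\gamma:\mathbb{R}_+\to K$ with the topology of uniform convergence on compact sets. $L(\gamma)=\int_0^\infty|\dot\gamma(t)|\,dt$ and $T(\gamma)=\inf\{t\ge0:\gamma\text{ is constant on }[t,\infty)\}\in[0,\infty]$. An irrigation plan is a Borel probability measure $\eta$ on $\Gamma$ with $\int_\Gamma L\,d\eta<\infty$; $\mathrm{IP}(K)$ is the set of irrigation plans. A curve is identified with its image when writing $x\in\gamma$, $\gamma\setminus A$, etc. Multiplicities: $\theta_\eta(x)=|x|_\eta=\eta(\{\gamma:x\in\gamma\})$; $m(x,\gamma)=\#\{t\in[0,T(\gamma)]\cap\mathbb{R}_+:\gamma(t)=x\}\in\mathbb{N}\cup\{\infty\}$; $m_\eta(x)=\int_\Gamma m(x,\gamma)\,\eta(d\gamma)$. A curve $\gamma$ is essentially simple if $\mathcal{H}^1(\{x\in\gamma: m(x,\gamma)\ne1\})=0$; $\eta$ is essentially simple if $\eta$-a.e. curve is. Rectifiability: $\eta$ is concentrated on a Borel set $A\subseteq K$ if $\mathcal{H}^1(\gamma\setminus A)=0$ for $\eta$-a.e. $\gamma$; $\eta$ is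 rectifiable if it is concentrated on a $1$-rectifiable set, i.e. a set covered up to an $\mathcal{H}^1$-null set by countably many Lipschitz curves. Costs: $\mathbf{I}_\alpha(\eta)=\int_\Gamma\int_0^\infty|\gamma(t)|_\eta^{\alpha-1}|\dot\gamma(t)|\,dt\,\eta(d\gamma)$. If $\eta$ is rectifiable, $\mathbf{E}_\alpha(\eta)=\int_K\theta_\eta^\alpha(x)\,\mathcal{H}^1(dx)$ and $\bar{\mathbf{E}}_\alpha(\eta)=\int_K\theta_\eta^{\alpha-1}(x)m_\eta(x)\,\mathcal{H}^1(dx)$; if $\eta$ is not rectifiable, both equal $+\infty$. Conventions (for $\alpha\in[0,1)$): $0^{\alpha-1}=\infty$, $\infty\times0=0$, and $\theta_\eta^\alpha(x)=0$ where $\theta_\eta(x)=0$ (also when $\alpha=0$). *)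

(* Defs.v *)
From HB Require Import structures.
From mathcomp Require Import all_boot all_order all_algebra.
From mathcomp Require Import all_classical all_reals all_analysis.

Set Implicit Arguments.
Unset Strict Implicit.
Unset Printing Implicit Defensive.
Import Order.TTheory GRing.Theory Num.Theory.
Import numFieldNormedType.Exports.

Local Open Scope classical_set_scope.
Local Open Scope ring_scope.

Notation borel T := (g_sigma_algebraType (@open T)).

(* The library norm on row vectors is the sup norm; lengths, Lipschitz
   constants and diameters below are Euclidean. *)
Definition enorm (R : realType) (d : nat) (v : 'rV[R]_d) : R :=
  Num.sqrt (\sum_(i < d) v ord0 i ^+ 2).

Section hausdorff.
Local Open Scope ereal_scope.
Context (R : realType) (d : nat).

(* The added 0 makes the diameter of the empty set equal to 0. *)
Definition ediam (A : set 'rV[R]_d) : \bar R :=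
  ereal_sup (0 |` [set (enorm (p.1 - p.2))%:E | p in A `*` A]).

Definition hausdorff1_delta (delta : R) (A : set 'rV[R]_d) : \bar R :=
  ereal_inf [set \sum_(n <oo) ediam (U n) | U in
    [set U : (set 'rV[R]_d)^nat |
      A `<=` \bigcup_n U n /\ forall n, ediam (U n) <= delta%:E]].

(* In dimension 1 the usual normalising constant of the Hausdorff measure
   is 1. The typing on the Borel type selects the sigma-algebra used when
   integrating; the value is the outer measure, defined on all sets. *)
Definition hausdorff1 (A : set (borel 'rV[R]_d)) : \bar R :=
  ereal_sup [set hausdorff1_delta delta A | delta in [set delta | (0 < delta)%R]].

Definition rectifiable1 (A : set 'rV[R]_d) : Prop :=
  exists c : nat -> R -> 'rV[R]_d,
    (forall n, exists k : R, forall s t, (0 <= s)%R -> (0 <= t)%R ->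
      (enorm (c n s - c n t)%R <= k * `|s - t|)%R) /\
    hausdorff1 (A `\` \bigcup_n (c n @` `[0%R, +oo[)) = 0.

End hausdorff.

Definition compact_nonneg (R : realType) (A : set R) : Prop :=
  compact A /\ A `<=` `[0, +oo[.

(* A curve on [0, +oo[ is represented by its unique extension to R that is
   constant on ]-oo, 0]; the topology only involves compact subsets of
   [0, +oo[. *)
Definition lip_curves (R : realType) (d : nat) (K : set 'rV[R]_d) :
    set {family @compact_nonneg R, R -> 'rV[R]_d} :=
  [set g : R -> 'rV[R]_d |
    [/\ forall t, 0 <= t -> K (g t),
        forall s t, 0 <= s -> 0 <= t -> enorm (g s - g t) <= `|s - t|
      & forall t, t < 0 -> g t = g 0]].

(* Measurable types are required to be pointed, whence the argument K0; it
   excludes no case, as there is no probability measure on an empty space. *)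
Definition Gamma (R : realType) (d : nat) (K : set 'rV[R]_d)
  (K0 : K !=set0) : Type := set_type (lip_curves K).

Section Gamma_instances.
Context (R : realType) (d : nat) (K : set 'rV[R]_d) (K0 : K !=set0).

HB.instance Definition _ :=
  Topological.copy (Gamma K0) (set_type (lip_curves K)).

Lemma lip_curves_cst : (cst (sval (cid K0)) : R -> 'rV[R]_d) \in lip_curves K.
Proof.
rewrite inE; split => //= [t _|s t _ _]; first by case: cid.
rewrite subrr /enorm big1 ?sqrtr0// => i _.
by rewrite mxE expr0n.
Qed.

HB.instance Definition _ := isPointed.Build (Gamma K0)
  (SigSub lip_curves_cst : Gamma K0).

End Gamma_instances.

Section irrigation.
Local Open Scope ereal_scope.
Context (R : realType) (d : nat) (K : set 'rV[R]_d) (K0 : K !=set0).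
Implicit Types (g : Gamma K0) (x : 'rV[R]_d) (a : R).

Local Notation leb := (@lebesgue_measure R).

Definition curve g : R -> 'rV[R]_d := set_val g.

Definition im g : set 'rV[R]_d := curve g @` `[0%R, +oo[.

(* A Lipschitz curve is differentiable almost everywhere; the junk value of
   derive1 at the other points does not affect integrals in t. *)
Definition speed g (t : R) : R := enorm (derive1 (curve g) t).

Definition length g : \bar R := \int[leb]_(t in `[0%R, +oo[) (speed g t)%:E.

Definition stop_time g : \bar R :=
  ereal_inf [set t%:E | t in
    [set t : R | (0 <= t)%R /\ forall s, (t <= s)%R -> curve g s = curve g t]].

Definition mult x g : \bar R :=
  counting [set t : R | [/\ (0 <= t)%R, t%:E <= stop_time g & curve g t = x]].

Definition essentially_simple_curve g : Prop :=
  hausdorff1 [set x | im g x /\ mult x g <> 1] = 0.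

Implicit Type eta : probability (borel (Gamma K0)) R.

Definition irrigation_plan eta : Prop := \int[eta]_g length g < +oo.

Definition theta eta x : \bar R := eta [set g | im g x].

Definition mult_plan eta x : \bar R := \int[eta]_g mult x g.

Definition essentially_simple eta : Prop :=
  {ae eta, forall g, essentially_simple_curve g}.

Definition concentrated eta (A : set 'rV[R]_d) : Prop :=
  {ae eta, forall g, hausdorff1 (im g `\` A) = 0}.

Definition rectifiable eta : Prop :=
  exists A : set (borel 'rV[R]_d),
    [/\ measurable A, A `<=` K, rectifiable1 A & concentrated eta A].

(* theta ^ a and theta ^ (a - 1) for 0 <= a < 1, with the conventions
   0 ^ a = 0 (even for a = 0) and 0 ^ (a - 1) = +oo, where the library has
   0 `^ 0 = 1 and 0 `^ r = 0 for r < 0. *)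
Definition theta_pow eta a x : \bar R :=
  if theta eta x == 0 then 0 else theta eta x `^ a.

Definition theta_pow_pred eta a x : \bar R :=
  if theta eta x == 0 then +oo else theta eta x `^ (a - 1).

Definition I_cost a eta : \bar R :=
  \int[eta]_g \int[leb]_(t in `[0%R, +oo[)
    (theta_pow_pred eta a (curve g t) * (speed g t)%:E).

Definition E_cost a eta : \bar R :=
  if `[< rectifiable eta >]
  then \int[@hausdorff1 R d]_(x in K) theta_pow eta a x else +oo.

Definition Ebar_cost a eta : \bar R :=
  if `[< rectifiable eta >]
  then \int[@hausdorff1 R d]_(x in K)
         (theta_pow_pred eta a x * mult_plan eta x)
  else +oo.

End irrigation.

(* Main.v *)
Require Import Defs.
From HB Require Import structures.
From mathcomp Require Import all_boot all_order all_algebra.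
From mathcomp Require Import ring lra zify.
From mathcomp Require Import all_classical all_reals all_analysis.
From mathcomp Require Import measurable_realfun.
Import Order.TTheory GRing.Theory Num.Theory.
Import numFieldNormedType.Exports.
Local Open Scope classical_set_scope.
Local Open Scope ring_scope.
Set Implicit Arguments.
Unset Strict Implicit.
Unset Printing Implicit Defensive.

(* Let P be the set where theta > 0. The area formula along a curve g,
     int f(g(t)) |g'(t)| dt = int f(x) m(x, g) H^1(dx),
   turns I_alpha into an integral over Gamma x K, and Tonelli's theorem gives
   the two identities as soon as H^1 is sigma-finite on P and eta is
   concentrated on P. For sigma-finiteness, a curve through x that leaves the
   ball of radius rho around x has length at least rho/2 in the ball of radius
   rho/2, so averaging over eta bounds the rho-separated subsets of
   {theta >= e}; curves that do not move meet a single point.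
   A plan is rectifiable if and only if it is concentrated on P. If it is
   concentrated on P, then countably many curves of maximal total mass exhaust
   it; conversely, on an arc of finite length Fubini's theorem shows that almost
   no curve charges {theta = 0}. If eta is not concentrated on P, all the costs
   are infinite since theta^(alpha - 1) is infinite off P. *)

(** * The Euclidean norm *)

(** For d >= 2 the measure H^1 is not sigma-finite on the whole space, so Tonelli cannot be applied
    to eta and H^1 directly; this forces the detour through [pos_theta]. A derivative is a limit
    that may fail to exist, so [speed] is not known to be measurable: it is replaced with [mspeed],
    a lower limit of dyadic chord slopes equal to it at almost every time, and integrals are
    compared by monotonicity, which needs no measurability. The area formula is proved without
    cutting the curve into injective pieces. Both sides define Borel measures; Fatou applied to
    dyadic counts of hits bounds the total mass on one side, Fatou applied to dyadic slopes gives
    the reverse inequality on every open set, and this forces equality when the length is finite.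
    The exhausting curves are found with the measure that sends B to the expected length spent in B:
    it is finite for an irrigation plan, so the supremum over countable unions of curves is
    attained. *)

Section enorm.
Context (R : realType) (d : nat).
Implicit Types u v w : 'rV[R]_d.

Lemma enorm_ge0 v : 0 <= enorm v.
Proof. exact: sqrtr_ge0. Qed.

Lemma enorm_sqr v : enorm v ^+ 2 = \sum_(i < d) v ord0 i ^+ 2.
Proof. by rewrite sqr_sqrtr// sumr_ge0// => i _; exact: sqr_ge0. Qed.

Lemma enorm0 : enorm (0 : 'rV[R]_d) = 0.
Proof. by rewrite /enorm big1 ?sqrtr0// => i _; rewrite mxE expr0n. Qed.

Lemma enormN v : enorm (- v) = enorm v.
Proof. by rewrite /enorm; congr Num.sqrt; apply: eq_bigr => i _; rewrite mxE sqrrN. Qed.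

Lemma enorm_distC u v : enorm (u - v) = enorm (v - u).
Proof. by rewrite -enormN opprB. Qed.

Lemma enormZ (k : R) v : enorm (k *: v) = `|k| * enorm v.
Proof.
rewrite /enorm -sqrtr_sqr -sqrtrM ?sqr_ge0// mulr_sumr; congr Num.sqrt.
by apply: eq_bigr => i _; rewrite mxE exprMn.
Qed.

Lemma coord_le_enorm v i : `|v ord0 i| <= enorm v.
Proof.
rewrite -sqrtr_sqr ler_wsqrtr// (bigD1 i)//= lerDl sumr_ge0// => j _.
exact: sqr_ge0.
Qed.

Lemma enorm_eq0 v : enorm v = 0 -> v = 0.
Proof.
move=> v0; apply/rowP => i; rewrite mxE; apply/eqP; rewrite -normr_le0 -v0.
exact: coord_le_enorm.
Qed.

Lemma enorm_dot u v : \sum_(i < d) u ord0 i * v ord0 i <= enorm u * enorm v.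
Proof.
have [/enorm_eq0 ->|u0] := eqVneq (enorm u) 0.
  by rewrite enorm0 mul0r big1// => i _; rewrite mxE mul0r.
have [/enorm_eq0 ->|v0] := eqVneq (enorm v) 0.
  by rewrite enorm0 mulr0 big1// => i _; rewrite mxE mulr0.
have p0 : 0 < enorm u * enorm v by rewrite mulr_gt0// lt0r enorm_ge0 ?u0 ?v0.
rewrite -(ler_pM2l p0) -(ler_pM2l (ltr0n R 2)).
set A := enorm u in p0 *; set B := enorm v in p0 *.
(* The inequality now reduces, coordinate by coordinate, to (B u_i - A v_i)^2 >= 0. *)
have -> : 2 * (A * B * (A * B)) =
    \sum_(i < d) (B ^+ 2 * u ord0 i ^+ 2 + A ^+ 2 * v ord0 i ^+ 2).
  by rewrite big_split/= -!mulr_sumr -!enorm_sqr -/A -/B; ring.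
rewrite !mulr_sumr ler_sum// => i _.
by have := sqr_ge0 (B * u ord0 i - A * v ord0 i); nra.
Qed.

Lemma enormD u v : enorm (u + v) <= enorm u + enorm v.
Proof.
rewrite -(@ler_pXn2r _ 2)// ?nnegrE ?addr_ge0 ?enorm_ge0//.
rewrite sqrrD !enorm_sqr (_ : \sum_(i < d) (u + v) ord0 i ^+ 2 =
  \sum_(i < d) u ord0 i ^+ 2 + (\sum_(i < d) u ord0 i * v ord0 i) *+ 2 +
  \sum_(i < d) v ord0 i ^+ 2).
  by rewrite lerD2r lerD2l lerMn2r enorm_dot.
rewrite -sumrMnl -!big_split/=; apply: eq_bigr => i _.
by rewrite !mxE sqrrD.
Qed.

Lemma enorm_triangle u v w : enorm (u - w) <= enorm (u - v) + enorm (v - w).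
Proof. by have := enormD (u - v) (v - w); rewrite addrA subrK. Qed.

Lemma enorm_dist_dist u v w : `|enorm (u - w) - enorm (v - w)| <= enorm (u - v).
Proof.
by have := enorm_triangle u v w; have := enorm_triangle v u w;
  rewrite (enorm_distC v u) ler_norml; lra.
Qed.

Lemma enorm_dist_norm u v : `|enorm u - enorm v| <= enorm (u - v).
Proof. by have := enorm_dist_dist u v 0; rewrite !subr0. Qed.

Lemma normr_le_enorm v : `|v| <= enorm v.
Proof.
rewrite [`|v|]mx_normrE; apply: bigmax_le => [|[i j] _]; first exact: enorm_ge0.
by rewrite /= (ord1 i) coord_le_enorm.
Qed.

Lemma coord_le_normr v i : `|v ord0 i| <= `|v|.
Proof. by rewrite [`|v|]mx_normrE; apply: (le_bigmax _ _ (ord0, i)). Qed.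

Lemma enorm_le_normr v : enorm v <= d%:R * `|v|.
Proof.
rewrite -(@ler_pXn2r _ 2)// ?nnegrE ?mulr_ge0 ?enorm_ge0//.
rewrite enorm_sqr; apply: (@le_trans _ _ (\sum_(i < d) `|v| ^+ 2)).
  apply: ler_sum => i _; rewrite -(@real_normK _ (v ord0 i)) ?num_real//.
  by rewrite ler_pXn2r ?nnegrE// coord_le_normr.
rewrite sumr_const card_ord exprMn -[X in X <= _]mulr_natl ler_wpM2r ?sqr_ge0//.
by rewrite -natrX ler_nat; case: d => // n; rewrite leq_pmulr.
Qed.

Lemma continuous_enorm : continuous (@enorm R d).
Proof.
move=> v; apply/(@cvgrPdist_lt _ R^o _ _ (nbhs_filter v)) => e e0.
(* The added 1 keeps the divisor positive when [d] is 0. *)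
have d0 : 0 < d%:R + 1 :> R by rewrite ltr_wpDl.
have : \forall w \near v, ball v (e / (d%:R + 1)) w.
  by apply: nbhsx_ballx; rewrite divr_gt0.
apply: filterS => w; rewrite -ball_normE/= ltr_pdivlMr// => vw.
apply: le_lt_trans (enorm_dist_norm _ _) _.
apply: le_lt_trans (enorm_le_normr _) _; apply: le_lt_trans vw.
by rewrite mulrDr mulr1 mulrC lerDl.
Qed.

End enorm.

(** * Borel sets of R^d generated by half-spaces *)

Section borel_rV.
Context (R : realType) (d : nat).

(** An explicit Archimedean witness, for countable unions over 1/(n+1) in place of unions over all e
    > 0. *)
Lemma truncnV_lt (e : R) : 0 < e -> (Num.truncn e^-1).+1%:R^-1 < e.
Proof.
move=> e0; rewrite invf_plt ?posrE//.
by have := @Num.Theory.truncn_itv R e^-1; rewrite invr_ge0 ltW// => /(_ isT)/andP[].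
Qed.

(** A generator small enough that measurability of maps and the Caratheodory property only have to
    be checked on coordinates. *)
Definition half_spaces : set (set 'rV[R]_d) :=
  [set A | exists (i : 'I_d) (c : R), A = [set x : 'rV[R]_d | x ord0 i < c]].

Local Notation halfT := (g_sigma_algebraType half_spaces).

Lemma half_space_gt i c :
  measurable ([set x : 'rV[R]_d | c < x ord0 i] : set halfT).
Proof.
have -> : [set x : 'rV[R]_d | c < x ord0 i] =
    \bigcup_n ~` [set x : 'rV[R]_d | x ord0 i < c + n.+1%:R^-1].
  apply/seteqP; split=> x /=.
    rewrite -subr_gt0 => cx; exists (Num.truncn (x ord0 i - c)^-1) => //=.
    by apply/negP; rewrite -leNgt -lerBrDl ltW// truncnV_lt.
  move=> [n _ /= /negP]; rewrite -leNgt; apply: lt_le_trans.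
  by rewrite ltrDl invr_gt0.
apply: bigcupT_measurable => n; apply: measurableC.
by apply: sub_sigma_algebra; exists i, (c + n.+1%:R^-1).
Qed.

Definition box (c : 'rV[R]_d) (r : R) : set 'rV[R]_d :=
  [set x | forall i, `|x ord0 i - c ord0 i| < r].

Lemma measurable_box c r : measurable (box c r : set halfT).
Proof.
have -> : box c r = \big[setI/setT]_(i < d)
    ([set x : 'rV[R]_d | x ord0 i < c ord0 i + r] `&`
     [set x : 'rV[R]_d | c ord0 i - r < x ord0 i]).
  rewrite -bigcap_seq/=.
  apply/seteqP; split => x /= H i => [_|] /=.
    by have := H i; rewrite ltr_distl => /andP[].
  have /= := H i; rewrite mem_index_enum => /(_ isT)[H1 H2].
  by rewrite ltr_distl H1 H2.
apply: bigsetI_measurable => i _; apply: measurableI.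
  by apply: sub_sigma_algebra; exists i, (c ord0 i + r).
exact: half_space_gt.
Qed.

(** [U] is the union of the boxes with rational centre and radius 1/(n+1) that it contains; [m]
    enumerates the centres. *)
Lemma measurable_open_half_spaces (U : set 'rV[R]_d) :
  open U -> measurable (U : set halfT).
Proof.
move=> oU.
pose rv (q : 'rV[rat]_d) : 'rV[R]_d := map_mx ratr q.
have -> : U = \bigcup_n \bigcup_m
    (if unpickle m is Some q then
       if `[< box (rv q) n.+1%:R^-1 `<=` U >] then box (rv q) n.+1%:R^-1
       else set0 else set0).
  apply/seteqP; split => [x Ux|x].
    have : nbhs x U by exact: open_nbhs_nbhs.
    rewrite -nbhs_ballE => -[e /= e0 eU].
    pose n := Num.truncn (e / 2)^-1.
    have ne : n.+1%:R^-1 < e / 2 by rewrite truncnV_lt// divr_gt0.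
    have n0 : 0 < n.+1%:R^-1 :> R by rewrite invr_gt0.
    have /choice[q Hq] : forall i, exists q : rat,
        `|x ord0 i - ratr q| < n.+1%:R^-1.
      move=> i; have [|q] := @rat_in_itvoo R (x ord0 i - n.+1%:R^-1)
        (x ord0 i + n.+1%:R^-1).
        by rewrite ltrBlDr -addrA ltrDl addr_gt0.
      by rewrite in_itv/= => qx; exists q; rewrite distrC ltr_distl.
    exists n => //; exists (pickle (\row_i q i)) => //; rewrite pickleK.
    have xb : box (rv (\row_i q i)) n.+1%:R^-1 x by move=> i; rewrite !mxE.
    case: asboolP => //; apply; move=> y yb; apply: eU.
    rewrite -ball_normE/=.
    apply: le_lt_trans (_ : _ <= n.+1%:R^-1 + n.+1%:R^-1) _; last first.
      by rewrite [ltRHS]splitr ltrD.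
    rewrite [X in X <= _]mx_normrE; apply: bigmax_le => [|[k i] _].
      by rewrite addr_ge0// ltW.
    rewrite (ord1 k) !mxE/=.
    have := yb i; have := xb i; rewrite !mxE => /ltW h1 /ltW h2.
    apply: le_trans (lerD h1 h2).
    by rewrite (distrC (y ord0 i)) ler_distD.
  move=> [n _ [m _]]; case: unpickle => // q; case: asboolP => // + xq.
  exact.
apply: bigcupT_measurable => n; apply: bigcupT_measurable => m.
case: unpickle => [q|] => //.
by case: asboolP => _ //; exact: measurable_box.
Qed.

Lemma borel_half_spaces (A : set 'rV[R]_d) :
  measurable (A : set (borel 'rV[R]_d)) -> measurable (A : set halfT).
Proof.
by apply: smallest_sub; [exact: smallest_sigma_algebra|
  exact: measurable_open_half_spaces].
Qed.

End borel_rV.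

Lemma measurable_fun_rV d0 (T : measurableType d0) (R : realType) (d : nat)
    (f : T -> 'rV[R]_d) :
  (forall i, measurable_fun setT (fun t => f t ord0 i)) ->
  measurable_fun setT (f : T -> borel 'rV[R]_d).
Proof.
move=> mf _ A /borel_half_spaces; rewrite setTI.
move: A; apply: smallest_sub.
  split=> [|A /= mA|F /= mF].
  - by rewrite preimage_set0.
  - by rewrite setTD preimage_setC; exact: measurableC.
  - by rewrite preimage_bigcup; exact: bigcupT_measurable.
move=> _ [i [c ->]]; rewrite -[X in measurable X]setTI.
rewrite (_ : f @^-1` _ = (fun t => f t ord0 i) @^-1` `]-oo, c[); last first.
  by apply/seteqP; split => t /=; rewrite in_itv.
exact: mf.
Qed.

(** * Hausdorff measure *)

Section hausdorff_outer_measure.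
Local Open Scope ereal_scope.
Context (R : realType) (d : nat).
Implicit Types (A B : set 'rV[R]_d) (r delta : R).

Lemma ediam_ge0 A : 0 <= ediam A.
Proof. by apply: ereal_sup_ubound; left. Qed.

Lemma enorm_le_ediam A x y : A x -> A y -> (enorm (x - y)%R)%:E <= ediam A.
Proof.
by move=> Ax Ay; apply: ereal_sup_ubound; right; exists (x, y).
Qed.

Lemma ediam_le A r : (0 <= r)%R ->
  (forall x y, A x -> A y -> (enorm (x - y) <= r)%R) -> ediam A <= r%:E.
Proof.
move=> r0 Ar; apply: ge_ereal_sup => _ [->|[[x y] [/= Ax Ay] <-]].
  by rewrite lee_fin.
by rewrite lee_fin; exact: Ar.
Qed.

Lemma le_ediam A B : A `<=` B -> ediam A <= ediam B.
Proof.
move=> AB; apply: le_ereal_sup => _ [->|[[x y] [/= Ax Ay] <-]]; first by left.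
by right; exists (x, y) => //; split; exact: AB.
Qed.

Lemma ediam0 : ediam (set0 : set 'rV[R]_d) = 0.
Proof.
by apply/eqP; rewrite eq_le ediam_ge0 andbT; apply: ediam_le => //.
Qed.

(* The sigma-algebra of all sets makes every cover admissible in [mu_ext]. *)
Local Notation allT := (g_sigma_algebraType [set: set 'rV[R]_d]).

(** The value +oo on large sets moves the bound on diameters from the covers into the set function,
    so that [hausdorff1_delta] becomes the outer measure generated by it. *)
Definition ediam_cut delta (A : set allT) : \bar R :=
  if ediam A <= delta%:E then ediam A else +oo.

Lemma ediam_cut_ge0 delta A : 0 <= ediam_cut delta A.
Proof. by rewrite /ediam_cut; case: ifPn => // _; exact: ediam_ge0. Qed.

Lemma ediam_cut0 delta : (0 < delta)%R -> ediam_cut delta set0 = 0.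
Proof. by move=> d0; rewrite /ediam_cut ediam0 lee_fin ltW. Qed.

Lemma hausdorff1_deltaE delta : (0 < delta)%R ->
  hausdorff1_delta delta = mu_ext (ediam_cut delta).
Proof.
move=> d0; apply/funext => A; apply/eqP; rewrite eq_le; apply/andP; split.
  apply: le_ereal_inf_tmp => _ [U [mU AU] <-].
  have [[n Un]|/forallNP Uf] := pselect (exists n, ~ ediam (U n) <= delta%:E).
    rewrite (@eseries_pinfty _ _ _ n) ?leey// => [k _|].
      by rewrite -ltNye; apply: lt_le_trans (ediam_cut_ge0 _ _).
    by rewrite /ediam_cut; case: ifPn.
  have {}Uf n : ediam (U n) <= delta%:E by apply: contrapT; exact: Uf.
  apply: ereal_inf_lbound; exists U => //.
  by apply: eq_eseriesr => n _; rewrite /ediam_cut Uf.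
apply: le_ereal_inf_tmp => _ [U [AU Uf] <-].
apply: ereal_inf_lbound; exists U; first split => //.
  by move=> k; apply: sub_sigma_algebra.
by apply: eq_eseriesr => n _; rewrite /ediam_cut Uf.
Qed.

Lemma le_hausdorff1_delta delta A B : A `<=` B ->
  hausdorff1_delta delta A <= hausdorff1_delta delta B.
Proof.
move=> AB; apply: le_ereal_inf => _ [U [BU Uf] <-]; exists U => //.
by split => //; exact: subset_trans BU.
Qed.

Lemma hausdorff1_delta_antitone delta delta' A : (delta <= delta')%R ->
  hausdorff1_delta delta' A <= hausdorff1_delta delta A.
Proof.
move=> dd; apply: le_ereal_inf => _ [U [BU Uf] <-]; exists U => //.
by split => // n; apply: le_trans (Uf n) _; rewrite lee_fin.
Qed.

Lemma hausdorff1_delta_le_cover delta (U : (set 'rV[R]_d)^nat) A :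
  A `<=` \bigcup_n U n -> (forall n, ediam (U n) <= delta%:E) ->
  hausdorff1_delta delta A <= \sum_(n <oo) ediam (U n).
Proof. by move=> AU Uf; apply: ereal_inf_lbound; exists U. Qed.

Lemma hausdorff1_delta_le delta A : (0 < delta)%R ->
  hausdorff1_delta delta A <= hausdorff1 A.
Proof. by move=> d0; apply: ereal_sup_ubound; exists delta. Qed.

Lemma hausdorff1_le A (M : \bar R) :
  (forall delta, (0 < delta)%R -> hausdorff1_delta delta A <= M) ->
  hausdorff1 A <= M.
Proof. by move=> H; apply: ge_ereal_sup => _ [e /= e0 <-]; exact: H. Qed.

Lemma hausdorff1_ge0 A : 0 <= hausdorff1 A.
Proof.
apply: le_trans (hausdorff1_delta_le A (ltr01 : (0 < 1 :> R)%R)).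
by rewrite hausdorff1_deltaE//; apply: mu_ext_ge0; exact: ediam_cut_ge0.
Qed.

Lemma hausdorff1_set0 : hausdorff1 (set0 : set 'rV[R]_d) = 0.
Proof.
apply/eqP; rewrite eq_le hausdorff1_ge0 andbT; apply: hausdorff1_le => e e0.
rewrite hausdorff1_deltaE// mu_ext0//; first exact: ediam_cut0.
exact: ediam_cut_ge0.
Qed.

Lemma le_hausdorff1 A B : A `<=` B -> hausdorff1 A <= hausdorff1 B.
Proof.
move=> AB; apply: hausdorff1_le => e e0.
by apply: le_trans (hausdorff1_delta_le _ e0); exact: le_hausdorff1_delta.
Qed.

Lemma hausdorff1_sigma_subadditive :
  sigma_subadditive (@hausdorff1 R d).
Proof.
move=> F; apply: hausdorff1_le => e e0.
apply: (@le_trans _ _ (\sum_(n <oo) hausdorff1_delta e (F n))).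
  rewrite hausdorff1_deltaE//.
  exact: (@mu_ext_sigma_subadditive _ allT R _ (@ediam_cut_ge0 e) F).
apply: lee_nneseries => n _.
  by move=> _; rewrite hausdorff1_deltaE//; apply: mu_ext_ge0; exact: ediam_cut_ge0.
exact: hausdorff1_delta_le.
Qed.

HB.instance Definition _ := isOuterMeasure.Build R 'rV[R]_d (@hausdorff1 R d)
  hausdorff1_set0 hausdorff1_ge0 le_hausdorff1 hausdorff1_sigma_subadditive.

End hausdorff_outer_measure.

Section hausdorff_metric.
Local Open Scope ereal_scope.
Context (R : realType) (d : nat).
Implicit Types (A B X : set 'rV[R]_d) (e delta : R).

(** A set of diameter at most delta < e cannot meet both [A] and [B], so a cover of the union splits
    into a cover of each. *)
Lemma hausdorff1_delta_separated A B e delta : (delta < e)%R ->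
  (forall x y, A x -> B y -> (e <= enorm (x - y))%R) ->
  hausdorff1_delta delta A + hausdorff1_delta delta B
    <= hausdorff1_delta delta (A `|` B).
Proof.
move=> de AB; apply: le_ereal_inf_tmp => _ [U [ABU Ud] <-].
pose UA n := if `[< U n `&` A !=set0 >] then U n else set0.
pose UB n := if `[< U n `&` A !=set0 >] then set0 else U n.
have Ud0 : ediam (set0 : set 'rV[R]_d) <= delta%:E.
  by apply: le_trans (Ud 0%N); exact: le_ediam.
apply: (@le_trans _ _
  (\sum_(n <oo) ediam (UA n) + \sum_(n <oo) ediam (UB n))).
  apply: leeD; (apply: hausdorff1_delta_le_cover; [move=> x|]).
  - move=> Ax; have [n _ Unx] := ABU x (or_introl Ax).
    by exists n => //; rewrite /UA asboolT//; exists x.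
  - by move=> n; rewrite /UA; case: ifP.
  - move=> Bx; have [n _ Unx] := ABU x (or_intror Bx).
    exists n => //; rewrite /UB asboolF// => -[y [Uny Ay]].
    have := le_trans (enorm_le_ediam Uny Unx) (Ud n).
    by rewrite lee_fin leNgt (lt_le_trans de)// AB.
  - by move=> n; rewrite /UB; case: ifP.
rewrite -nneseriesD; [|by move=> *; exact: ediam_ge0..].
apply: lee_nneseries => n _; first by move=> _; rewrite adde_ge0// ediam_ge0.
by rewrite /UA /UB; case: ifP; rewrite ediam0 ?adde0 ?add0e.
Qed.

(** Given scales [a] and [b] for the two suprema, a common finer scale [c] below [e] can only
    increase the approximations. *)
Lemma hausdorff1_separated A B e : (0 < e)%R ->
  (forall x y, A x -> B y -> (e <= enorm (x - y))%R) ->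
  hausdorff1 A + hausdorff1 B <= hausdorff1 (A `|` B).
Proof.
move=> e0 AB.
have [->|ABoo] := eqVneq (hausdorff1 (A `|` B)) +oo; first by rewrite leey.
have fin C : C `<=` A `|` B -> hausdorff1 C \is a fin_num.
  move=> /le_hausdorff1 CAB; rewrite ge0_fin_numE ?hausdorff1_ge0//.
  by apply: le_lt_trans CAB _; rewrite ltey.
have fA : hausdorff1 A \is a fin_num by apply: fin; left.
have fB : hausdorff1 B \is a fin_num by apply: fin; right.
rewrite -leeBrDr//; apply: hausdorff1_le => a a0.
have fa : hausdorff1_delta a A \is a fin_num.
  have ge : 0 <= hausdorff1_delta a A.
    by rewrite hausdorff1_deltaE//; apply: mu_ext_ge0; exact: ediam_cut_ge0.
  rewrite ge0_fin_numE//; apply: le_lt_trans (hausdorff1_delta_le A a0) _.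
  by rewrite ltey_eq fA.
rewrite leeBrDr// addeC -leeBrDr//; apply: hausdorff1_le => b b0.
rewrite leeBrDr// addeC.
pose c := Num.min (Num.min a b) (e / 2)%R.
have c0 : (0 < c)%R by rewrite !lt_min a0 b0 divr_gt0.
have ce : (c < e)%R.
  by rewrite gt_min ltr_pdivrMr// ltr_pMr// ltr1n orbT.
apply: le_trans (hausdorff1_delta_le _ c0).
apply: le_trans (hausdorff1_delta_separated ce AB).
by apply: leeD; apply: hausdorff1_delta_antitone; rewrite /c !ge_min lexx ?orbT.
Qed.

(** Caratheodory's criterion for metric outer measures. The layers [r j] approach the hyperplane;
    layers of the same parity are at positive distance from each other, so each parity sum is at
    most the measure of [X]. The series over all layers therefore converges, and its tail bounds
    what is lost by staying at distance 1/(N+2) from the hyperplane. *)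
Lemma caratheodory_half_space (i : 'I_d) (c : R) :
  (@hausdorff1 R d).-caratheodory [set x : 'rV[R]_d | (x ord0 i < c)%R].
Proof.
apply: le_caratheodory_measurable => X.
change (hausdorff1 (X `&` [set x : 'rV[R]_d | (x ord0 i < c)%R]) +
  hausdorff1 (X `&` ~` [set x : 'rV[R]_d | (x ord0 i < c)%R]) <= hausdorff1 X).
(* The signed distance to the hyperplane: a gap between values of [u] is a gap in norm. *)
pose u (x : 'rV[R]_d) : R := (c - x ord0 i)%R.
have u_lip x y : (u x - u y <= enorm (x - y))%R.
  apply: le_trans (coord_le_enorm (x - y) i); rewrite !mxE /u.
  by rewrite -normrN ler_normr; apply/orP; left; lra.
have [->|XooN] := eqVneq (hausdorff1 X) +oo; first by rewrite leey.
pose V (r : R) := X `&` [set x | (r < u x)%R].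
pose r j := X `&` [set x | (j.+3%:R^-1 < u x <= j.+2%:R^-1)%R].
(* [b] is 0 for the even layers and 1 for the odd ones; the skipped layer provides the gap 1/(m+1) -
   1/(m+2). *)
have sumr (b n : nat) : \sum_(k < n) hausdorff1 (r (k.*2 + b)%N) <=
    hausdorff1 (V (n.*2 + b).+1%:R^-1%R).
  elim: n => [|n IH]; first by rewrite big_ord0 hausdorff1_ge0.
  rewrite big_ord_recr/=; apply: le_trans (leeD2r _ IH) _.
  pose m := (n.*2 + b)%N; rewrite doubleS !addSn -/m.
  have em : (0 < m.+1%:R^-1 - m.+2%:R^-1 :> R)%R.
    by rewrite subr_gt0 ltf_pV2 ?posrE// ltr_nat.
  apply: le_trans (hausdorff1_separated em _) _.
    move=> x y [_ /= Vx] [_ /= /andP[_ ry]].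
    by apply: le_trans (u_lip x y); rewrite lerB// ltW.
  apply: le_hausdorff1 => x [[Xx /= Vx]|[Xx /andP[]]]; split => //=.
  by apply: lt_trans Vx; rewrite ltf_pV2 ?posrE// ltr_nat; lia.
have sumrX n : \sum_(0 <= j < n) hausdorff1 (r j) <= hausdorff1 X + hausdorff1 X.
  apply: (@le_trans _ _ (\sum_(k < n) (hausdorff1 (r k.*2) + hausdorff1 (r k.*2.+1)))).
    rewrite (_ : \sum_(k < n) _ = \sum_(0 <= j < n.*2) hausdorff1 (r j)).
      apply: lee_sum_nneg_natr => [k _ _|]; first exact: hausdorff1_ge0.
      by rewrite -addnn leq_addr.
    elim: n => [|n IH]; first by rewrite big_ord0 big_geq.
    by rewrite big_ord_recr/= IH doubleS !big_nat_recr//= addeA.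
  rewrite big_split/=; apply: leeD.
    rewrite (eq_bigr (fun k : 'I_n => hausdorff1 (r (k.*2 + 0)%N))) => [|k _].
      by apply: le_trans (sumr 0%N n) _; apply: le_hausdorff1 => x [].
    by rewrite addn0.
  rewrite (eq_bigr (fun k : 'I_n => hausdorff1 (r (k.*2 + 1)%N))) => [|k _].
    by apply: le_trans (sumr 1%N n) _; apply: le_hausdorff1 => x [].
  by rewrite addn1.
have Xfin : hausdorff1 X \is a fin_num.
  by rewrite ge0_fin_numE ?hausdorff1_ge0// ltey.
have soo : \sum_(0 <= j <oo) hausdorff1 (r j) < +oo.
  apply: (@le_lt_trans _ _ (hausdorff1 X + hausdorff1 X)).
    apply: lime_le.
      by apply: is_cvg_nneseries => *; exact: hausdorff1_ge0.
    by apply: nearW => n; exact: sumrX.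
  by rewrite ltey_eq fin_numD Xfin.
apply/lee_addgt0Pr => e e0.
have := nneseries_tail_cvg soo (fun k _ => hausdorff1_ge0 _).
move=> /fine_cvgP[fint /cvgrPdist_lt/(_ e e0) lte].
have [N HN] : exists N, \sum_(N <= k <oo) hausdorff1 (r k) <= e%:E.
  have [N _ HN] := filterI fint lte; exists N.
  have [/fineK <-] := HN N (leqnn N).
  by rewrite sub0r normrN lee_fin => /ltW; apply: le_trans; exact: ler_norm.
have XV : X `&` [set x : 'rV[R]_d | (x ord0 i < c)%R] `<=`
    V N.+2%:R^-1%R `|` \bigcup_(n in ~` `I_N) r n.
  move=> x [Xx /= xc]; have u0 : (0 < u x)%R by rewrite subr_gt0.
  have [uN|uN] := ltP N.+2%:R^-1%R (u x); [by left|right].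
  have ex : exists n, (n.+3%:R^-1 < u x)%R.
    exists (Num.truncn (u x)^-1); apply: lt_trans (truncnV_lt u0).
    by rewrite ltf_pV2 ?posrE// ltr_nat.
  case: (ex_minnP ex) => n un nmin.
  have nu : (u x <= n.+2%:R^-1)%R.
    case: n nmin un => [|n] nmin un.
      by apply: le_trans uN _; rewrite lef_pV2 ?posrE// ler_nat.
    by rewrite leNgt; apply/negP => /nmin; rewrite ltnn.
  exists n; last by split => //=; rewrite un.
  apply/negP; rewrite -leqNgt.
  by have := lt_le_trans un uN; rewrite ltf_pV2 ?posrE// ltr_nat !ltnS.
apply: (@le_trans _ _ ((hausdorff1 (V N.+2%:R^-1%R) + e%:E) +
  hausdorff1 (X `&` ~` [set x : 'rV[R]_d | (x ord0 i < c)%R]))).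
  apply: leeD2r; apply: le_trans (le_hausdorff1 XV) _.
  apply: le_trans (outer_measureU2 (@hausdorff1 R d) _ _) _; apply: leeD2l.
  apply: le_trans HN.
  exact: (outer_measure_sigma_subadditive_tail (@hausdorff1 R d)).
rewrite addeAC; apply: leeD2r.
apply: le_trans (hausdorff1_separated (e := N.+2%:R^-1%R) _ _) _.
- by rewrite invr_gt0.
- move=> x y [_ /= Vx] [_ /= /negP]; rewrite -leNgt => yc.
  apply: le_trans (u_lip x y); apply: le_trans (ltW Vx) _.
  by rewrite lerBrDr gerDl /u subr_le0.
- by apply: le_hausdorff1 => x [[]|[]].
Qed.

Lemma caratheodory_borel (A : set (borel 'rV[R]_d)) : measurable A ->
  (@hausdorff1 R d).-caratheodory A.
Proof.
move=> /borel_half_spaces; apply: smallest_sub => [|_ [i [c ->]]].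
  split=> [|B mB|F mF].
  - exact: caratheodory_measurable_set0.
  - by rewrite setTD; exact: caratheodory_measurable_setC.
  - exact: caratheodory_measurable_bigcup.
exact: caratheodory_half_space.
Qed.

Lemma hausdorff1_semi_sigma_additive :
  semi_sigma_additive (@hausdorff1 R d).
Proof.
move=> F mF tF mUF.
apply: (@caratheodory_measure_sigma_additive R 'rV[R]_d
  (@hausdorff1 R d) F) => //.
- by move=> n; exact: caratheodory_borel.
- exact: (caratheodory_borel mUF).
Qed.

HB.instance Definition _ := isMeasure.Build _ (borel 'rV[R]_d) R
  (@hausdorff1 R d) (@hausdorff1_set0 R d) (@hausdorff1_ge0 R d)
  hausdorff1_semi_sigma_additive.

End hausdorff_metric.

Section hausdorff_bounds.
Local Open Scope ereal_scope.
Context (R : realType) (d : nat).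

(** A 1-Lipschitz map does not increase diameters, so a cover of [E] yields intervals of no larger
    length that cover [0, r[. *)
Lemma hausdorff1_lip_ge (E : set 'rV[R]_d) (phi : 'rV[R]_d -> R) (r : R) :
  (forall x y, (`|phi x - phi y| <= enorm (x - y))%R) ->
  `[0%R, r[ `<=` phi @` E -> r%:E <= hausdorff1 E.
Proof.
move=> lphi rE; apply: le_trans (hausdorff1_delta_le E (ltr01 : (0 < 1 :> R)%R)).
apply: le_ereal_inf_tmp => _ [U [EU U1] <-].
pose B n := phi @` (E `&` U n).
(* The closed hull is measurable even if the image is not; an empty image is set apart because [inf]
   and [sup] would be default values. *)
pose I n : set R := if `[< B n !=set0 >] then `[inf (B n), sup (B n)]%classic else set0.
have mI n : measurable (I n) by rewrite /I; case: ifP.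
have fU n : ediam (U n) = (fine (ediam (U n)))%:E.
  rewrite fineK// ge0_fin_numE ?ediam_ge0//.
  by apply: le_lt_trans (U1 n) _; rewrite ltey.
have BD n b b' : B n b -> B n b' -> (b - fine (ediam (U n)) <= b')%R.
  move=> [x [Ex Ux] <-] [y [Ey Uy] <-].
  have := enorm_le_ediam Ux Uy; rewrite fU lee_fin => xy.
  by have := le_trans (lphi x y) xy; rewrite ler_norml; lra.
have lbB n : B n !=set0 -> has_lbound (B n).
  by move=> [b Bb]; exists (b - fine (ediam (U n)))%R => b' Bb'; exact: BD.
have ubB n : B n !=set0 -> has_ubound (B n).
  move=> [b Bb]; exists (b + fine (ediam (U n)))%R => b' Bb'.
  by rewrite -lerBlDr; exact: BD.
have leI n : lebesgue_measure (I n) <= ediam (U n).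
  rewrite /I; case: asboolP => [B0|_]; last by rewrite measure0 ediam_ge0.
  rewrite lebesgue_measure_itv/= lte_fin; case: ifPn => _; last exact: ediam_ge0.
  rewrite -EFinB fU lee_fin lerBlDr; apply: ge_sup => // b Bb.
  rewrite -lerBlDl; apply: lb_le_inf => // b' Bb'; exact: BD.
have rI : `[0%R, r[ `<=` \bigcup_n I n.
  move=> t /rE [x Ex xt]; have [n _ Unx] := EU _ Ex; exists n => //.
  have Bt : B n t by exists x.
  rewrite /I asboolT; last by exists t.
  rewrite /= in_itv/= ge_inf ?ub_le_sup//.
  - by apply: ubB; exists t.
  - by apply: lbB; exists t.
have [r0|r0] := leP r 0%R.
  by apply: (@le_trans _ _ 0); rewrite ?lee_fin//; apply: nneseries_ge0 => *; exact: ediam_ge0.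
have -> : r%:E = @lebesgue_measure R `[0%R, r[.
  by rewrite lebesgue_measure_itv/= lte_fin r0 sube0.
apply: (@le_trans _ _ (\sum_(n <oo) @lebesgue_measure R (I n))).
  by apply: measure_sigma_subadditive.
by apply: lee_nneseries.
Qed.

End hausdorff_bounds.

(** * Metric speed of Lipschitz curves *)

Section nondecreasing_lipschitz.
Local Open Scope ereal_scope.
Context (R : realType) (F : R -> R).
Hypothesis F_nd : forall x y, (x <= y)%R -> (F x <= F y)%R.
Hypothesis F_lip : forall x y, (x <= y)%R -> (F y - F x <= y - x)%R.

Local Notation leb := (@lebesgue_measure R).

(** The Stieltjes measures of [F] and [G] add up to Lebesgue measure, which therefore dominates the
    first one. *)
Let G (x : R) : R := (x - F x)%R.

Let F_dist x y : (`|F x - F y| <= `|x - y|)%R.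
Proof.
wlog xy : x y / (x <= y)%R.
  move=> H; have [|/ltW] := leP x y; first exact: H.
  by rewrite distrC (distrC x); exact: H.
by rewrite distrC (distrC x) !ger0_norm ?subr_ge0 ?F_nd// F_lip.
Qed.

Let cF : continuous F.
Proof.
move=> x; apply/(@cvgrPdist_lt _ R^o) => e e0.
near=> y; apply: le_lt_trans (F_dist x y) _.
by near: y; apply: cvgr_dist_lt.
Unshelve. all: by end_near. Qed.

Let G_nd : {homo G : x y / (x <= y)%R}.
Proof. by move=> x y xy; rewrite /G; have := F_lip xy; lra. Qed.

Let G_rc : right_continuous G.
Proof.
apply/right_continuousW => x; apply: (@cvgB _ R^o); first exact: cvg_id.
exact: cF.
Qed.

Let F_rc : right_continuous F.
Proof. exact/right_continuousW/cF. Qed.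

HB.instance Definition _ := isCumulative.Build R _ R F F_nd F_rc.
HB.instance Definition _ := isCumulative.Build R _ R G G_nd G_rc.

Let muF : {measure set (measurableTypeR R) -> \bar R} :=
  lebesgue_stieltjes_measure (F : cumulative R R).
Let muG : {measure set (measurableTypeR R) -> \bar R} :=
  lebesgue_stieltjes_measure (G : cumulative R R).

Let ls_itv (f : cumulative R R) (a b : R) : (a <= b)%R ->
  lebesgue_stieltjes_measure f `]a, b] = (f b - f a)%:E.
Proof.
move=> ab; rewrite /lebesgue_stieltjes_measure /measure_extension/=.
rewrite measurable_mu_extE//; last exact: is_ocitv.
exact: wlength_itv_bnd.
Qed.

Let muF_le (A : set (measurableTypeR R)) : measurable A -> muF A <= leb A.
Proof.
pose m : {measure set (measurableTypeR R) -> \bar R} := measure_add muF muG.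
have mE B : m B = muF B + muG B by exact: (measure_addE muF muG B).
move=> mA; rewrite (@lebesgue_measure_unique R m) ?mE ?leeDl//.
move=> X /ocitvP[->|[[u v] /= uv ->]]; first by rewrite !measure0.
rewrite [RHS](mE `]u, v]%classic) /lebesgue_measure [LHS]ls_itv ?ltW//.
have -> : muF `]u, v]%classic = (F v - F u)%:E by exact: (ls_itv _ (ltW uv)).
have -> : muG `]u, v]%classic = (G v - G u)%:E by exact: (ls_itv _ (ltW uv)).
by rewrite -EFinD; congr EFin; rewrite /idfun /G/=; lra.
Qed.

(** Being dominated by Lebesgue measure, the Stieltjes measure of [F] has a Radon-Nikodym density,
    and Lebesgue differentiation identifies it with the derivative almost everywhere. *)
Lemma nondecreasing_lipschitz_density (a b : R) : (a < b)%R ->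
  exists h : R -> R, [/\ measurable_fun setT h,
    leb.-integrable setT (EFin \o h),
    (F b - F a)%:E = \int[leb]_(t in `]a, b]) (h t)%:E &
    {ae leb, forall x, (a < x < b)%R -> is_derive (x : R^o) 1%R (F : R^o -> R^o) (h x)}].
Proof.
move=> ab; pose D : set (measurableTypeR R) := `]a, b]%classic.
have mD : measurable D by exact: measurable_itv.
have muFE x y : (x <= y)%R -> muF `]x, y]%classic = (F y - F x)%:E.
  exact: ls_itv.
have Doo : muF D < +oo by rewrite muFE ?ltW// ltey.
pose nu : {finite_measure set (measurableTypeR R) -> \bar R} := mfrestr mD Doo.
have nuE B : nu B = muF (B `&` D) by [].
have nuleb : nu `<< leb.
  apply/null_content_dominatesP => A mA A0; apply/eqP.
  rewrite eq_le measure_ge0 andbT -A0; apply: le_trans (muF_le mA).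
  by rewrite nuE le_measure// ?inE//; exact: measurableI.
pose h0 := Radon_Nikodym_SigmaFinite.f nu leb.
pose h t := fine (h0 t).
have hE : EFin \o h = h0.
  apply/funext => t; rewrite /h /= fineK//.
  exact: Radon_Nikodym_SigmaFinite.f_fin_num.
have ih : leb.-integrable setT (EFin \o h).
  by rewrite hE; exact: Radon_Nikodym_SigmaFinite.f_integrable.
have mh : measurable_fun setT h.
  by apply/measurable_EFinP; exact: measurable_int ih.
have FE x : (a <= x <= b)%R -> (F x - F a)%:E = \int[leb]_(t in `]a, x]) (h t)%:E.
  move=> /andP[ax xb]; transitivity (nu `]a, x]%classic).
    rewrite nuE (_ : _ `&` _ = `]a, x]%classic) ?muFE//.
    apply: setIidl => t; rewrite /D /= !in_itv/= => /andP[-> tx].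
    exact: le_trans xb.
  rewrite (Radon_Nikodym_SigmaFinite.f_integral nuleb) -/h0//.
  by apply: eq_integral => t _; rewrite -hE.
exists h; split => //; first by rewrite FE// lexx ltW.
have ihS A : measurable A -> leb.-integrable A (EFin \o h).
  by move=> mA; exact: integrableS ih.
have := @FTC1 R h (BRight a) (fun y => ihS _ (measurable_itv _))
  (open_integrable_locally openT ih).
apply: filterS; first exact: (ae_filter_ringOfSetsType leb).
move=> x /= + /andP[ax xb]; rewrite lte_fin => /(_ ax)[dI Ih].
set I := (fun x0 : R => _) in dI Ih.
have {Ih}dI : is_derive (x : R^o) 1%R (I : R^o -> R^o) (h x).
  by apply: DeriveDef => //; rewrite -Ih derive1E.
have dFI : is_derive (x : R^o) 1%R ((cst (F a) : R^o -> R^o) + (I : R^o -> R^o))%R (h x).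
  by apply: is_derive_eq; rewrite add0r.
apply: near_eq_is_derive dFI; near=> y.
have ay : (a < y)%R by near: y; exact: lt_nbhsr.
have yb : (y <= b)%R by near: y; exact: lt_le_nbhsl.
rewrite /I /GRing.add/= /Rintegral -FE ?yb ?(ltW ay)//=.
by rewrite addrC subrK.
Unshelve. all: by end_near. Qed.

End nondecreasing_lipschitz.

Section lipschitz.
Local Open Scope ereal_scope.
Context (R : realType).
Local Notation leb := (@lebesgue_measure R).

(** Rademacher's theorem on the line, with the increment formula: (f + id)/2 is nondecreasing and
    1-Lipschitz, which reduces the claim to the monotone case. *)
Lemma lipschitz_density (f : R -> R) (a b : R) :
  (forall x y, (`|f x - f y| <= `|x - y|)%R) -> (a < b)%R ->
  exists h : R -> R, [/\ measurable_fun setT h,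
    leb.-integrable `]a, b] (EFin \o h),
    (f b - f a)%:E = \int[leb]_(t in `]a, b]) (h t)%:E &
    {ae leb, forall x, (a < x < b)%R ->
      is_derive (x : R^o) 1%R (f : R^o -> R^o) (h x)}].
Proof.
move=> fl ab; pose F x := (2^-1 * (f x + x))%R.
have fl' x y : (x <= y)%R -> (x - y <= f y - f x <= y - x)%R.
  move=> xy; have := fl y x; rewrite (@ger0_norm _ (y - x)%R) ?subr_ge0//.
  by rewrite ler_norml opprB.
have F_nd x y : (x <= y)%R -> (F x <= F y)%R.
  by move=> /fl'; rewrite /F; lra.
have F_lip x y : (x <= y)%R -> (F y - F x <= y - x)%R.
  by move=> /fl'; rewrite /F; lra.
have [h [mh ih Fh dh]] := nondecreasing_lipschitz_density F_nd F_lip ab.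
have i1 : leb.-integrable `]a, b] (cst 1).
  apply/integrableP; split => //.
  rewrite (eq_integral (cst 1)) => [|x _]; last by rewrite /= normr1.
  by rewrite integral_cst//= lebesgue_measure_itv/= lte_fin ab mul1e -EFinB ltry.
have ih' : leb.-integrable `]a, b] (EFin \o h) by exact: integrableS ih.
have i2h : leb.-integrable `]a, b] (fun t => 2%:E * (EFin \o h) t).
  exact: integrableZl.
exists (fun t => 2 * h t - 1)%R; split.
- by apply: measurable_funB => //; exact: measurable_funM.
- have := integrableB _ i2h i1; move=> /(_ (measurable_itv _)); exact: eq_integrable.
- transitivity (\int[leb]_(t in `]a, b]) (2%:E * (EFin \o h) t - cst 1 t)).
    rewrite integralB//= integralZl// -Fh integral_cst//= lebesgue_measure_itv/=.
    rewrite lte_fin ab mul1e; apply: (congr1 EFin (_ : _ = 2 * (F b - F a) - (b - a))%R).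
    by rewrite /F; lra.
  by apply: eq_integral => t _; rewrite EFinB EFinM.
- apply: filterS dh; first exact: (ae_filter_ringOfSetsType leb).
  move=> x /= /[apply] dF.
  have -> : f = (2 *: (F : R -> R^o) - id)%R.
    by apply/funext => y; rewrite /F !fctE/= /GRing.scale/=; lra.
  by apply: is_derive_eq; rewrite /GRing.scale/=; lra.
Qed.

End lipschitz.

(** * Integrals of functions that may not be measurable *)

Section integral_without_measurability.
Local Open Scope ereal_scope.
Context d (T : measurableType d) (R : realType).
Variables (mu : {measure set T -> \bar R}) (D : set T).
Hypothesis mD : measurable D.

(** The integral is a supremum over the simple functions below the integrand, hence monotone for
    arbitrary nonnegative functions. *)
Lemma ge0_le_integral_any (f g : T -> \bar R) :
  (forall x, D x -> 0 <= f x) -> (forall x, D x -> f x <= g x) ->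
  \int[mu]_(x in D) f x <= \int[mu]_(x in D) g x.
Proof.
move=> f0 fg.
have g0 x : D x -> 0 <= g x by move=> Dx; apply: le_trans (fg x Dx); exact: f0.
rewrite !ge0_integralE//; apply: le_ereal_sup => _ [h /= hf <-].
exists h => // x; apply: le_trans (hf x) _; rewrite !patchE.
by case: ifPn => // /set_mem; exact: fg.
Qed.

(** [f] lies between the modifications of [g] by 0 and by +oo on a null set, and these have the same
    integral as [g]. This is what allows [speed] to be exchanged for [mspeed]. *)
Lemma ge0_ae_eq_integral_any (f g : T -> \bar R) :
  (forall x, D x -> 0 <= f x) -> (forall x, D x -> 0 <= g x) ->
  measurable_fun D g -> {ae mu, forall x, D x -> f x = g x} ->
  \int[mu]_(x in D) f x = \int[mu]_(x in D) g x.
Proof.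
move=> f0 g0 mg [N [mN N0 NP]].
have fgN x : D x -> ~ N x -> f x = g x.
  by move=> Dx Nx; apply: contrapT => H; apply: Nx; apply: NP => /= /(_ Dx).
have aux (l : \bar R) : 0 <= l ->
    \int[mu]_(x in D) (if x \in N then l else g x) = \int[mu]_(x in D) g x.
  move=> l0; apply: ge0_ae_eq_integral => //.
  - apply: measurable_fun_if => //.
      apply: (measurable_fun_bool true); rewrite (_ : _ @^-1` _ = N).
        exact: measurableI.
      by apply/seteqP; split => x /=; [exact: set_mem|exact: mem_set].
    by apply: measurable_funS mg => // x [].
  - by move=> x Dx; case: ifP => // _; exact: g0.
  - exists N; split => // x /= H; apply: contrapT => Nx; apply: H => _.
    by rewrite memNset.
apply/eqP; rewrite eq_le; apply/andP; split.
  rewrite -(aux +oo)//; apply: ge0_le_integral_any => // x Dx.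
  by case: ifPn => [_|/negP xN]; rewrite ?leey// fgN// => /mem_set.
rewrite -(aux 0)//; apply: ge0_le_integral_any => // x Dx.
  by case: ifPn => // _; exact: g0.
by case: ifPn => [_|/negP xN]; rewrite ?f0// fgN// => /mem_set.
Qed.

End integral_without_measurability.

(** * Dyadic grids in time and joint measurability *)

Section dyadic.
Context (R : realType).
Implicit Types (n k : nat) (t : R).

Definition dyadic n k : R := k%:R / 2 ^+ n.

Definition dyidx n t : nat := Num.truncn (2 ^+ n * t).

Lemma exp2_gt0 n : 0 < 2 ^+ n :> R.
Proof. by rewrite exprn_gt0. Qed.

Lemma dyadic_ge0 n k : 0 <= dyadic n k.
Proof. by rewrite divr_ge0// ltW// exp2_gt0. Qed.

Lemma dyadicS n k : dyadic n k.+1 - dyadic n k = (2 ^+ n)^-1.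
Proof. by rewrite /dyadic -mulrBl -natr1 addrAC subrr add0r mul1r. Qed.

Lemma dyadic_ltS n k : dyadic n k < dyadic n k.+1.
Proof. by rewrite -subr_gt0 dyadicS invr_gt0 exp2_gt0. Qed.

Lemma dyidxP n t : 0 <= t -> dyadic n (dyidx n t) <= t < dyadic n (dyidx n t).+1.
Proof.
move=> t0; rewrite /dyadic ler_pdivrMr ?exp2_gt0// ltr_pdivlMr ?exp2_gt0//.
by rewrite mulrC Num.Theory.truncn_itv// mulr_ge0// ltW// exp2_gt0.
Qed.

Lemma dyidx_eq n k t : dyadic n k <= t < dyadic n k.+1 -> dyidx n t = k.
Proof.
rewrite /dyadic ler_pdivrMr ?exp2_gt0// ltr_pdivlMr ?exp2_gt0// => kt.
by apply: Num.Theory.truncn_def; rewrite mulrC.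
Qed.

Lemma dyidx_lt0 n t : t < 0 -> dyidx n t = 0%N.
Proof.
move=> t0; apply/eqP; rewrite /dyidx -leqn0 leqNgt Num.Theory.truncn_gt_nat.
by rewrite -ltNge (lt_le_trans _ ler01)// pmulr_rlt0// exp2_gt0.
Qed.

Lemma cvg_dyidx t : 0 <= t -> dyadic n (dyidx n t) @[n --> \oo] --> t.
Proof.
move=> t0; apply/(@cvgrPdist_lt _ R^o) => e e0.
have : (2^-1 ^+ n : R) @[n --> \oo] --> (0 : R).
  by apply: cvg_expr; rewrite ger0_norm ?invr_ge0// invf_lt1// ltr1n.
move=> /(@cvgrPdist_lt _ R^o)/(_ e e0); apply: filterS => n.
rewrite sub0r normrN exprVn ger0_norm ?invr_ge0 ?exprn_ge0// => ne.
have /andP[h1 h2] := dyidxP n t0; have := dyadicS n (dyidx n t).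
by rewrite ger0_norm ?subr_ge0//; lra.
Qed.

Lemma measurable_dyidx n k : measurable [set t : R | dyidx n t = k].
Proof.
have mle j : measurable [set t : R | (dyidx n t <= j)%N].
  rewrite (_ : [set _ | _] = `]-oo, (dyadic n j.+1)[%classic)//.
  apply/seteqP; split => t; rewrite /= in_itv/= /dyadic leqNgt
    Num.Theory.truncn_gt_nat -ltNge ltr_pdivlMr ?exp2_gt0// mulrC//.
case: k => [|k].
  by rewrite (_ : [set _ | _] = [set t : R | (dyidx n t <= 0)%N])//;
    apply/seteqP; split => t /=; rewrite leqn0 => /eqP.
rewrite (_ : [set _ | _] = [set t : R | (dyidx n t <= k.+1)%N] `\`
  [set t : R | (dyidx n t <= k)%N]); first exact: measurableD.
apply/seteqP; split => t /= => [->|[h1 /negP]]; first by rewrite leqnn ltnn.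
by rewrite -ltnNge => h2; apply/eqP; rewrite eqn_leq h1.
Qed.

(** Functions that only see the dyadic index of the time are jointly measurable, as their preimages
    are countable unions of rectangles; other functions of (x, t) are reached as limits. *)
Lemma measurable_dyadic_step n d1 (X : measurableType d1) d2
    (Y : measurableType d2) (phi : nat -> X -> Y) :
  (forall k, measurable_fun setT (phi k)) ->
  measurable_fun setT (fun p : X * R => phi (dyidx n p.2) p.1).
Proof.
move=> mphi _ A mA; rewrite setTI.
rewrite (_ : _ @^-1` A =
    \bigcup_k ((phi k @^-1` A) `*` [set t | dyidx n t = k])); last first.
  apply/seteqP; split => [[x t] /= At|[x t] [k _ [/= + /= tk]]]; last by rewrite -tk.
  by exists (dyidx n t).
apply: bigcupT_measurable => k; apply: measurableX; last exact: measurable_dyidx.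
by rewrite -[X in measurable X]setTI; exact: mphi.
Qed.

End dyadic.

Section lipschitz_curve.
Context (R : realType) (d : nat) (c : R -> 'rV[R]_d).
Hypothesis cl : forall s t, enorm (c s - c t) <= `|s - t|.

Local Notation leb := (@lebesgue_measure R).

Definition slope n k : R := 2 ^+ n * enorm (c (dyadic R n k.+1) - c (dyadic R n k)).

(* A jointly measurable substitute for [speed], which is only defined through
   a limit that may fail to exist. *)
Definition mspeed (t : R) : \bar R := limn_einf (fun n => (slope n (dyidx n t))%:E).

Lemma slope_ge0 n k : 0 <= slope n k.
Proof. by rewrite mulr_ge0 ?enorm_ge0// ltW// exp2_gt0. Qed.

Lemma mspeed_ge0 t : (0 <= mspeed t)%E.
Proof.
rewrite /mspeed limn_einf_lim; apply: lime_ge; first exact: is_cvg_einfs.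
apply: nearW => n; apply: le_ereal_inf_tmp => _ [k _ <-].
by rewrite lee_fin slope_ge0.
Qed.

Lemma ae_derivable_curve : {ae leb, forall t : R, derivable c t 1}.
Proof.
have H i n : {ae leb, forall t : R, - n%:R < t < n%:R ->
    derivable (fun t => c t ord0 i) t 1}.
  case: n => [|n]; first by apply: nearW => t; rewrite oppr0; case: ltgtP.
  have [||h [_ _ _]] := @lipschitz_density R (fun t => c t ord0 i) (- n.+1%:R) n.+1%:R.
  - move=> x y; apply: le_trans (cl x y).
    by have := coord_le_enorm (c x - c y) i; rewrite !mxE.
  - by rewrite gt0_cp.
  - apply: filterS; first exact: (ae_filter_ringOfSetsType leb).
    by move=> t /= + tn => /(_ tn) [].
have {}H : {ae leb, forall t : R, forall n (i : 'I_d), - n%:R < t < n%:R ->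
    derivable (fun t => c t ord0 i) t 1}.
  apply: (@ae_foralln _ _ _ leb) => n.
  by apply: filter_forall => i; exact: H.
apply: filterS H; first exact: (ae_filter_ringOfSetsType leb).
move=> t H; apply/derivable_mxP => i j; rewrite (ord1 i).
apply: (H (Num.truncn `|t|).+1 j); rewrite -ltr_norml.
by have /andP[] := Num.Theory.truncn_itv (normr_ge0 t).
Qed.

(** The dyadic interval [a, b[ around [t] need not start at [t]. The first order errors at its two
    ends are at most e (t - a) and e (b - t), which add up to e times its length. *)
Lemma straddle (t : R) : 0 <= t -> derivable c t 1 ->
  slope n (dyidx n t) @[n --> \oo] --> enorm (derive1 c t).
Proof.
move=> t0 dt; apply/(@cvgrPdist_le _ R^o) => e e0.
set v := derive1 c t.
have d0 : 0 < d%:R + 1 :> R by rewrite ltr_wpDl.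
have dv : h^-1 *: ((c \o shift t) (h *: (1 : R)) - c t) @[h --> 0^'] --> v.
  by rewrite /v derive1E; exact: dt.
have [del /= del0 H] : exists2 del, 0 < del & forall h, `|h| < del ->
    enorm (c (t + h) - c t - h *: v) <= e * `|h|.
  have := @cvgr_dist_lt _ _ _ _ _ _ _ dv (e / (d%:R + 1)).
  move=> /(_ _ (divr_gt0 e0 d0))[del /= del0 H]; exists del => // h hdel.
  have [->|h0] := eqVneq h 0.
    by rewrite addr0 subrr scale0r subr0 enorm0 normr0 mulr0.
  have := H h; rewrite /ball/= sub0r normrN => /(_ hdel h0).
  rewrite /GRing.scale/= mulr1 (addrC h) => Hh.
  have -> : c (t + h) - c t - h *: v = - h *: (v - h^-1 *: (c (t + h) - c t)).
    by rewrite scalerBr !scaleNr opprK scalerA mulfV// scale1r addrC.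
  rewrite enormZ normrN mulrC ler_wpM2r//.
  apply: le_trans (enorm_le_normr _) _; rewrite mulrC.
  move: Hh; rewrite ltr_pdivlMr// => /ltW; apply: le_trans.
  by rewrite ler_wpM2l// lerDl.
near=> n.
have nd : (2 ^+ n)^-1 < del.
  have : (2^-1 ^+ n : R) < del; last by rewrite exprVn.
  near: n; apply: (@cvgr_lt _ _ _ _ (fun n => (2^-1 ^+ n : R)) 0) => //.
  by apply: cvg_expr; rewrite ger0_norm ?invr_ge0// invf_lt1// ltr1n.
have /andP[at_ tb] := dyidxP n t0.
rewrite /slope; set k := dyidx n t in at_ tb *.
set a := dyadic R n k in at_ *; set b := dyadic R n k.+1 in tb *.
have ba : b - a = (2 ^+ n)^-1 by exact: dyadicS.
have n0 : 0 < 2 ^+ n :> R by exact: exp2_gt0.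
have Ha := H (a - t); have Hb := H (b - t).
rewrite ler0_norm ?subr_le0// in Ha; rewrite gtr0_norm ?subr_gt0// in Hb.
rewrite !(addrC t) !subrK in Ha Hb.
have {}Ha := Ha ltac:(lra); have {}Hb := Hb ltac:(lra).
rewrite -(gtr0_norm n0) -enormZ; apply: le_trans (enorm_dist_norm _ _) _.
have -> : v - 2 ^+ n *: (c b - c a) = 2 ^+ n *: ((c a - c t - (a - t) *: v) -
    (c b - c t - (b - t) *: v)).
  apply: (scalerI (a := (2 ^+ n)^-1)); first by rewrite invr_eq0 gt_eqF.
  rewrite scalerBr !scalerA mulVf ?gt_eqF// !scale1r -ba.
  rewrite !scalerBl; apply/rowP => i; rewrite !mxE; ring.
rewrite enormZ gtr0_norm// mulrC -ler_pdivlMr// -ba mulrBr.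
apply: le_trans (enormD _ _) _; rewrite enormN.
by apply: le_trans (lerD Ha Hb) _; lra.
Unshelve. all: by end_near. Qed.

Lemma mspeed_derivable t : 0 <= t -> derivable c t 1 ->
  mspeed t = (enorm (derive1 c t))%:E.
Proof.
move=> t0 dt; rewrite /mspeed.
have /cvg_EFin : \forall n \near \oo, (slope n (dyidx n t))%:E \is a fin_num.
  by apply: nearW.
move=> /(_ _ (straddle t0 dt)) H.
by have [] := cvg_limn_einf_sup H.
Qed.

Lemma ae_mspeed : {ae leb, forall t : R, `[0, +oo[%classic t ->
  (enorm (derive1 c t))%:E = mspeed t}.
Proof.
apply: filterS ae_derivable_curve; first exact: (ae_filter_ringOfSetsType leb).
move=> t dt; rewrite /= in_itv/= andbT => t0.
by rewrite mspeed_derivable.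
Qed.

End lipschitz_curve.

Section joint_measurability.
Context (R : realType).

Lemma measurable_continuous_borel (T : ptopologicalType) (f : T -> R) :
  continuous f -> measurable_fun setT (f : borel T -> R).
Proof.
move=> cf; move=> mT; apply: (measurability _ (RGenInftyO.measurableE R)) => //.
move=> _ [_ [x ->] <-]; rewrite setTI; apply: sub_sigma_algebra.
by apply: (open_comp (D := `]-oo, x[%classic)) => [t _|]; [exact: cf|exact: interval_open].
Qed.

Lemma continuous_coord d (i : 'I_d) :
  continuous (fun x : 'rV[R]_d => x ord0 i).
Proof. exact: coord_continuous. Qed.

Context d0 (X : measurableType d0) (d : nat).
Implicit Types f g : X -> 'rV[R]_d.

Lemma measurable_fun_coord f i :
  measurable_fun setT (f : X -> borel 'rV[R]_d) ->
  measurable_fun setT (fun x => f x ord0 i).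
Proof.
move=> mf.
apply: (@measurableT_comp _ _ _ _ _ _ (fun v : borel 'rV[R]_d => (v : 'rV[R]_d) ord0 i)) mf.
exact: measurable_continuous_borel (@continuous_coord d i).
Qed.

Lemma measurable_fun_subrV f g :
  measurable_fun setT (f : X -> borel 'rV[R]_d) ->
  measurable_fun setT (g : X -> borel 'rV[R]_d) ->
  measurable_fun setT ((fun x => f x - g x) : X -> borel 'rV[R]_d).
Proof.
move=> mf mg; apply: measurable_fun_rV => i.
under eq_fun do rewrite !mxE.
by apply: measurable_funB; exact: measurable_fun_coord.
Qed.

Lemma measurable_fun_enormB f g :
  measurable_fun setT (f : X -> borel 'rV[R]_d) ->
  measurable_fun setT (g : X -> borel 'rV[R]_d) ->
  measurable_fun setT (fun x => enorm (f x - g x)).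
Proof.
move=> mf mg; apply: (@measurableT_comp _ _ _ _ _ _ (@enorm R d : borel _ -> R)).
  exact: (@measurable_continuous_borel _ (@enorm R d) (@continuous_enorm R d)).
exact: measurable_fun_subrV.
Qed.

Variable c : X -> R -> 'rV[R]_d.
Hypothesis mc : forall t, measurable_fun setT ((c^~ t) : X -> borel 'rV[R]_d).

Lemma measurable_mspeed :
  measurable_fun setT (fun p : X * R => mspeed (c p.1) p.2).
Proof.
rewrite /mspeed /limn_einf; apply: measurableT_comp => //.
apply: measurable_fun_limn_esup => n; apply: measurableT_comp => //.
apply/measurable_EFinP.
apply: (@measurable_dyadic_step _ n _ X _ R (fun k x => slope (c x) n k)) => k.
by apply: measurable_funM => //; exact: measurable_fun_enormB.
Qed.

(** By continuity in time the evaluation is the limit of its values at left dyadic end points; all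
    negative times have index 0, whence the hypothesis on them. *)
Lemma measurable_eval :
  (forall x, continuous (c x)) -> (forall x t, t < 0 -> c x t = c x 0) ->
  measurable_fun setT ((fun p : X * R => c p.1 p.2) : X * R -> borel 'rV[R]_d).
Proof.
move=> cc c0; apply: measurable_fun_rV => i.
pose f n (p : X * R) := c p.1 (dyadic R n (dyidx n p.2)) ord0 i.
apply: (@measurable_fun_cvg _ _ _ _ f) => [n|[x t] _].
  apply: (@measurable_dyadic_step _ n _ X _ R
    (fun k x => c x (dyadic R n k) ord0 i)) => k.
  exact: measurable_fun_coord.
rewrite /f/=; have [t0|t0] := ltP t 0.
  rewrite c0//; under eq_fun do rewrite dyidx_lt0// /dyadic mul0r.
  exact: cvg_cst.
have h := @cvg_dyidx R t t0.
have h2 := cvg_comp _ _ h (cc x t).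
exact: (cvg_comp _ _ h2 (@continuous_coord d i (c x t))).
Qed.

End joint_measurability.

Lemma normr_derive_dist (R : realType) (d : nat) (c : R -> 'rV[R]_d)
    (x : 'rV[R]_d) (t : R) (phi := fun t => enorm (c t - x)) :
  derivable phi t 1 -> derivable c t 1 ->
  `|'D_1 phi t| <= enorm (derive1 c t).
Proof.
move=> dphi dc; rewrite derive1E.
have H1 : `|u^-1 *: ((phi \o shift t) (u *: (1 : R)) - phi t)| @[u --> (0:R)^'] -->
    (`|'D_1 phi t| : R).
  by apply: cvg_norm; exact: dphi.
have H2 : enorm (u^-1 *: ((c \o shift t) (u *: (1 : R)) - c t)) @[u --> (0:R)^'] -->
    enorm ('D_1 c t).
  exact: (cvg_comp _ _ dc (@continuous_enorm R d _)).
apply: (ler_cvg_to H1 H2); apply: nearW => u.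
by rewrite /GRing.scale/= enormZ normrM ler_wpM2l// enorm_dist_dist.
Qed.

Section curve_increment.
Local Open Scope ereal_scope.
Context (R : realType) (d : nat) (c : R -> 'rV[R]_d).
Hypothesis cl : forall s t, (enorm (c s - c t) <= `|s - t|)%R.

Local Notation leb := (@lebesgue_measure R).

Lemma lipschitz_curve_continuous : continuous c.
Proof.
move=> t; apply/cvgrPdist_lt => e e0.
exists e => //= s; apply: le_lt_trans.
by apply: le_trans (cl t s); exact: normr_le_enorm.
Qed.

Lemma measurable_lipschitz_curve : measurable_fun setT (c : R -> borel 'rV[R]_d).
Proof.
apply: measurable_fun_rV => i; apply: continuous_measurable_fun => t.
exact: (cvg_comp _ _ (lipschitz_curve_continuous (x:=t)) (@continuous_coord R d i (c t))).
Qed.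

Lemma measurable_mspeed1 : measurable_fun setT (mspeed c).
Proof.
have H := @measurable_mspeed R _ unit d (fun=> c) 
  (fun t => @measurable_cst _ _ unit (borel 'rV[R]_d) setT (c t)).
apply: (measurableT_comp H (g := fun t => (tt, t))).
exact: measurable_pair1.
Qed.

(** The scalar function [phi], the distance to the starting point, grows at most at the speed of the
    curve; this avoids vector-valued integrals. *)
Lemma curve_increment (a b : R) : (0 <= a)%R -> (a <= b)%R ->
  (enorm (c b - c a))%:E <= \int[leb]_(t in `]a, b]) mspeed c t.
Proof.
move=> a0; rewrite le_eqVlt => /orP[/eqP->|ab].
  by rewrite subrr enorm0; apply: integral_ge0 => t _; exact: mspeed_ge0.
pose phi t := enorm (c t - c a).
have phil x y : (`|phi x - phi y| <= `|x - y|)%R.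
  by apply: le_trans (enorm_dist_dist _ _ _) (cl x y).
have [h [mh ih phiE dh]] := lipschitz_density phil ab.
have -> : enorm (c b - c a) = (phi b - phi a)%R by rewrite /phi subrr enorm0 subr0.
rewrite phiE; apply: (@le_trans _ _ (\int[leb]_(t in `]a, b]) (`|h t|)%:E)).
  have iah : leb.-integrable `]a, b] (abse \o (EFin \o h)) by exact: integrable_abse.
  by apply: (le_integral _ ih iah) => // t _; rewrite lee_fin ler_norm.
apply: ae_ge0_le_integral => //.
- by apply/measurable_EFinP; apply: measurableT_comp => //; exact: measurable_funTS.
- by move=> t _; exact: mspeed_ge0.
- exact: measurable_funTS measurable_mspeed1.
(* The derivative of [phi] is known on the open interval only. *)
have nb : {ae leb, forall t : R, t != b}.
  exists [set b]; split => //; first exact: lebesgue_measure_set1.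
  by move=> t /= /negP; rewrite negbK => /eqP.
have := ae_derivable_curve cl; move: dh; move: nb.
apply: filterS3; first exact: (ae_filter_ringOfSetsType leb).
move=> t tb dphi dc; rewrite /= in_itv/= => /andP[aT tb'].
have {}tb : (t < b)%R by rewrite lt_neqAle tb.
have t0 : (0 <= t)%R by apply: le_trans a0 _; exact: ltW.
have [dphi1 <-] := dphi (introT andP (conj aT tb)).
rewrite mspeed_derivable// lee_fin.
exact: normr_derive_dist.
Qed.

End curve_increment.

(** * Measures with density *)

(* The side conditions are arguments so that the measure instance below applies
   to the term itself. *)
Definition density d (T : measurableType d) (R : realType)
    (mu : set T -> \bar R) (f : T -> \bar R) & measurable_fun setT f &
    (forall x, (0 <= f x)%E) : set T -> \bar R :=
  fun A => (\int[mu]_(x in A) f x)%E.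

Section density.
Import HBNNSimple.
Local Open Scope ereal_scope.
Context d (T : measurableType d) (R : realType).
Variables (mu : {measure set T -> \bar R}) (f : T -> \bar R).
Hypotheses (mf : measurable_fun setT f) (f0 : forall x, 0 <= f x).

Local Notation nu := (density mu mf f0).

Let nu0 : nu set0 = 0.
Proof. by rewrite /density integral_set0. Qed.

Let nu_ge0 A : 0 <= nu A.
Proof. exact: integral_ge0. Qed.

Let nu_sigma_additive : semi_sigma_additive nu.
Proof.
move=> F mF tF mUF; rewrite /density ge0_integral_bigcup//.
- by apply: is_cvg_nneseries => n _ _; exact: integral_ge0.
- exact: measurable_funTS.
Qed.

HB.instance Definition _ := isMeasure.Build _ _ _ nu nu0 nu_ge0 nu_sigma_additive.

(** Proved from simple functions because [f] may be infinite and [mu] need not be sigma-finite, as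
    is the case for H^1. *)
Lemma integral_density (g : T -> \bar R) : measurable_fun setT g ->
  (forall x, 0 <= g x) -> \int[nu]_x g x = \int[mu]_x (g x * f x).
Proof.
move=> mg g0.
pose h := nnsfun_approx measurableT mg.
have hE (n : nat) : \int[nu]_x (h n x)%:E = \int[mu]_x ((h n x)%:E * f x).
  rewrite integralT_nnsfun sintegralE.
  under [RHS]eq_integral => x _.
    rewrite fimfunE -fsumEFin//; rewrite ge0_mule_fsuml; last first.
      move=> r; rewrite lee_fin; have [r0|r0] := leP 0%R r; first by rewrite mulr_ge0.
      by rewrite preimage_nnfun0 ?indic0 ?mulr0.
    over.
  rewrite /= ge0_integral_fsum//.
  - apply: eq_fsbigr => r /set_mem [x _ <-].
    transitivity ((h n x)%:E * \int[mu]_y ((\1_(h n @^-1` [set h n x]) y)%:E * f y)).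
      congr (_ * _); rewrite /density integral_mkcond; apply: eq_integral => y _.
      by rewrite patchE indicE; case: ifPn => _; rewrite ?mul1e ?mul0e.
    rewrite -ge0_integralZl//.
    + by apply: eq_integral => y _; rewrite EFinM muleA.
    + by apply: emeasurable_funM => //; exact/measurable_EFinP.
    + by move=> y _; rewrite mule_ge0// lee_fin.
    + by rewrite lee_fin.
  - move=> r; apply: emeasurable_funM => //.
    by apply/measurable_EFinP; exact: measurable_funM.
  - move=> r x _; rewrite mule_ge0// lee_fin.
    have [r0|r0] := leP 0%R r; first by rewrite mulr_ge0.
    by rewrite preimage_nnfun0 ?indic0 ?mulr0.
have cvh x : EFin \o h^~ x @ \oo --> g x.
  by apply: cvg_nnsfun_approx => // y _; exact: g0.
have ndh x : nondecreasing_seq (fun n => (h n x)%:E).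
  by move=> m n mn; rewrite lee_fin; exact/lefP/nd_nnsfun_approx.
transitivity (limn (fun n => \int[nu]_x (h n x)%:E)).
  rewrite -monotone_convergence//.
  - by apply: eq_integral => x _; apply/esym/cvg_lim => //; exact: cvh.
  - by move=> n; exact/measurable_EFinP.
  - by move=> n x _; rewrite lee_fin.
under eq_fun do rewrite hE.
rewrite -monotone_convergence//.
- apply: eq_integral => x _; apply/cvg_lim => //.
  have [ffin|] := boolP (f x \is a fin_num); first by apply: cvgeZr => //; exact: cvh.
  rewrite ge0_fin_numE// -leNgt leye_eq => /eqP ->.
  (* The product is discontinuous at (0, +oo); there the approximations stay below [g x] = 0, so the
     sequence is constantly 0. *)
  have [gx0|gx0] := eqVneq (g x) 0; last first.
    apply: cvgeM; [|exact: cvh|exact: cvg_cst].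
    by rewrite mule_def_neq0_infty.
  rewrite gx0 mul0e; have -> : (fun n => (h n x)%:E * +oo) = cst 0.
    apply/funext => n; suff -> : h n x = 0%R by rewrite mul0e.
    suff : (h n x)%:E <= g x.
      by rewrite gx0 lee_fin => hle; apply: le_anti; rewrite hle fun_ge0.
    have <- := cvg_lim (@ereal_hausdorff R) (cvh x).
    apply: lime_ge; first by apply/cvg_ex; exists (g x); exact: cvh.
    by near=> m; apply: ndh; near: m; exists n.
  exact: cvg_cst.
- by move=> n; apply: emeasurable_funM => //; exact/measurable_EFinP.
- by move=> n x _; rewrite mule_ge0// lee_fin.
- by move=> x _ m n mn; apply: lee_wpmul2r => //; exact: ndh.
Unshelve. all: by end_near. Qed.

End density.

Section pushforward_density.
Local Open Scope ereal_scope.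
Context d1 (X : measurableType d1) (R : realType) (T : ptopologicalType).
Variables (m : {measure set X -> \bar R}) (n : {measure set (borel T) -> \bar R}).
Variables (phi : X -> borel T) (g : X -> \bar R) (h : borel T -> \bar R).
Hypotheses (mphi : measurable_fun setT phi) (mg : measurable_fun setT g)
  (mh : measurable_fun setT h) (g0 : forall x, 0 <= g x) (h0 : forall z, 0 <= h z).
Hypotheses (goo : \int[m]_x g x < +oo)
  (gh : forall U : set T, open U ->
    \int[m]_(x in phi @^-1` U) g x = \int[n]_(z in U) h z).

(** The image under [phi] of the measure with density [g] and the measure with density [h] agree on
    the open sets, a generating family stable under intersection. Finite total mass gives
    uniqueness. *)
Lemma integral_pushforward_density (f : borel T -> \bar R) :
  measurable_fun setT f -> (forall z, 0 <= f z) ->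
  \int[m]_x (f (phi x) * g x) = \int[n]_z (f z * h z).
Proof.
move=> mf f0.
pose m0 : {measure set (borel T) -> \bar R} := pushforward (density m mg g0) phi.
pose m1 := m0 mphi.
pose m2 : {measure set (borel T) -> \bar R} := density n mh h0.
have m12 : forall A, measurable A -> m1 A = m2 A.
  apply: (@measure_unique _ R (borel T) (@open T) (fun=> setT)) => //.
  - by move=> A B; exact: openI.
  - by move=> _; exact: openT.
  - by rewrite bigcup_const//; exists 0%N.
transitivity (\int[m1]_z f z).
  rewrite -(@integral_density _ _ _ m g mg g0 (f \o phi))//.
  - by rewrite ge0_integral_pushforward.
  - exact: measurableT_comp.
  - by move=> x; exact: f0.
rewrite (@eq_measure_integral _ _ _ setT m2) => [|A mA _]; last exact: m12.
exact: integral_density.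
Qed.

End pushforward_density.

(** * Dyadic counting of multiplicities *)

Section limn_einf_bounds.
Local Open Scope ereal_scope.
Context (R : realType).
Implicit Types (u : (\bar R)^nat) (l : \bar R).

Lemma limn_einf_ge u l : (\forall n \near \oo, l <= u n) -> l <= limn_einf u.
Proof.
move=> [N _ HN]; rewrite limn_einf_lim; apply: lime_ge; first exact: is_cvg_einfs.
exists N => // n /= Nn; apply: le_ereal_inf_tmp => _ [k /= nk <-].
by apply: HN; exact: leq_trans nk.
Qed.

Lemma limn_einf_le u l : (forall n, u n <= l) -> limn_einf u <= l.
Proof.
move=> H; rewrite limn_einf_lim; apply: lime_le; first exact: is_cvg_einfs.
apply: nearW => n; apply: le_trans (H n).
by apply: ereal_inf_lbound; exists n => /=.
Qed.

Lemma le_limn_einf u v : (\forall n \near \oo, u n <= v n) ->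
  limn_einf u <= limn_einf v.
Proof.
move=> [N _ HN]; rewrite !limn_einf_lim; apply: lee_lim; [exact: is_cvg_einfs..|].
exists N => // n /= Nn; apply: le_ereal_inf_tmp => _ [k /= nk <-].
apply: le_trans (HN k _); first by apply: ereal_inf_lbound; exists k.
exact: leq_trans nk.
Qed.

End limn_einf_bounds.

Section counting.
Local Open Scope ereal_scope.
Context (R : realType) (T : choiceType).
Implicit Types (A : set T) (s : seq T).

Lemma counting_ge_size A s : uniq s -> (forall x, x \in s -> A x) ->
  (size s)%:R%:E <= counting A :> \bar R.
Proof.
move=> us sA; rewrite /counting; case: ifPn => [/asboolP fA|_]; last exact: leey.
rewrite lee_fin ler_nat; apply: uniq_leq_size => // x /sA Ax.
by rewrite in_fset_set// inE.
Qed.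

(** An infinite set has finite parts of every size, which forces [l] to be +oo. *)
Lemma counting_le A (l : \bar R) :
  (forall s, uniq s -> (forall x, x \in s -> A x) -> (size s)%:R%:E <= l) ->
  counting A <= l.
Proof.
move=> H; rewrite /counting; case: ifPn => [/asboolP fA|/asboolP iA].
  by apply: H => // x; rewrite in_fset_set// inE.
have exs n : exists s, [/\ uniq s, forall x, x \in s -> A x & size s = n].
  elim: n => [|n [s [us sA sn]]]; first by exists [::].
  have [x Ax xs] : exists2 x, A x & x \notin s.
    apply: contrapT => /forall2NP nA; apply: iA.
    apply: sub_finite_set (finite_seq s) => x Ax /=.
    by have [//|/negP] := nA x; rewrite negbK.
  exists (x :: s); split => /=; [by rewrite xs| |by rewrite sn].
  by move=> y; rewrite inE => /predU1P[->//|]; exact: sA.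
rewrite leye_eq; apply/eqP/eqyP => M M0.
have [s [us sA sM]] := exs (Num.truncn M).+1.
apply: le_trans (H s us sA); rewrite lee_fin sM ltW//.
by have /andP[] := Num.Theory.truncn_itv (ltW M0).
Qed.

End counting.

Lemma counting_image_le (R : realType) (T U : choiceType) (f : T -> U)
    (S : set T) : (counting (f @` S) <= counting S :> \bar R)%E.
Proof.
apply: counting_le => s us sS.
(* A nonempty list provides the default value for a total choice of preimages. *)
case: s us sS => [|k0 s0]; first by move=> _ _; exact: (@counting_ge_size _ _ _ [::]).
set s := k0 :: s0 => us sS.
have [t0 _ _] := sS k0 (mem_head _ _).
have /choice[g Hg] : forall k, exists t, k \in s -> S t /\ f t = k.
  move=> k; have [ks|ks] := boolP (k \in s); last by exists t0.
  by have [t St tk] := sS k ks; exists t.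
rewrite -(size_map g); apply: counting_ge_size.
  rewrite map_inj_in_uniq// => k k' ks ks' gkk'.
  by have [_ <-] := Hg k ks; rewrite gkk'; have [_ ->] := Hg k' ks'.
by move=> _ /mapP[k ks ->]; have [] := Hg k ks.
Qed.

Section counting_dyadic.
Local Open Scope ereal_scope.
Context (R : realType).

Lemma dyidx_neq (t t' : R) : (0 <= t)%R -> (0 <= t')%R -> t != t' ->
  \forall n \near \oo, dyidx n t <> dyidx n t'.
Proof.
move=> t0 t'0 tt'; have e0 : (0 < `|t - t'|)%R by rewrite normr_gt0 subr_eq0.
have : \forall n \near \oo, ((2^-1 ^+ n : R) < `|t - t'|)%R.
  apply: (@cvgr_lt _ _ _ _ (fun n => (2^-1 ^+ n : R)%R) 0%R) => //.
  by apply: cvg_expr; rewrite ger0_norm ?invr_ge0// invf_lt1// ltr1n.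
apply: filterS => n; rewrite exprVn => nt kk.
have /andP[h1 h2] := dyidxP n t0; have /andP[h3 h4] := dyidxP n t'0.
rewrite -kk in h3 h4; have := dyadicS R n (dyidx n t).
have : (`|t - t'| < dyadic R n (dyidx n t).+1 - dyadic R n (dyidx n t))%R.
  by rewrite ltr_norml; apply/andP; split; lra.
by lra.
Qed.

Lemma near_seq (T : eqType) (s : seq T) (P : T -> nat -> Prop) :
  (forall x, x \in s -> \forall n \near \oo, P x n) ->
  \forall n \near \oo, forall x, x \in s -> P x n.
Proof.
elim: s => [|a s IH] H; first exact: nearW.
have H1 := IH (fun x xs => H x (mem_behead (s := a :: s) xs)).
apply: filterS2 (H a (mem_head _ _)) H1 => n Pa Ps x.
by rewrite inE => /predU1P[->//|]; exact: Ps.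
Qed.

(* The dyadic intervals of length 2^-n that meet S end up separating the points
   of any finite part of S. *)
Lemma limn_einf_counting_dyidx (S : set R) : (forall t, S t -> (0 <= t)%R) ->
  limn_einf (fun n => counting (dyidx n @` S) : \bar R) = counting S.
Proof.
move=> S0; apply/eqP; rewrite eq_le; apply/andP; split.
  by apply: limn_einf_le => n; exact: counting_image_le.
apply: counting_le => s us sS; apply: limn_einf_ge.
have : \forall n \near \oo, forall x, x \in s -> forall y, y \in s ->
    x != y -> dyidx n x <> dyidx n y.
  apply: (@near_seq _ _ (fun x n => forall y, y \in s -> x != y -> dyidx n x <> dyidx n y)) => x xs.
  apply: (@near_seq _ _ (fun y n => x != y -> dyidx n x <> dyidx n y)) => y ys.
  have [->|xy] := eqVneq x y; first exact: nearW.
  by apply: filterS (dyidx_neq (S0 _ (sS _ xs)) (S0 _ (sS _ ys)) xy).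
apply: filterS => n Hn; rewrite -(size_map (@dyidx R n)); apply: counting_ge_size.
  rewrite map_inj_in_uniq// => x y xs ys; apply: contra_eq => xy.
  by apply/eqP; exact: Hn.
by move=> _ /mapP[x xs ->]; exists x => //; exact: sS.
Qed.

End counting_dyadic.

Section hitting_sets.
Context (R : realType) d0 (X : measurableType d0) (d : nat).
Variable c : X -> R -> 'rV[R]_d.
Hypothesis mc : forall t, measurable_fun setT ((c^~ t) : X -> borel 'rV[R]_d).
Hypothesis cc : forall x, continuous (c x).

(** On a compact time interval the distance to the target attains its minimum, which is 0 as soon as
    dyadic times come arbitrarily close; this leaves countably many conditions. *)
Lemma measurable_hit_cc (a b : R) : a <= b ->
  measurable [set p : X * borel 'rV[R]_d |
    exists t, a <= t <= b /\ c p.1 t = p.2].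
Proof.
move=> ab.
(* The dyadic grid of [0, 1] carried to [a, b]; the minimum keeps every index inside the
   interval. *)
pose q n k : R := a + (b - a) * Num.min 1 (dyadic R n k).
have qab n k : a <= q n k <= b.
  have r0 : 0 <= Num.min 1 (dyadic R n k) by rewrite le_min ler01 dyadic_ge0.
  have r1 : Num.min 1 (dyadic R n k) <= 1 by rewrite ge_min lexx.
  by rewrite /q; move: r0 r1; set r := Num.min _ _ => r0 r1; apply/andP; split; nra.
rewrite (_ : [set _ | _] = \bigcap_m \bigcup_n \bigcup_k
    [set p : X * borel 'rV[R]_d | enorm (c p.1 (q n k) - (p.2 : 'rV[R]_d)) < m.+1%:R^-1]).
  apply: bigcapT_measurable => m; apply: bigcupT_measurable => n.
  apply: bigcupT_measurable => k.
  have mf : measurable_fun setT (fun p : X * borel 'rV[R]_d =>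
      enorm (c p.1 (q n k) - (p.2 : 'rV[R]_d))).
    apply: measurable_fun_enormB; last exact: measurable_snd.
    exact: (measurableT_comp (mc (q n k)) measurable_fst).
  rewrite -[X in measurable X]setTI.
  rewrite (_ : [set p : X * borel 'rV[R]_d | _] =
    (fun p : X * borel 'rV[R]_d => enorm (c p.1 (q n k) - (p.2 : 'rV[R]_d))) @^-1`
      `]-oo, m.+1%:R^-1[); first exact: mf.
  by apply/seteqP; split => p /=; rewrite in_itv.
apply/seteqP; split => [[x z] /= [t [/andP[at_ tb] <-]] m _|[x z] /= H].
  pose s := (t - a) / (b - a).
  have s0 : 0 <= s by rewrite divr_ge0 ?subr_ge0.
  have s1 : s <= 1.
    have [ba0|ba0] := eqVneq (b - a) 0; first by rewrite /s ba0 invr0 mulr0.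
    by rewrite ler_pdivrMr ?mul1r ?lerD2r// lt_neqAle eq_sym ba0 subr_ge0.
  have ts : t = a + (b - a) * s.
    have [ba0|ba0] := eqVneq (b - a) 0; first by rewrite ba0 mul0r; lra.
    by rewrite /s mulrC mulfVK// addrC subrK.
  have h := @cvg_dyidx R s s0.
  have hq : q n (dyidx n s) @[n --> \oo] --> t.
    rewrite ts; apply: cvgD; first exact: cvg_cst.
    apply: cvgMr; rewrite (_ : (fun n => _) = (fun n => dyadic R n (dyidx n s)))//.
    apply/funext => n; rewrite min_r//.
    by have /andP[+ _] := dyidxP n s0; move=> /le_trans; apply.
  have hc := cvg_comp _ _ hq (@cc x t).
  have m0 : 0 < m.+1%:R^-1 :> R by rewrite invr_gt0.
  have [N _ HN] : \forall n \near \oo, enorm (c x (q n (dyidx n s)) - c x t) < m.+1%:R^-1.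
    apply: (@cvgr_lt _ _ _ _ (fun n => enorm (c x (q n (dyidx n s)) - c x t)) 0) => //.
    have h1 : c x (q n (dyidx n s)) - c x t @[n --> \oo] --> c x t - c x t.
      by apply: cvgB; [exact: hc|exact: cvg_cst].
    have := cvg_comp _ _ h1 (@continuous_enorm R d _).
    by rewrite subrr enorm0.
  by exists N => //; exists (dyidx N s) => //; exact: HN (leqnn N).
have cf : {within `[a, b], continuous (fun t => enorm (c x t - z))}.
  apply: continuous_subspaceT => t.
  apply: (@continuous_comp _ _ _ (fun t => c x t - z) (@enorm R d)).
    by apply: cvgB; [exact: cc|exact: cvg_cst].
  exact: continuous_enorm.
have [t0 tab Ht] := EVT_min ab cf.
exists t0; split; first by move: tab; rewrite in_itv.
apply/eqP; rewrite -subr_eq0; apply/eqP/enorm_eq0/le_anti.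
rewrite enorm_ge0 andbT leNgt; apply/negP => e0.
have [n _ [k _ /= Hnk]] := H (Num.truncn (enorm (c x t0 - z))^-1) I.
have := lt_trans Hnk (truncnV_lt e0); rewrite ltNge Ht//.
by rewrite in_itv; exact: qab.
Qed.

Lemma measurable_hit_co (a b : R) : a < b ->
  measurable [set p : X * borel 'rV[R]_d |
    exists t, a <= t < b /\ c p.1 t = p.2].
Proof.
move=> ab; rewrite (_ : [set _ | _] = \bigcup_m [set p : X * borel 'rV[R]_d |
    exists t, a <= t <= b - (b - a) * m.+1%:R^-1 /\ c p.1 t = p.2]).
  apply: bigcupT_measurable => m; apply: measurable_hit_cc.
  rewrite lerBrDl -lerBrDr -[leRHS]mulr1 ler_wpM2l ?subr_ge0 ?(ltW ab)//.
  by rewrite invf_le1// ler1n.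
have ba : 0 < b - a by rewrite subr_gt0.
apply/seteqP; split => [[x z] /= [t [/andP[at_ tb] tz]]|[x z] [m _ /= [t [/andP[at_ tb] tz]]]].
  have e0 : 0 < (b - t) / (b - a) by rewrite divr_gt0// subr_gt0.
  exists (Num.truncn ((b - t) / (b - a))^-1) => //=; exists t; split => //.
  rewrite at_/= lerBrDl -lerBrDr mulrC -ler_pdivlMr//.
  exact/ltW/truncnV_lt.
exists t; split => //; rewrite at_/=; apply: le_lt_trans tb _.
by rewrite ltrBlDr ltrDl mulr_gt0// invr_gt0.
Qed.

Variable T : X -> \bar R.
Hypothesis mT : measurable_fun setT T.

(** [T] is compared with the left end of the interval rather than with the hitting time, which
    decouples the two conditions and makes each of them measurable. *)
Definition dyhit n k : set (X * borel 'rV[R]_d) :=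
  [set p | ((dyadic R n k)%:E <= T p.1)%E /\
    exists t, dyadic R n k <= t < dyadic R n k.+1 /\ c p.1 t = p.2].

Lemma measurable_dyhit n k : measurable (dyhit n k).
Proof.
apply: measurableI; last by apply: measurable_hit_co; exact: dyadic_ltS.
have <- : (fun p : X * borel 'rV[R]_d => T p.1) @^-1` `[(dyadic R n k)%:E, +oo[ =
    (fun p => ((dyadic R n k)%:E <= T p.1)%E).
  by apply/funext => p /=; rewrite in_itv/= andbT.
rewrite -[X in measurable X]setTI.
apply: (measurableT_comp mT measurable_fst) => //.
exact: emeasurable_itv.
Qed.

Definition hits x (z : 'rV[R]_d) : set R :=
  [set t | [/\ 0 <= t, (t%:E <= T x)%E & c x t = z]].

Hypothesis T0 : forall x, (0 <= T x)%E.
Hypothesis cT : forall x s t, (T x <= s%:E)%E -> (T x <= t%:E)%E -> c x s = c x t.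

(* A hit occurring after the stopping time T in a dyadic interval that starts
   before T may be replaced with a hit at T. *)
Lemma image_dyidx_hits n x z : dyidx n @` hits x z = [set k | dyhit n k (x, z)].
Proof.
apply/seteqP; split => [_ [t [t0 tT tz] <-]|k [/= kT [t [tk tz]]]].
  have /andP[h1 h2] := dyidxP n t0; split => /=.
    by apply: le_trans tT; rewrite lee_fin.
  by exists t; rewrite h1 h2.
have t0 : 0 <= t by have /andP[+ _] := tk; apply: le_trans; exact: dyadic_ge0.
have [tT|Tt] := leP t%:E (T x).
  by exists t; [split|exact: dyidx_eq].
have fT : T x \is a fin_num by rewrite ge0_fin_numE//; apply: lt_trans Tt (ltry _).
exists (fine (T x)).
  split; [by rewrite fine_ge0|by rewrite fineK|].
  by rewrite -tz; apply: cT; rewrite ?fineK// ltW.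
apply: dyidx_eq; move: kT Tt; rewrite -(fineK fT) lee_fin lte_fin/= => -> Tt.
by have /andP[_ ] := tk; apply: lt_trans.
Qed.

Lemma counting_hitsE x z : (counting (hits x z) : \bar R) =
  limn_einf (fun n => \sum_(k <oo) (\1_(dyhit n k) (x, z))%:E)%E.
Proof.
rewrite -limn_einf_counting_dyidx; last by move=> t [].
congr limn_einf; apply/funext => n; rewrite image_dyidx_hits counting_dirac.
by apply: eq_eseriesr => k _; rewrite diracE indicE; congr (_%:R%:E); apply/idP/idP;
  rewrite !inE.
Qed.

Lemma measurable_counting_hits :
  measurable_fun setT (fun p : X * borel 'rV[R]_d => counting (hits p.1 p.2) : \bar R).
Proof.
have -> : (fun p : X * borel 'rV[R]_d => counting (hits p.1 p.2) : \bar R) =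
    (fun p => limn_einf (fun n => \sum_(k <oo) (\1_(dyhit n k) p)%:E)%E).
  by apply/funext => -[x z]; exact: counting_hitsE.
apply: measurableT_comp => //; apply: measurable_fun_limn_esup => n.
apply: measurableT_comp => //; apply: ge0_emeasurable_sum => // k _.
by apply/measurable_EFinP; apply: measurable_indic; exact: measurable_dyhit.
Qed.

End hitting_sets.

(** * Area formula *)

Section hausdorff_increments.
Local Open Scope ereal_scope.
Context (R : realType) (d : nat).

Lemma hausdorff1_deltaU delta (A B : set 'rV[R]_d) : (0 < delta)%R ->
  hausdorff1_delta delta (A `|` B) <=
  hausdorff1_delta delta A + hausdorff1_delta delta B.
Proof.
move=> d0; rewrite hausdorff1_deltaE//.
have := @mu_ext_sigma_subadditive _ (g_sigma_algebraType [set: set 'rV[R]_d]) R _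
  (@ediam_cut_ge0 R d delta) (bigcup2 A B).
rewrite bigcup2E => /le_trans; apply.
have c0 n : (1 < n)%N -> mu_ext (@ediam_cut R d delta) (bigcup2 A B n) = 0.
  by case: n => [|[|n]]// _; apply: mu_ext0; [exact: ediam_cut0|exact: ediam_cut_ge0].
rewrite (nneseries_split 0 2); last by move=> k _; apply: mu_ext_ge0; exact: ediam_cut_ge0.
rewrite add0n big_nat_recr//= big_nat1/= eseries0 ?adde0//.
by move=> n n2 _; exact: c0.
Qed.

Lemma hausdorff1_delta_le_ediam delta (A : set 'rV[R]_d) :
  ediam A <= delta%:E -> hausdorff1_delta delta A <= ediam A.
Proof.
move=> dA.
apply: le_trans (hausdorff1_delta_le_cover (U := fun n => if n is 0%N then A else set0) _ _) _.
- by move=> x Ax; exists 0%N.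
- by case=> // n; apply: le_trans dA; exact: le_ediam.
- rewrite (nneseries_split 0 1); last by move=> *; exact: ediam_ge0.
  by rewrite add0n big_nat1 eseries0 ?adde0// => -[|n]// _ _; exact: ediam0.
Qed.

Variable c : R -> 'rV[R]_d.
Hypothesis cl : forall s t, (enorm (c s - c t) <= `|s - t|)%R.

Local Notation leb := (@lebesgue_measure R).

(** Bisection down to arcs of duration at most [e]: such an arc covers itself, and its diameter is
    at most the integral of the speed, which is additive over the halves. *)
Lemma hausdorff1_image_le (a b : R) : (0 <= a)%R -> (a <= b)%R ->
  hausdorff1 (c @` `[a, b]) <= \int[leb]_(t in `]a, b]) mspeed c t.
Proof.
move=> a0 ab; apply: hausdorff1_le => e e0.
have [p] : exists p, (b - a <= e * 2 ^+ p)%R.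
  exists (Num.truncn ((b - a) / e)).+1.
  have ba0 : (0 <= (b - a) / e)%R by rewrite divr_ge0 ?subr_ge0// ltW.
  rewrite mulrC -ler_pdivrMr//.
  have /andP[_ h] := Num.Theory.truncn_itv ba0.
  apply: le_trans (ltW h) _; rewrite -natrX ler_nat ltnW//.
  exact: ltn_expl.
elim: p a b a0 ab => [|p IH] a b a0 ab.
  rewrite mulr1 => bae.
  have cd (u v : R) : (a <= u)%R -> (u <= b)%R -> (a <= v)%R -> (v <= b)%R ->
      (enorm (c u - c v))%:E <= \int[leb]_(t in `]a, b]) mspeed c t.
    wlog uv : u v / (u <= v)%R.
      move=> H au ub av vb; have [uv|/ltW vu] := leP u v; first exact: H.
      by rewrite enorm_distC; exact: H.
    move=> au ub av vb; rewrite enorm_distC.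
    apply: le_trans (curve_increment cl _ uv) _; first exact: le_trans au.
    apply: ge0_subset_integral => //.
    - exact: measurable_funTS (measurable_mspeed1 c).
    - by move=> t _; exact: mspeed_ge0.
    - move=> t /=; rewrite !in_itv/= => /andP[ut tv].
      by rewrite (le_lt_trans au)//= (le_trans tv).
  apply: le_trans (hausdorff1_delta_le_ediam _) _.
    apply: ediam_le; first exact: ltW.
    move=> _ _ [u /= +] <- [v /= +] <-; rewrite !in_itv/= => /andP[? ?] /andP[? ?].
    apply: le_trans (cl u v) _; apply: le_trans bae.
    by rewrite ler_norml; lra.
  apply: ge_ereal_sup => _ [->|[[_ _] [/= [u + <-] [v + <-]] <-]].
    by apply: integral_ge0 => t _; exact: mspeed_ge0.
  by rewrite /= !in_itv/= => /andP[? ?] /andP[? ?]; exact: cd.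
move=> bae; pose m : R := ((a + b) / 2)%R.
have am : (a <= m)%R by rewrite /m; lra.
have mb : (m <= b)%R by rewrite /m; lra.
have H1 := IH a m a0 am; have H2 := IH m b (le_trans a0 am) mb.
rewrite exprS in bae.
have ma : (m - a <= e * 2 ^+ p)%R by rewrite /m; lra.
have bm : (b - m <= e * 2 ^+ p)%R by rewrite /m; lra.
have -> : c @` `[a, b] = c @` `[a, m] `|` c @` `[m, b].
  rewrite -image_setU; congr (_ @` _); apply/seteqP; split => t /=.
    rewrite !in_itv/= => /andP[at_ tb]; have [tm|/ltW mt] := leP t m; [left|right].
      by rewrite at_.
    by rewrite mt.
  rewrite !in_itv/= => -[] /andP[h1 h2]; rewrite ?h1 ?h2 ?andbT/=.
    exact: le_trans mb.
  exact: le_trans h1.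
apply: le_trans (hausdorff1_deltaU _ _ e0) _.
apply: le_trans (leeD (H1 ma) (H2 bm)) _.
rewrite -ge0_integral_setU//.
- by rewrite -itv_bndbnd_setU.
- exact: measurable_funTS (measurable_mspeed1 c).
- by move=> t _; exact: mspeed_ge0.
- by apply/disj_setPRL => t /=; rewrite !in_itv/= => /andP[mt _] /andP[_]; lra.
Qed.

(** On [a, b[ the distance to [c a] already takes all values below the chord length; half-open
    intervals are needed because the dyadic ones are. *)
Lemma hausdorff1_image_ge (a b : R) : (a <= b)%R ->
  (enorm (c b - c a))%:E <= hausdorff1 (c @` `[a, b[).
Proof.
move=> ab; apply: (@hausdorff1_lip_ge _ _ _ (fun z => enorm (z - c a))).
  by move=> x y; exact: enorm_dist_dist.
move=> r; rewrite /= in_itv/= => /andP[r0 rb].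
have cf : {within `[a, b], continuous (fun t => enorm (c t - c a))}.
  apply: continuous_subspaceT => t.
  apply: (@continuous_comp _ _ _ (fun t => c t - c a)%R (@enorm R d)).
    by apply: cvgB; [exact: lipschitz_curve_continuous|exact: cvg_cst].
  exact: continuous_enorm.
have [|t tab ft] := @IVT _ _ a b r ab cf.
  by rewrite subrr enorm0 ge_min r0/= le_max (ltW rb) orbT.
exists (c t) => //; exists t => //=; move: tab; rewrite !in_itv/= => /andP[-> tb].
rewrite lt_neqAle tb andbT; apply/eqP => tb'.
by move: rb; rewrite -ft tb' ltxx.
Qed.

End hausdorff_increments.

Section borel_open_eq.
Local Open Scope ereal_scope.
Context (R : realType) (d : nat).
Variables m1 m2 : {measure set (borel 'rV[R]_d) -> \bar R}.
Hypotheses (m1oo : m1 setT < +oo) (m21 : m2 setT <= m1 setT)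
  (m12 : forall U : set 'rV[R]_d, open U -> m1 U <= m2 U).

(** Taking complements, the bounds on open sets and on the total mass give the reverse inequality on
    closed sets; open sets are increasing unions of closed ones. *)
Lemma measure_open_eq (U : set 'rV[R]_d) : open U -> m1 U = m2 U.
Proof.
have mop (V : set 'rV[R]_d) : open V -> measurable (V : set (borel 'rV[R]_d)).
  exact: sub_sigma_algebra.
have cl21 (C : set 'rV[R]_d) : closed C -> m2 C <= m1 C.
  move=> clC; have oC : open (~` C) by exact: closed_openC.
  have mC : measurable (C : set (borel 'rV[R]_d)).
    by rewrite -(setCK C); apply: measurableC; exact: mop.
  have split_ (m : {measure set (borel 'rV[R]_d) -> \bar R}) : m setT = m C + m (~` C).
    rewrite -measureU//; first by rewrite setUv.
      exact: mop.
    by rewrite setICr.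
  have f2 : m2 (~` C) \is a fin_num.
    rewrite ge0_fin_numE//; apply: le_lt_trans m1oo; apply: le_trans m21.
    by apply: le_measure; rewrite ?inE//; exact: mop.
  rewrite -(leeD2rE _ _ f2) -split_; apply: le_trans m21 _; rewrite split_.
  by apply: leeD2l; exact: m12.
move=> oU; apply/eqP; rewrite eq_le m12//=.
(* The points at distance at least 1/(n+1) from the complement of [U]. *)
pose F n : set 'rV[R]_d := ~` \bigcup_(y in ~` U) ball y n.+1%:R^-1.
have clF n : closed (F n).
  by apply: open_closedC; apply: bigcup_open => y _; exact: ball_open.
have mF n : measurable (F n : set (borel 'rV[R]_d)).
  by rewrite -(setCK (F n)); apply: measurableC; apply: mop; exact: closed_openC.
have FU n : F n `<=` U.
  move=> x Fx; apply: contrapT => Ux; apply: Fx; exists x => //.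
  by apply: ballxx; rewrite invr_gt0.
have UE : U = \bigcup_n F n.
  apply/seteqP; split => [x Ux|x [n _]]; last exact: FU.
  have : nbhs x U by exact: open_nbhs_nbhs.
  rewrite -nbhs_ballE => -[e /= e0 eU].
  exists (Num.truncn e^-1) => // -[y Uy yx]; apply: Uy; apply: eU.
  apply: ball_sym; apply: le_ball yx; exact/ltW/truncnV_lt.
have ndF : nondecreasing_seq F.
  move=> i j ij; apply/subsetPset => x Fx [y Uy yx]; apply: Fx; exists y => //.
  by apply: le_ball yx; rewrite lef_pV2 ?posrE// ler_nat.
have := nondecreasing_cvg_mu (mu := m2) mF _ ndF; rewrite -UE => /(_ (mop _ oU)) cvF.
rewrite -(cvg_lim _ cvF)//; apply: lime_le; first by apply/cvg_ex; exists (m2 U).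
apply: nearW => n; apply: le_trans (cl21 _ (clF n)) _.
by apply: le_measure; rewrite ?inE//; exact: mop.
Qed.

End borel_open_eq.

Section area_formula.
Local Open Scope ereal_scope.
Context (R : realType) (d : nat) (c : R -> 'rV[R]_d) (T : \bar R).
Hypothesis cl : forall s t, (enorm (c s - c t) <= `|s - t|)%R.
Hypothesis T0 : 0 <= T.
Hypothesis cT : forall s t, T <= s%:E -> T <= t%:E -> c s = c t.

Local Notation leb := (@lebesgue_measure R).
Local Notation H1 := (@hausdorff1 R d).

(** A single curve is a family indexed by [unit], so the results on hitting sets of families apply
    to it. *)
Let c1 (_ : unit) := c.
Let T1 (_ : unit) := T.

Let mc1 t : measurable_fun setT ((c1^~ t) : unit -> borel 'rV[R]_d).
Proof. exact: measurable_cst. Qed.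

Let cc1 x : continuous (c1 x).
Proof. exact: lipschitz_curve_continuous. Qed.

Let mT1 : measurable_fun setT T1.
Proof. exact: measurable_cst. Qed.

Let Y n k : set (borel 'rV[R]_d) := [set z | dyhit c1 T1 n k (tt, z)].

Let mY n k : measurable (Y n k).
Proof.
rewrite -[X in measurable X]setTI.
apply: (measurable_pair1 tt) => //; exact: measurable_dyhit.
Qed.

Definition hits1 z := hits c1 T1 tt z.

Definition nhits z : \bar R := counting (hits1 z).

Let le_hits n z : \sum_(k <oo) (\1_(Y n k) z)%:E <= nhits z.
Proof.
apply: le_trans (counting_image_le R (@dyidx R n) (hits1 z)).
rewrite image_dyidx_hits// counting_dirac; apply: lee_nneseries => // k _.
Qed.

Let hitsE z : nhits z = limn_einf (fun n => \sum_(k <oo) (\1_(Y n k) z)%:E).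
Proof.
by rewrite /nhits counting_hitsE.
Qed.

Let msum n : measurable_fun setT (fun z : borel 'rV[R]_d => \sum_(k <oo) (\1_(Y n k) z)%:E : \bar R).
Proof.
apply: ge0_emeasurable_sum => // k _.
by apply/measurable_EFinP; apply: measurable_indic; exact: mY.
Qed.

Lemma measurable_counting_hits1 :
  measurable_fun setT (fun z : borel 'rV[R]_d => nhits z).
Proof.
have H := measurable_counting_hits mc1 cc1 mT1 (fun=> T0) (fun=> cT).
exact: (measurableT_comp H (measurable_pair1 tt)).
Qed.

Lemma integral_dyadic n (f : R -> \bar R) :
  measurable_fun setT f -> (forall t, 0 <= f t) ->
  \int[leb]_(t in `[0%R, +oo[) f t =
  \sum_(k <oo) \int[leb]_(t in `[dyadic R n k, dyadic R n k.+1[) f t.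
Proof.
move=> mf f0.
have -> : `[0%R, +oo[%classic = \bigcup_k `[dyadic R n k, dyadic R n k.+1[%classic.
  apply/seteqP; split => t /=; rewrite in_itv/= ?andbT => t0.
    by exists (dyidx n t) => //=; rewrite in_itv/=; exact: dyidxP.
  have [k _ /=] := t0; rewrite in_itv/= => /andP[+ _].
  by apply: le_trans; exact: dyadic_ge0.
rewrite ge0_integral_bigcup//; first exact: measurable_funTS.
by move=> i j _ _ [t [/= ti tj]]; rewrite in_itv/= in ti, tj;
  rewrite -(dyidx_eq ti) (dyidx_eq tj).
Qed.

(** By Fatou it suffices to bound the dyadic counts, and each [Y n k] lies in an arc whose measure
    is at most the integral of the speed over its interval. *)
Lemma int_counting_hits_le :
  \int[H1]_z nhits z <= \int[leb]_(t in `[0%R, +oo[) mspeed c t.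
Proof.
under eq_integral do rewrite hitsE.
apply: le_trans (fatou _ _ msum _) _ => //.
  by move=> n z _; apply: nneseries_ge0 => *; rewrite lee_fin.
apply: limn_einf_le => n.
rewrite integral_nneseries//; last by move=> k; apply/measurable_EFinP; apply: measurable_indic; exact: mY.
rewrite (integral_dyadic n (measurable_mspeed1 c) (mspeed_ge0 c)).
apply: lee_nneseries => [k _ _|k _]; first exact: integral_ge0.
rewrite integral_indic// setIT.
apply: (@le_trans _ _ (hausdorff1 (c @` `[dyadic R n k, dyadic R n k.+1]))).
  apply: le_hausdorff1 => z [/= _ [t [/andP[h1 h2] tz]]].
  by exists t => //=; rewrite in_itv/= h1 ltW.
apply: le_trans (hausdorff1_image_le cl (dyadic_ge0 R n k) (ltW (dyadic_ltS R n k))) _.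
rewrite -integral_itv_bndo_bndc//; last exact: measurable_funTS (measurable_mspeed1 c).
by rewrite integral_itv_bndoo//; apply: measurable_funTS (measurable_mspeed1 c).
Qed.

Let mc : measurable_fun setT (c : R -> borel 'rV[R]_d).
Proof. exact: measurable_lipschitz_curve. Qed.

Lemma slope_after_stop n k : T < (dyadic R n k)%:E -> slope c n k = 0%R.
Proof.
move=> Tk; rewrite /slope (cT (t := dyadic R n k)) ?subrr ?enorm0 ?mulr0// ltW//.
by apply: lt_trans Tk _; rewrite lte_fin dyadic_ltS.
Qed.

(** Fatou in time, with the slopes of those dyadic intervals that are mapped into [U]: slope times
    duration is a chord, at most the measure of an arc inside [U]. As [U] is open, the interval
    around a time spent in [U] is eventually retained. *)
Lemma int_mspeed_open_le (U : set 'rV[R]_d) : open U ->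
  \int[leb]_(t in `[0%R, +oo[ `&` c @^-1` U) mspeed c t <=
  \int[H1]_(z in U) nhits z.
Proof.
move=> oU; have mU : measurable (U : set (borel 'rV[R]_d)) by exact: sub_sigma_algebra.
have mcU : measurable (c @^-1` U) by rewrite -[X in measurable X]setTI; exact: mc.
pose J n k : set R := `[dyadic R n k, dyadic R n k.+1[%classic.
pose v n k : R := if `[< J n k `<=` c @^-1` U >] then slope c n k else 0%R.
pose f n (t : R) : \bar R := (v n (dyidx n t))%:E.
have v0 n k : (0 <= v n k)%R by rewrite /v; case: ifP => // _; exact: slope_ge0.
have mf n : measurable_fun setT (f n).
  apply/measurable_EFinP.
  have := @measurable_dyadic_step R n _ unit _ R (fun k _ => v n k) (fun=> measurable_cst _).
  by move=> H; exact: (measurableT_comp H (measurable_pair1 tt)).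
have intf n : \int[leb]_(t in `[0%R, +oo[) f n t <= \int[H1]_(z in U) nhits z.
  rewrite (integral_dyadic n (mf n)); last by move=> t; rewrite lee_fin.
  apply: (@le_trans _ _ (\int[H1]_(z in U) \sum_(k <oo) (\1_(Y n k) z)%:E)); last first.
    apply: ge0_le_integral_any => [z _|z _]; last exact: le_hits.
    by apply: nneseries_ge0 => *; rewrite lee_fin.
  rewrite integral_nneseries//; last first.
    move=> k; apply/measurable_EFinP; apply: measurable_funTS.
    by apply: measurable_indic; exact: mY.
  apply: lee_nneseries => [k _ _|k _].
    by apply: integral_ge0 => t _; rewrite lee_fin.
  rewrite integral_indic//.
  rewrite (_ : \int[leb]_(t in _) _ = (v n k / 2 ^+ n)%:E); last first.
    transitivity (\int[leb]_(t in `[dyadic R n k, dyadic R n k.+1[) (v n k)%:E).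
      apply: eq_integral => t /[!inE]/=; rewrite in_itv/= => tk.
      by rewrite /f (dyidx_eq tk).
    rewrite integral_cst//= lebesgue_measure_itv/= lte_fin dyadic_ltS.
    by rewrite -EFinB dyadicS -EFinM.
  rewrite /v; case: ifPn => [/asboolP JU|_]; last by rewrite mul0r; exact: hausdorff1_ge0.
  (* [Y n k] only counts intervals that start no later than [T]; on the later ones the slope
     vanishes. *)
  have [kT|Tk] := leP (dyadic R n k)%:E T; last first.
    by rewrite slope_after_stop// mul0r; exact: hausdorff1_ge0.
  rewrite /slope mulrAC mulfV ?mul1r ?gt_eqF ?exp2_gt0//.
  apply: le_trans (hausdorff1_image_ge cl (ltW (dyadic_ltS R n k))) _.
  apply: le_hausdorff1 => _ [t tk <-]; split; last exact: JU.
  by split => //; exists t; move: tk; rewrite /= in_itv.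
apply: (@le_trans _ _ (\int[leb]_(t in `[0%R, +oo[) limn_einf (f ^~ t))); last first.
  apply: le_trans (fatou _ _ _ _) _ => //.
  - by move=> n; exact: measurable_funTS (mf n).
  - by move=> n t _; rewrite lee_fin.
  - exact: limn_einf_le.
rewrite integral_mkcondr; apply: ge0_le_integral_any => // t.
  by move=> _; rewrite patchE; case: ifPn => // _; exact: mspeed_ge0.
rewrite /= in_itv/= andbT => t0; rewrite patchE.
case: ifPn => [/set_mem/= Uct|_]; last first.
  by apply: limn_einf_ge; apply: nearW => n; rewrite lee_fin.
apply: le_limn_einf.
have : nbhs t (c @^-1` U).
  by apply: (@lipschitz_curve_continuous R d c cl t); exact: open_nbhs_nbhs.
rewrite -nbhs_ballE => -[e /= e0 eU].
have : \forall n \near \oo, ((2^-1 ^+ n : R) < e)%R.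
  apply: (@cvgr_lt _ _ _ _ (fun n => (2^-1 ^+ n : R)%R) 0%R) => //.
  by apply: cvg_expr; rewrite ger0_norm ?invr_ge0// invf_lt1// ltr1n.
apply: filterS => n; rewrite exprVn => ne; rewrite /f /v asboolT// => s.
rewrite /J/= in_itv/= => /andP[s1 s2]; apply: eU; rewrite /ball/= ltr_norml.
have /andP[t1 t2] := dyidxP n t0; have := dyadicS R n (dyidx n t).
by move=> h; apply/andP; split; lra.
Qed.

Hypothesis Loo : \int[leb]_(t in `[0%R, +oo[) mspeed c t < +oo.

(** The finite length [Loo] makes the two bounds above meet the assumptions of [measure_open_eq]. *)
Lemma area_formula (f : borel 'rV[R]_d -> \bar R) :
  measurable_fun setT f -> (forall z, 0 <= f z) ->
  \int[leb]_(t in `[0%R, +oo[) (f (c t) * mspeed c t) = \int[H1]_z (f z * nhits z).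
Proof.
move=> mf f0.
pose g := mspeed c \_ `[0%R, +oo[.
have g0 t : 0 <= g t by rewrite /g patchE; case: ifP => // _; exact: mspeed_ge0.
have mg : measurable_fun setT g.
  apply/(measurable_restrictT _ (measurable_itv _)).
  exact: measurable_funTS (measurable_mspeed1 c).
have mh := measurable_counting_hits1.
have h0 z : 0 <= nhits z by rewrite /nhits /counting; case: ifP => _; rewrite ?leey.
have gE (D : set R) : \int[leb]_(t in D) g t = \int[leb]_(t in `[0%R, +oo[ `&` D) mspeed c t.
  by rewrite integral_mkcondl.
transitivity (\int[leb]_t (f (c t) * g t)).
  rewrite [LHS]integral_mkcond; apply: eq_integral => t _.
  by rewrite /g !patchE; case: ifP => _ //; rewrite mule0.
apply: (integral_pushforward_density (m := leb) (n := H1) mc mg mh g0 h0) => //.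
- by rewrite gE setIT.
- pose m0 : {measure set (borel 'rV[R]_d) -> \bar R} := 
    pushforward (density leb mg g0) (c : measurableTypeR R -> borel 'rV[R]_d).
  pose m1 := m0 mc.
  pose m2 : {measure set (borel 'rV[R]_d) -> \bar R} := density H1 mh h0.
  have m1E (A : set (borel 'rV[R]_d)) : m1 A = \int[leb]_(t in `[0%R, +oo[ `&` c @^-1` A) mspeed c t.
    exact: gE.
  have m2E (A : set (borel 'rV[R]_d)) : m2 A = \int[H1]_(z in A) nhits z by [].
  move=> U oU; apply: (@measure_open_eq _ _ m1 m2).
  + by rewrite m1E preimage_setT setIT.
  + by rewrite m1E preimage_setT setIT m2E; exact: int_counting_hits_le.
  + by move=> V oV; rewrite m1E m2E; exact: int_mspeed_open_le.
  + exact: oU.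
Qed.

End area_formula.

(** * Measurability on the space of curves *)

Section gamma.
Context (R : realType) (d : nat) (K : set 'rV[R]_d) (K0 : K !=set0).
Implicit Types g : Gamma K0.

Lemma curveP g : lip_curves K (curve g).
Proof. exact: (@set_valP _ (lip_curves K) g). Qed.

Lemma curve_mem g t : 0 <= t -> K (curve g t).
Proof. by have [H _ _] := curveP g; exact: H. Qed.

Lemma curve_neg g t : t < 0 -> curve g t = curve g 0.
Proof. by have [_ _ H] := curveP g; exact: H. Qed.

Lemma curve_lip g s t : enorm (curve g s - curve g t) <= `|s - t|.
Proof.
have H u v : 0 <= u -> 0 <= v -> enorm (curve g u - curve g v) <= `|u - v|.
  by have [_ H _] := curveP g; exact: H.
have [s0|s0] := ltP s 0; have [t0|t0] := ltP t 0.
- by rewrite !curve_neg// subrr enorm0.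
- rewrite curve_neg//; apply: le_trans (H _ _ (lexx 0) t0) _.
  by rewrite sub0r normrN ger0_norm// distrC ger0_norm; lra.
- rewrite (curve_neg g t0); apply: le_trans (H _ _ s0 (lexx 0)) _.
  by rewrite subr0 !ger0_norm; lra.
- exact: H.
Qed.

Lemma curve_continuous g : continuous (curve g).
Proof. exact: lipschitz_curve_continuous (@curve_lip g). Qed.

(** Singletons are compact, so the topology of the space of curves refines pointwise convergence. *)
Lemma curve_eval_continuous (t : R) : 0 <= t -> continuous (fun g => curve g t).
Proof.
move=> t0 g.
pose F := {family @compact_nonneg R, R -> 'rV[R]_d}.
have h1 : (@curve R d K K0 : Gamma K0 -> F) g' @[g' --> g] --> (curve g : F).
  exact: (@initial_continuous _ _ (set_val : set_type (lip_curves K) -> F) g).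
have h2 : {uniform [set t], nbhs (curve g : F) --> curve g}.
  have /fam_cvgP : {family @compact_nonneg R, nbhs (curve g : F) --> curve g}.
    by rewrite fam_cvgE.
  apply; split; first exact: compact_set1.
  by move=> _ /= ->; rewrite in_itv/= t0.
move: h2; rewrite uniform_set1 => h2.
exact: (cvg_comp _ _ h1 h2).
Qed.

Lemma measurable_curve_eval (t : R) :
  measurable_fun setT ((fun g => curve g t) : borel (Gamma K0) -> borel 'rV[R]_d).
Proof.
wlog t0 : t / 0 <= t.
  move=> H; have [|t0] := leP 0 t; first exact: H.
  by under eq_fun do rewrite curve_neg//; exact: H.
apply: measurable_fun_rV => i; apply: (@measurable_continuous_borel R (Gamma K0)) => g.
exact: (cvg_comp _ _ (@curve_eval_continuous t t0 g) (@continuous_coord R d i _)).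
Qed.

Lemma measurable_curve :
  measurable_fun setT ((fun p => curve (p.1 : Gamma K0) p.2) :
    (borel (Gamma K0) * R)%type -> borel 'rV[R]_d).
Proof.
apply: (@measurable_eval R _ (borel (Gamma K0)) d (fun g => curve (g : Gamma K0))).
- exact: measurable_curve_eval.
- by move=> g; exact: curve_continuous.
- by move=> g t; exact: curve_neg.
Qed.

Lemma measurable_curve_mspeed :
  measurable_fun setT ((fun p => mspeed (curve (p.1 : Gamma K0)) p.2) :
    (borel (Gamma K0) * R)%type -> \bar R).
Proof.
apply: (@measurable_mspeed R _ (borel (Gamma K0)) d (fun g => curve (g : Gamma K0))).
exact: measurable_curve_eval.
Qed.

Definition stopped g (t : R) := forall s, t <= s -> curve g s = curve g t.

Lemma stoppedW g t t' : t <= t' -> stopped g t -> stopped g t'.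
Proof.
move=> tt' st s t's; rewrite (st t' tt').
by rewrite st// (le_trans tt').
Qed.

Lemma stop_time_ge0 g : (0 <= stop_time g)%E.
Proof.
by apply: le_ereal_inf_tmp => _ [t [t0 _] <-]; rewrite lee_fin.
Qed.

Lemma stop_time_lt g (a : R) :
  (stop_time g < a%:E)%E <-> exists t, [/\ 0 <= t, t < a & stopped g t].
Proof.
split => [/ereal_inf_lt [_ [t [t0 st] <-]]|[t [t0 ta st]]].
  by rewrite lte_fin => ta; exists t.
apply: (@le_lt_trans _ _ t%:E); last by rewrite lte_fin.
by apply: ereal_inf_lbound; exists t.
Qed.

(** Clear strictly after the stopping time; continuity extends it to the stopping time itself, which
    is only an infimum. *)
Lemma curve_stop_time g s t :
  (stop_time g <= s%:E)%E -> (stop_time g <= t%:E)%E -> curve g s = curve g t.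
Proof.
have H u v : (stop_time g < u%:E)%E -> (stop_time g < v%:E)%E -> curve g u = curve g v.
  move=> /stop_time_lt[a [_ au sa]] /stop_time_lt[b [_ bv sb]].
  have [ab|/ltW ba] := leP a b.
    by rewrite (sa u (ltW au)) -(sa b ab) (sb v (ltW bv)).
  by rewrite (sb v (ltW bv)) -(sb a ba) (sa u (ltW au)).
have H2 u v : (stop_time g <= u%:E)%E -> (stop_time g < v%:E)%E -> curve g u = curve g v.
  move=> ug vg; apply/eqP; rewrite -subr_eq0; apply/eqP/enorm_eq0.
  apply: le_anti; rewrite enorm_ge0 andbT leNgt; apply/negP => e0.
  (* A time so close to [u] that a 1-Lipschitz curve cannot move by [e] in between. *)
  set e := enorm _ in e0; pose w := u + e / 2.
  have uw : u < w by rewrite ltrDl divr_gt0.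
  have wg : (stop_time g < w%:E)%E by apply: le_lt_trans ug _; rewrite lte_fin.
  have := curve_lip g u w; rewrite (H w v wg vg) -/e distrC ger0_norm ?subr_ge0 ?(ltW uw)//.
  by move: e0; rewrite /w; clear; lra.
move=> sg tg; pose w := Num.max s t + 1.
have wg : (stop_time g < w%:E)%E.
  by apply: le_lt_trans sg _; rewrite lte_fin /w ltr_pwDr// le_max lexx.
by rewrite (H2 s w)// (H2 t w).
Qed.

Lemma measurable_stopped t : measurable [set g : borel (Gamma K0) | stopped g t].
Proof.
have -> : [set g : borel (Gamma K0) | stopped g t] = \bigcap_n \bigcap_k
    [set g : borel (Gamma K0) | enorm (curve (g : Gamma K0) (t + dyadic R n k) - curve (g : Gamma K0) t) <= 0].
  apply/seteqP; split => g /= H.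
    move=> n _ k _ /=; rewrite (H (t + _)) ?subrr ?enorm0// lerDl.
    exact: dyadic_ge0.
  move=> s ts; have st0 : 0 <= s - t by rewrite subr_ge0.
  pose c := curve (g : Gamma K0).
  have Hn n k : c (t + dyadic R n k) = c t.
    apply/eqP; rewrite -subr_eq0; apply/eqP/enorm_eq0/le_anti.
    by rewrite enorm_ge0 andbT; exact: (H n I k I).
  have h : t + dyadic R n (dyidx n (s - t)) @[n --> \oo] --> s.
    rewrite -[X in _ --> X](subrKC t); apply: cvgD; first exact: cvg_cst.
    exact: cvg_dyidx.
  have h2 : c (t + dyadic R n (dyidx n (s - t))) @[n --> \oo] --> c s.
    exact: (cvg_comp _ _ h (@curve_continuous g s)).
  have h3 : (fun n => c (t + dyadic R n (dyidx n (s - t)))) = (fun=> c t).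
    by apply/funext => n; exact: Hn.
  rewrite h3 in h2; apply: (cvg_unique (@norm_hausdorff _ _) h2).
  exact: cvg_cst.
apply: bigcapT_measurable => n; apply: bigcapT_measurable => k.
rewrite -[X in measurable X]setTI.
rewrite (_ : [set g : borel (Gamma K0) | _] =
  (fun g : borel (Gamma K0) => enorm (curve (g : Gamma K0) (t + dyadic R n k) - curve (g : Gamma K0) t))
    @^-1` `]-oo, 0]); last by apply/seteqP; split => g /=; rewrite in_itv.
have mf : measurable_fun setT (fun g : borel (Gamma K0) =>
    enorm (curve (g : Gamma K0) (t + dyadic R n k) - curve (g : Gamma K0) t)).
  by apply: measurable_fun_enormB; exact: measurable_curve_eval.
exact: mf.
Qed.

Lemma measurable_stop_time :
  measurable_fun setT (@stop_time R d K K0 : borel (Gamma K0) -> \bar R).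
Proof.
move=> mT; apply: (measurability _ (ErealGenInftyO.measurableE R)) => //.
move=> _ [_ [a ->] <-]; rewrite setTI.
have -> : (@stop_time R d K K0 : borel (Gamma K0) -> \bar R) @^-1` `]-oo, a%:E[ =
    \bigcup_n (if 0 <= a - n.+1%:R^-1 then
      [set g : borel (Gamma K0) | stopped g (a - n.+1%:R^-1)] else set0).
  apply/seteqP; split => g /=; rewrite in_itv/=.
    move=> /stop_time_lt[t [t0 ta st]].
    have e0 : 0 < a - t by rewrite subr_gt0.
    have := truncnV_lt e0; set n := Num.truncn _ => nat_.
    have tn : t <= a - n.+1%:R^-1 by rewrite lerBrDl -lerBrDr ltW.
    exists n => //; rewrite (le_trans t0 tn) /=; exact: stoppedW st.
  move=> [n _]; case: ifPn => // n0 /= st; apply/stop_time_lt.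
  by exists (a - n.+1%:R^-1); split => //; rewrite ltrBlDr ltrDl invr_gt0.
apply: bigcupT_measurable => n; case: ifP => _ //; exact: measurable_stopped.
Qed.

End gamma.

Section plan_measurability.
Context (R : realType) (d : nat) (K : set 'rV[R]_d) (K0 : K !=set0).
Implicit Types g : Gamma K0.

Local Notation G := (borel (Gamma K0)).
Local Notation Z := (borel 'rV[R]_d).

Definition incidence : set (G * Z)%type := [set p | im (p.1 : Gamma K0) p.2].

Lemma measurable_incidence : measurable incidence.
Proof.
have -> : incidence = \bigcup_n [set p : G * Z |
    exists t, 0 <= t <= n%:R /\ curve (p.1 : Gamma K0) t = p.2].
  apply/seteqP; split => [[g z] /= [t + tz]|[g z] [n _ [t [/andP[t0 tn] tz]]]].
    rewrite /= in_itv/= andbT => t0; exists (Num.truncn t).+1 => //.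
    exists t; split => //; rewrite t0/= ltW//.
    by have /andP[] := Num.Theory.truncn_itv t0.
  by exists t => //=; rewrite in_itv/= t0.
apply: bigcupT_measurable => n.
apply: (@measurable_hit_cc R _ G d (fun g => curve (g : Gamma K0))) => //.
- exact: measurable_curve_eval.
- by move=> g; exact: curve_continuous.
Qed.

Lemma measurable_im g : measurable (im g : set Z).
Proof.
rewrite -[X in measurable X]setTI.
exact: (measurable_pair1 (g : G) measurableT measurable_incidence).
Qed.

Lemma measurable_im_curves (x : Z) : measurable [set g : G | im (g : Gamma K0) x].
Proof.
rewrite -[X in measurable X]setTI.
exact: (measurable_pair2 (x : Z) measurableT measurable_incidence).
Qed.

Lemma measurable_mult :
  measurable_fun setT (fun p : (G * Z)%type => mult p.2 (p.1 : Gamma K0)).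
Proof.
apply: (@measurable_counting_hits R _ G d (fun g => curve (g : Gamma K0)) _ _
  (fun g => stop_time (g : Gamma K0))).
- exact: measurable_curve_eval.
- by move=> g; exact: curve_continuous.
- exact: measurable_stop_time.
- by move=> g; exact: stop_time_ge0.
- by move=> g s t; exact: curve_stop_time.
Qed.

Lemma mult_ge0 x g : (0 <= mult x g)%E.
Proof. by rewrite /mult /counting; case: ifP => _; rewrite ?leey. Qed.

(** A point reached after the stopping time is also reached at the stopping time, where [mult]
    counts it. *)
Lemma mult_ge1 x g : im g x -> (1 <= mult x g)%E.
Proof.
move=> [t + tx]; rewrite /= in_itv/= andbT => t0.
have [s [s0 sT sx]] : exists s, [/\ 0 <= s, (s%:E <= stop_time g)%E & curve g s = x].
  have [tT|Tt] := leP t%:E (stop_time g); first by exists t.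
  have fT : stop_time g \is a fin_num.
    by rewrite ge0_fin_numE ?stop_time_ge0//; apply: lt_trans Tt (ltry _).
  exists (fine (stop_time g)); split.
  - by rewrite fine_ge0// stop_time_ge0.
  - by rewrite fineK.
  - by rewrite -tx; apply: curve_stop_time; rewrite ?fineK// ltW.
apply: (@counting_ge_size _ _ _ [:: s]) => // y; rewrite inE => /eqP ->.
by split.
Qed.

Lemma mult_out x g : ~ im g x -> mult x g = 0%E.
Proof.
move=> xg; rewrite /mult (_ : [set _ | _] = set0).
  by rewrite /counting asboolT// fset_set0.
apply/seteqP; split => // t [t0 _ tx]; apply: xg.
by exists t => //=; rewrite in_itv/= t0.
Qed.

Variable eta : probability G R.

Lemma measurable_theta : measurable_fun setT (theta eta : Z -> \bar R).
Proof.
have := measurable_fun_ysection eta measurable_incidence.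
congr (measurable_fun _ _); apply/funext => x /=; congr (eta _).
by apply/seteqP; split => g; rewrite /ysection /= inE.
Qed.

Lemma theta_ge0 x : (0 <= theta eta x)%E.
Proof. exact: measure_ge0. Qed.

Lemma theta_le1 x : (theta eta x <= 1)%E.
Proof. by apply: probability_le1; exact: measurable_im_curves. Qed.

Lemma measurable_mult_plan : measurable_fun setT (mult_plan eta : Z -> \bar R).
Proof.
have := @measurable_fun_fubini_tonelli_G _ _ G Z R eta _ measurable_mult.
by apply => p; exact: mult_ge0.
Qed.

Definition pos_theta : set Z := [set x | theta eta x != 0%E].

Lemma measurable_pos_theta : measurable pos_theta.
Proof.
have -> : pos_theta = theta eta @^-1` (~` [set 0%E]).
  by apply/seteqP; split => x /=; [move=> /eqP|move=> /eqP].
by rewrite -[X in measurable X]setTI; apply: measurable_theta => //; exact: measurableC.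
Qed.

Lemma theta_pow_pred_ge0 a x : (0 <= theta_pow_pred eta a x)%E.
Proof. by rewrite /theta_pow_pred; case: ifP => // _; exact: poweR_ge0. Qed.

Lemma measurable_theta_pow_pred a :
  measurable_fun setT (theta_pow_pred eta a : Z -> \bar R).
Proof.
apply: measurable_fun_ifT => //.
  apply: (measurable_fun_bool false); rewrite setTI.
  rewrite (_ : _ @^-1` _ = pos_theta); first exact: measurable_pos_theta.
  by apply/seteqP; split => x /=; rewrite /pos_theta /=; case: eqP.
exact: (measurableT_comp (measurable_poweR _) measurable_theta).
Qed.

Lemma theta_pow_predM a x : theta eta x != 0%E ->
  (theta_pow_pred eta a x * theta eta x = theta_pow eta a x)%E.
Proof.
move=> x0; rewrite /theta_pow_pred /theta_pow (negbTE x0).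
have f1 : theta eta x \is a fin_num.
  by rewrite ge0_fin_numE ?theta_ge0//; apply: le_lt_trans (theta_le1 x) (ltry _).
move: x0 (theta_ge0 x); rewrite -(fineK f1); set r := fine _.
rewrite eqe lee_fin => r0 rge; rewrite !poweR_EFin -EFinM; congr EFin.
have rgt : 0 < r by rewrite lt_neqAle eq_sym r0.
by rewrite -{2}[r]powRr1// -powRD ?subrK// (gt_eqF rgt) implybT.
Qed.

End plan_measurability.

Section ae_ge0.
Local Open Scope ereal_scope.
Context d (T : measurableType d) (R : realType) (mu : {measure set T -> \bar R}).
Variable f : T -> \bar R.
Hypotheses (mf : measurable_fun setT f) (f0 : forall x, 0 <= f x).

Lemma ge0_integral_lty_ae : \int[mu]_x f x < +oo -> {ae mu, forall x, f x < +oo}.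
Proof.
move=> foo; have fi : mu.-integrable setT f.
  by apply/integrableP; split => //; under eq_integral do rewrite gee0_abs//.
have := integrable_ae measurableT fi.
apply: filterS; by move=> x /(_ I) fx; rewrite ltey_eq fx.
Qed.

Lemma ge0_integral_eq0_ae : \int[mu]_x f x = 0 <-> {ae mu, forall x, f x = 0}.
Proof.
have H := ae_eq_integral_abs mu measurableT mf.
have E : \int[mu]_x f x = \int[mu]_x `|f x|.
  by apply: eq_integral => x _; rewrite gee0_abs.
rewrite E; split => [/H|].
  apply: filterS; by move=> x /(_ I).
move=> h; apply/H; move: h.
apply: filterS; by move=> x.
Qed.

End ae_ge0.

Section curve_integrals.
Local Open Scope ereal_scope.
Context (R : realType) (d : nat) (K : set 'rV[R]_d) (K0 : K !=set0).
Implicit Types (g : Gamma K0).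

Local Notation G := (borel (Gamma K0)).
Local Notation Z := (borel 'rV[R]_d).
Local Notation leb := (@lebesgue_measure R).
Local Notation H1 := (@hausdorff1 R d).
Implicit Types (f : Z -> \bar R) (B : set Z).

(** Written with [mspeed], so that it depends measurably on [g]. *)
Definition curve_int f g : \bar R :=
  \int[leb]_(t in `[0%R, +oo[) (f (curve g t) * mspeed (curve g) t).

Lemma curve_int_ge0 f g : (forall z, 0 <= f z) -> 0 <= curve_int f g.
Proof.
by move=> f0; apply: integral_ge0 => t _; rewrite mule_ge0// mspeed_ge0.
Qed.

Lemma measurable_curve1 g : measurable_fun setT (curve g : R -> Z).
Proof. exact: (measurable_lipschitz_curve (@curve_lip _ _ _ _ g)). Qed.

Lemma measurable_mspeed_curve g : measurable_fun setT (mspeed (curve g)).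
Proof. exact: measurable_mspeed1. Qed.

Lemma measurable_curve_integrand f g : measurable_fun setT f ->
  measurable_fun setT (fun t => f (curve g t) * mspeed (curve g) t).
Proof.
move=> mf; apply: emeasurable_funM; last exact: measurable_mspeed_curve.
exact: (measurableT_comp mf (measurable_curve1 g)).
Qed.

Lemma measurable_curve_int f : measurable_fun setT f -> (forall z, 0 <= f z) ->
  measurable_fun setT (curve_int f : G -> \bar R).
Proof.
move=> mf f0.
pose F (p : (G * R)%type) : \bar R := if (0 <= p.2)%R then
  f (curve (p.1 : Gamma K0) p.2) * mspeed (curve (p.1 : Gamma K0)) p.2 else 0.
have F0 p : 0 <= F p by rewrite /F; case: ifP => // _; rewrite mule_ge0// mspeed_ge0.
have mF : measurable_fun setT F.
  apply: measurable_fun_ifT => //.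
    apply: (measurable_fun_bool true); rewrite setTI.
    rewrite (_ : _ @^-1` _ = (snd : (G * R)%type -> R) @^-1` `[0%R, +oo[).
      by rewrite -[X in measurable X]setTI; exact: measurable_snd.
    by apply/seteqP; split => p /=; rewrite in_itv/= andbT.
  apply: emeasurable_funM; last exact: measurable_curve_mspeed.
  exact: (measurableT_comp mf (@measurable_curve R d K K0)).
have := @measurable_fun_fubini_tonelli_F _ _ G (measurableTypeR R) R leb F mF F0.
congr (measurable_fun _ _); apply/funext => g.
rewrite /fubini_F /curve_int [RHS]integral_mkcond; apply: eq_integral => t _.
by rewrite patchE /F /= mem_setE in_itv/= andbT.
Qed.

Lemma ae_speed_mspeed g : {ae leb, forall t, `[0%R, +oo[%classic t ->
  (speed g t)%:E = mspeed (curve g) t}.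
Proof. exact: ae_mspeed (@curve_lip _ _ _ _ g). Qed.

Lemma lengthE g : length g = \int[leb]_(t in `[0%R, +oo[) mspeed (curve g) t.
Proof.
apply: ge0_ae_eq_integral_any => //.
- by move=> t _; rewrite lee_fin enorm_ge0.
- by move=> t _; exact: mspeed_ge0.
- exact: measurable_funTS (measurable_mspeed_curve g).
- exact: ae_speed_mspeed.
Qed.

Lemma length_curve_int g : length g = curve_int (cst 1) g.
Proof. by rewrite lengthE; apply: eq_integral => t _; rewrite mul1e. Qed.

Lemma length_ge0 g : 0 <= length g.
Proof. by apply: integral_ge0 => t _; rewrite lee_fin enorm_ge0. Qed.

Lemma measurable_length : measurable_fun setT (@length R d K K0 : G -> \bar R).
Proof.
have -> : (@length R d K K0 : G -> \bar R) = curve_int (cst 1).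
  by apply/funext => g; exact: length_curve_int.
by apply: measurable_curve_int => //; exact: measurable_cst.
Qed.

Lemma curve_int_speed f g : measurable_fun setT f -> (forall z, 0 <= f z) ->
  \int[leb]_(t in `[0%R, +oo[) (f (curve g t) * (speed g t)%:E) = curve_int f g.
Proof.
move=> mf f0; apply: ge0_ae_eq_integral_any => //.
- by move=> t _; rewrite mule_ge0// lee_fin enorm_ge0.
- by move=> t _; rewrite mule_ge0// mspeed_ge0.
- exact: measurable_funTS (measurable_curve_integrand g mf).
- apply: filterS (ae_speed_mspeed g); first exact: (ae_filter_ringOfSetsType leb).
  by move=> t /= H t0; rewrite H.
Qed.

Lemma curve_int_area f g : length g < +oo ->
  measurable_fun setT f -> (forall z, 0 <= f z) ->
  curve_int f g = \int[H1]_z (f z * mult z g).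
Proof.
move=> Loo mf f0; rewrite lengthE in Loo.
exact: (area_formula (@curve_lip _ _ _ _ g) (stop_time_ge0 g)
  (@curve_stop_time _ _ _ _ g) Loo mf f0).
Qed.

Lemma measurable_mult1 g : measurable_fun setT (fun z : Z => mult z g).
Proof.
exact: (measurableT_comp (@measurable_mult R d K K0) (measurable_pair1 (g : G))).
Qed.

(** By the area formula the left side integrates the multiplicity over [B], and the multiplicity is
    at least 1 on the image and 0 elsewhere. *)
Lemma curve_int_indic_eq0 B g : measurable B -> length g < +oo ->
  curve_int (fun z => (\1_B z)%:E) g = 0 <-> hausdorff1 (im g `&` B) = 0.
Proof.
move=> mB Loo.
have mf : measurable_fun setT (fun z : Z => (\1_B z)%:E : \bar R).
  by apply/measurable_EFinP; exact: measurable_indic.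
rewrite curve_int_area//.
have mfm : measurable_fun setT (fun z : Z => (\1_B z)%:E * mult z g).
  by apply: emeasurable_funM => //; exact: measurable_mult1.
have f0 z : 0 <= (\1_B z)%:E * mult z g by rewrite mule_ge0 ?lee_fin// mult_ge0.
split => [/(ge0_integral_eq0_ae H1 mfm f0)[N [mN N0 HN]]|H0].
  apply/eqP; rewrite eq_le hausdorff1_ge0 andbT -N0.
  apply: le_hausdorff1 => z [zg zB]; apply: HN => /=.
  rewrite indicE mem_set// mul1e => m0.
  by have := mult_ge1 zg; rewrite m0 leNgt lte01.
apply/(ge0_integral_eq0_ae H1 mfm f0).
exists (im g `&` B); split => //.
  by apply: measurableI => //; exact: measurable_im.
move=> z /= H; apply: contrapT => /not_andP [zg|zB]; apply: H.
  by rewrite mult_out// mule0.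
by rewrite indicE memNset// mul0e.
Qed.

Variable eta : probability G R.

Lemma I_costE a : I_cost a eta = \int[eta]_g curve_int (theta_pow_pred eta a) g.
Proof.
apply: eq_integral => g _; apply: (curve_int_speed (f := theta_pow_pred eta a)).
  exact: measurable_theta_pow_pred.
exact: theta_pow_pred_ge0.
Qed.

Hypothesis IPeta : irrigation_plan eta.

Lemma ae_finite_length : {ae eta, forall g, length g < +oo}.
Proof.
apply: ge0_integral_lty_ae IPeta; first exact: measurable_length.
by move=> g; exact: length_ge0.
Qed.

End curve_integrals.

(** * Sigma-finiteness on the set of positive multiplicity *)

Section packing.
Local Open Scope ereal_scope.
Context (R : realType) (d : nat).
Implicit Types (E : set 'rV[R]_d) (s : seq 'rV[R]_d) (rho : R).

Definition separated rho : rel 'rV[R]_d := fun x y => (rho <= enorm (x - y))%R.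

(** A separated family of maximal size, which exists by the bound, is a net: the balls of radius
    [rho] around it cover [E]. Their diameter 2 rho accounts for the factor 2. *)
Lemma hausdorff1_packing E (r M : R) : (0 < r)%R ->
  (forall rho s, (0 < rho <= r)%R -> pairwise (separated rho) s ->
     (forall x, x \in s -> E x) -> ((size s)%:R * rho <= M)%R) ->
  hausdorff1 E <= (2 * M)%:E.
Proof.
move=> r0 H; apply: hausdorff1_le => e e0.
pose rho := Num.min r (e / 2)%R.
have rho0 : (0 < rho)%R by rewrite lt_min r0 divr_gt0.
have rhor : (0 < rho <= r)%R by rewrite rho0 ge_min lexx.
have rhoe : (2 * rho <= e)%R.
  by have : (rho <= e / 2)%R; [rewrite ge_min lexx orbT|lra].
pose P n := exists s, [/\ pairwise (separated rho) s, forall x, x \in s -> E x & size s = n].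
have exP : exists n, `[< P n >] by exists 0%N; apply/asboolP; exists [::].
have M0 : (0 <= M)%R.
  by have := H rho [::] rhor isT; rewrite mul0r; apply.
have bP n : `[< P n >] -> (n <= Num.truncn (M / rho))%N.
  move=> /asboolP[s [ps sE <-]].
  rewrite Num.Theory.truncn_ge_nat ?divr_ge0 ?(ltW rho0)// ler_pdivlMr//.
  exact: H ps sE.
case: (ex_maxnP exP bP) => m /asboolP[s [ps sE sm]] mmax.
have cover x : E x -> exists2 y, y \in s & (enorm (x - y) < rho)%R.
  move=> Ex; apply: contrapT => Hs.
  have : (m.+1 <= m)%N; last by rewrite ltnn.
  apply: mmax; apply/asboolP; exists (x :: s); split; last by rewrite /= sm.
    rewrite /= ps andbT; apply/allP => y ys; rewrite /separated leNgt.
    by apply/negP => xy; apply: Hs; exists y.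
  by move=> y; rewrite inE => /predU1P[->//|]; exact: sE.
pose U n := if (n < size s)%N then [set z | (enorm (z - nth 0%R s n) < rho)%R] else set0.
have dU n : ediam (U n) <= (2 * rho)%:E.
  rewrite /U; case: ifP => _; last first.
    by rewrite ediam0 lee_fin mulr_ge0// ltW.
  apply: ediam_le => [|x y /= xs ys]; first by rewrite mulr_ge0// ltW.
  have := enorm_triangle x (nth 0%R s n) y; rewrite (enorm_distC (nth _ _ _) y).
  by move: xs ys; lra.
apply: le_trans (hausdorff1_delta_le_cover (U := U) _ _) _.
- move=> x /cover[y ys xy]; exists (index y s) => //.
  by rewrite /U index_mem ys /= nth_index.
- by move=> n; apply: le_trans (dU n) _; rewrite lee_fin.
rewrite (nneseries_split 0 (size s)); last by move=> *; exact: ediam_ge0.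
rewrite add0n eseries0 ?adde0; last first.
  by move=> n ns _; rewrite /U ltnNge ns/= ediam0.
apply: (@le_trans _ _ (\sum_(0 <= k < size s) (2 * rho)%:E)).
  by apply: lee_sum => k _; exact: dU.
rewrite big_mkord sumEFin lee_fin sumr_const card_ord -[X in (X <= _)%R]mulr_natl.
by rewrite mulrCA ler_pM2l//; exact: H ps sE.
Qed.

Lemma measurable_enorm_ball (x : 'rV[R]_d) r :
  measurable ([set z | (enorm (z - x) < r)%R] : set (borel 'rV[R]_d)).
Proof.
have mf : measurable_fun setT (fun z : borel 'rV[R]_d => enorm ((z : 'rV[R]_d) - x)).
  apply: (@measurable_fun_enormB R _ (borel 'rV[R]_d) d idfun (cst x)) => //.
  exact: measurable_id.
rewrite -[X in measurable X]setTI (_ : [set z | _] =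
  (fun z : borel 'rV[R]_d => enorm ((z : 'rV[R]_d) - x)) @^-1` `]-oo, r[).
  exact: mf.
by apply/seteqP; split => z /=; rewrite in_itv.
Qed.

End packing.

Section curve_packing.
Local Open Scope ereal_scope.
Context (R : realType) (d : nat) (K : set 'rV[R]_d) (K0 : K !=set0).
Implicit Types (g : Gamma K0).

Local Notation G := (borel (Gamma K0)).
Local Notation Z := (borel 'rV[R]_d).

Lemma hausdorff1_im_le g : hausdorff1 (im g) <= length g.
Proof.
have [->|Loo] := eqVneq (length g) +oo; first by rewrite leey.
have {}Loo : length g < +oo by rewrite ltey.
rewrite length_curve_int curve_int_area//.
have -> : hausdorff1 (im g) = \int[@hausdorff1 R d]_z (\1_(im g) z)%:E.
  by rewrite integral_indic ?setIT//; exact: measurable_im.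
apply: ge0_le_integral_any => z _; first by rewrite lee_fin.
rewrite mul1e indicE; case: (boolP (z \in im g)) => [/set_mem/mult_ge1//|_].
exact: mult_ge0.
Qed.

(** Dyadic times keep the union countable. With a displacement above 2r, no ball of radius r
    contains both the starting point and the point reached. *)
Definition moving (r : R) : set G :=
  \bigcup_n \bigcup_k [set g : G | (2 * r < enorm (curve (g : Gamma K0) (dyadic R n k) - curve (g : Gamma K0) 0))%R].

Lemma measurable_moving r : measurable (moving r).
Proof.
apply: bigcupT_measurable => n; apply: bigcupT_measurable => k.
have mf : measurable_fun setT (fun g : G => enorm (curve (g : Gamma K0) (dyadic R n k) - curve (g : Gamma K0) 0)%R).
  by apply: measurable_fun_enormB; exact: measurable_curve_eval.
rewrite -[X in measurable X]setTI (_ : [set g : G | _] =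
  (fun g : G => enorm (curve (g : Gamma K0) (dyadic R n k) - curve (g : Gamma K0) 0)%R) @^-1` `](2 * r)%R, +oo[).
  exact: mf.
by apply/seteqP; split => z /=; rewrite in_itv/= andbT.
Qed.

(* A curve through x that moves by more than 2r leaves the ball of radius r,
   hence all smaller balls, around x. *)
Lemma hausdorff1_moving_ball g x (r rho : R) : moving r g -> im g x ->
  (0 < rho <= r)%R ->
  (rho / 2)%:E <= hausdorff1 (im g `&` [set z | (enorm (z - x) < rho / 2)%R]).
Proof.
move=> [n _ [k _ /= gm]] [t0 + tx] /andP[rho0 rhor].
rewrite /= in_itv/= andbT => t00.
pose f t := enorm (curve g t - x)%R.
(* One of time 0 and the witnessing dyadic time will do; from there to [t0] the distance to [x]
   takes all values below rho/2. *)
have [q q0 qr] : exists2 q, (0 <= q)%R & (rho / 2 <= f q)%R.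
  have := enorm_triangle (curve g (dyadic R n k)) x (curve g 0).
  rewrite (enorm_distC x).
  have [h|h] := leP (rho / 2)%R (f (dyadic R n k)).
    by exists (dyadic R n k); [exact: dyadic_ge0|].
  move=> tri; exists 0%R => //; rewrite /f in h *; move: tri gm h rhor rho0.
  by set u := enorm _; set v := enorm _; set w := enorm _; clear; lra.
apply: (@hausdorff1_lip_ge _ _ _ (fun z => enorm (z - x))).
  by move=> y z; exact: enorm_dist_dist.
move=> v; rewrite /= in_itv/= => /andP[v0 vr].
have ft0 : f t0 = 0%R by rewrite /f tx subrr enorm0.
have cf a b : {within `[a, b], continuous f}.
  apply: continuous_subspaceT => t.
  apply: (@continuous_comp _ _ _ (fun t => curve g t - x)%R (@enorm R d)).
    by apply: cvgB; [exact: curve_continuous|exact: cvg_cst].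
  exact: continuous_enorm.
have [t tpos ftv] : exists2 t, (0 <= t)%R & f t = v.
  have [tq|/ltW qt] := leP t0 q.
    have [|t tab ft] := @IVT _ f _ _ v tq (@cf _ _).
      by rewrite ft0 ge_min v0/= le_max (le_trans (ltW vr) qr) orbT.
    exists t => //; move: tab; rewrite in_itv/= => /andP[h _].
    exact: le_trans h.
  have [|t tab ft] := @IVT _ f _ _ v qt (@cf _ _).
    by rewrite ft0 ge_min v0 orbT/= le_max (le_trans (ltW vr) qr).
  exists t => //; move: tab; rewrite in_itv/= => /andP[h _].
  exact: le_trans h.
exists (curve g t) => //; split => /=; last by rewrite -/(f t) ftv.
by exists t => //=; rewrite in_itv/= tpos.
Qed.

(** The balls of radius rho/2 around separated points are disjoint, and each point that is met uses
    up length rho/2 in its own ball. *)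
Lemma moving_packing g (r rho : R) (s : seq 'rV[R]_d) : (0 < rho <= r)%R ->
  pairwise (separated rho) s ->
  \sum_(x <- s) (if `[< im g x /\ moving r g >] then rho%:E else 0) <= 2%:E * length g.
Proof.
move=> rhor ps; apply: (@le_trans _ _ (2%:E * hausdorff1 (im g `&`
    \big[setU/set0]_(x <- s) [set z | (enorm (z - x) < rho / 2)%R]))); last first.
  apply: lee_wpmul2l => //; apply: le_trans (hausdorff1_im_le g).
  by apply: le_hausdorff1 => z [].
elim: s ps => [|x s IH] /=.
  by move=> _; rewrite !big_nil mule_ge0// hausdorff1_ge0.
move=> /andP[/allP xs ps]; rewrite !big_cons setIUr.
have mb y := @measurable_enorm_ball R d y (rho / 2)%R.
have mim := measurable_im g.
rewrite [hausdorff1 _](_ : _ = hausdorff1 (im g `&` [set z | (enorm (z - x) < rho / 2)%R]) +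
  hausdorff1 (im g `&` \big[setU/set0]_(j <- s) [set z | (enorm (z - j) < rho / 2)%R])); last first.
  apply: (measureU (@hausdorff1 R d)).
  - exact: measurableI.
  - by apply: measurableI => //; apply: bigsetU_measurable.
  - rewrite -subset0 => z [[_ /= zx] [_]]; rewrite -bigcup_seq => -[y /= ys zy].
    have := xs y ys; rewrite /separated; have := enorm_triangle x z y.
    by rewrite (enorm_distC x z); move: zx zy; lra.
rewrite ge0_muleDr ?hausdorff1_ge0//; apply: leeD; last exact: IH.
case: asboolP => [[gx gm]|_]; last by rewrite mule_ge0// hausdorff1_ge0.
apply: (@le_trans _ _ (2%:E * (rho / 2)%:E)); first by rewrite -EFinM lee_fin; lra.
by apply: lee_wpmul2l => //; exact: hausdorff1_moving_ball gm gx rhor.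
Qed.

End curve_packing.

Section pos_theta_sigma_finite.
Local Open Scope ereal_scope.
Context (R : realType) (d : nat) (K : set 'rV[R]_d) (K0 : K !=set0).
Implicit Types (g : Gamma K0).

Local Notation G := (borel (Gamma K0)).
Local Notation Z := (borel 'rV[R]_d).

Definition still : set G := ~` \bigcup_n moving n.+1%:R^-1.

Lemma measurable_still : measurable still.
Proof. by apply: measurableC; apply: bigcupT_measurable => n; exact: measurable_moving. Qed.

Lemma still_curve g t : still g -> curve g t = curve g 0.
Proof.
have [t0|t0] := ltP t 0%R; first by rewrite curve_neg.
move=> sg; have Hn n k : curve g (dyadic R n k) = curve g 0.
  apply/eqP; rewrite -subr_eq0; apply/eqP/enorm_eq0/le_anti.
  rewrite enorm_ge0 andbT leNgt; apply/negP => e0; apply: sg.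
  have e2 : (0 < enorm (curve g (dyadic R n k) - curve g 0) / 2)%R by rewrite divr_gt0.
  exists (Num.truncn (enorm (curve g (dyadic R n k) - curve g 0) / 2)^-1) => //.
  exists n => //; exists k => //=.
  by rewrite mulrC -ltr_pdivlMr//; exact: truncnV_lt.
have h2 := cvg_comp _ _ (@cvg_dyidx R t t0) (@curve_continuous _ _ _ _ g t).
have h3 : (curve g \o (fun n => dyadic R n (dyidx n t))) = (fun=> curve g 0).
  by apply/funext => n /=; exact: Hn.
rewrite h3 in h2; apply: (cvg_unique (@norm_hausdorff _ _) h2).
exact: cvg_cst.
Qed.

Lemma still_packing g (rho : R) (s : seq 'rV[R]_d) : (0 < rho <= 1)%R ->
  pairwise (separated rho) s ->
  \sum_(x <- s) (if `[< im g x /\ still g >] then rho%:E else 0) <= 1.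
Proof.
move=> /andP[rho0 rho1] ps.
have imE x : im g x -> still g -> x = curve g 0.
  by move=> [t _ <-] sg; exact: still_curve.
elim: s ps => [|x s IH] /=; first by rewrite big_nil lee_fin.
move=> /andP[/allP xs ps]; rewrite big_cons.
case: asboolP => [[gx sg]|_]; last by rewrite add0e; exact: IH.
rewrite big_seq big1 ?adde0 ?lee_fin// => y ys.
case: asboolP => // -[gy _]; have := xs y ys.
by rewrite /separated (imE _ gx sg) (imE _ gy sg) subrr enorm0 leNgt rho0.
Qed.

Variable eta : probability G R.

Definition hitmass (S : set G) (x : Z) : \bar R :=
  eta ([set g : G | im (g : Gamma K0) x] `&` S).

Lemma measurable_hitmass S : measurable S -> measurable_fun setT (hitmass S).
Proof.
move=> mS; have mIS : measurable (@incidence R d K K0 `&` (S `*` setT)).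
  by apply: measurableI; [exact: measurable_incidence|exact: measurableX].
have := measurable_fun_ysection eta mIS.
congr (measurable_fun _ _); apply/funext => x /=; congr (eta _).
apply/seteqP; split => g; rewrite /ysection /= ?inE.
  by move=> [? [? _]].
by move=> [? ?]; split.
Qed.

(* W bounds the packings met by a single curve; averaging over eta bounds the
   packings by points that carry mass at least e. *)
Lemma hausdorff1_hitmass_lty (S : set G) (e r : R) (W : G -> \bar R) :
  (0 < r)%R -> (0 < e)%R -> measurable S ->
  measurable_fun setT W -> (forall g, 0 <= W g) -> \int[eta]_g W g < +oo ->
  (forall (rho : R) s g, (0 < rho <= r)%R -> pairwise (separated rho) s ->
    \sum_(x <- s) (if `[< im g x /\ S g >] then rho%:E else 0) <= W g) ->
  hausdorff1 [set x : Z | e%:E <= hitmass S x] < +oo.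
Proof.
move=> r0 e0 mS mW W0 Woo H.
have WE : \int[eta]_g W g = (fine (\int[eta]_g W g))%:E.
  by rewrite fineK// ge0_fin_numE//; exact: integral_ge0.
apply: le_lt_trans (ltry (2 * (fine (\int[eta]_g W g) / e))).
apply: (@hausdorff1_packing _ _ _ r) => // rho s rhor ps sE.
have rho0 : (0 < rho)%R by case/andP: rhor.
have mA x : measurable ([set g : G | im (g : Gamma K0) x] `&` S).
  by apply: measurableI => //; exact: measurable_im_curves.
rewrite ler_pdivlMr// -lee_fin -WE.
apply: (@le_trans _ _ (\int[eta]_g \sum_(x <- s)
    (rho%:E * (\1_([set g : G | im (g : Gamma K0) x] `&` S) g)%:E))); last first.
  apply: ge0_le_integral_any => g _.
    by apply: sume_ge0 => x _; rewrite mule_ge0 ?lee_fin// ltW.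
  apply: le_trans (H rho s g rhor ps); apply: lee_sum => x _.
  rewrite indicE; case: asboolP => [gS|gS].
    by rewrite mem_set// mule1.
  by rewrite memNset// mule0.
rewrite ge0_integral_sum//; last 2 first.
- move=> x; apply: emeasurable_funM => //.
  by apply/measurable_EFinP; exact: measurable_indic.
- by move=> x g _; rewrite mule_ge0 ?lee_fin// ltW.
apply: (@le_trans _ _ (\sum_(x <- s) (rho * e)%:E)).
  rewrite sumEFin lee_fin big_const_seq count_predT iter_addr_0.
  by rewrite -[leRHS]mulr_natl mulrA.
rewrite big_seq [leRHS]big_seq; apply: lee_sum => x xs.
rewrite ge0_integralZl//; last 2 first.
- by apply/measurable_EFinP; exact: measurable_indic.
- by rewrite lee_fin ltW.
rewrite integral_indic// setIT EFinM; apply: lee_wpmul2l; first by rewrite lee_fin ltW.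
exact: sE.
Qed.

Hypothesis IPeta : irrigation_plan eta.

(** Index 0 stands for the still curves, i'+1 for those moving by more than 2/(i'+1). Still curves
    have length 0 and need a packing bound of their own. *)
Definition piece (i j : nat) : set Z :=
  [set x | j.+1%:R^-1%:E <= hitmass (if i is i'.+1 then moving i'.+1%:R^-1 else still) x].

Lemma measurable_piece i j : measurable (piece i j).
Proof.
have mS : measurable (if i is i'.+1 then moving i'.+1%:R^-1 else still : set G).
  by case: i => [|i]; [exact: measurable_still|exact: measurable_moving].
rewrite -[X in measurable X]setTI.
rewrite (_ : piece i j = hitmass (if i is i'.+1 then moving i'.+1%:R^-1 else still) @^-1` `[j.+1%:R^-1%:E, +oo[).
  by apply: measurable_hitmass => //; exact: emeasurable_itv.
by apply/seteqP; split => z /=; rewrite in_itv/= andbT.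
Qed.

Lemma hausdorff1_piece i j : hausdorff1 (piece i j) < +oo.
Proof.
case: i => [|i].
  apply: (@hausdorff1_hitmass_lty still _ 1 (cst 1)) => //.
  - exact: measurable_still.
  - by rewrite integral_cst// mul1e; apply: le_lt_trans (probability_le1 _ _) _ => //; exact: ltry.
  - by move=> rho s g; exact: still_packing.
apply: (@hausdorff1_hitmass_lty (moving i.+1%:R^-1) _ i.+1%:R^-1 (fun g => 2%:E * length (g : Gamma K0))).
- by rewrite invr_gt0.
- by rewrite invr_gt0.
- exact: measurable_moving.
- by apply: emeasurable_funM => //; exact: measurable_length.
- by move=> g; rewrite mule_ge0// length_ge0.
- rewrite ge0_integralZl//; last 2 first.
    exact: measurable_length.
    by move=> g _; exact: length_ge0.
  by rewrite lte_mul_pinfty.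
- by move=> rho s g; exact: moving_packing.
Qed.

(** The classes indexed by [i] exhaust all curves, so a point charged by none of them has theta =
    0. *)
Lemma pos_theta_pieces : pos_theta eta `<=` \bigcup_i \bigcup_j piece i j.
Proof.
move=> x /= /eqP tx; apply: contrapT => H; apply: tx.
pose S i : set G := if i is i'.+1 then moving i'.+1%:R^-1 else still.
have mS i : measurable (S i).
  by case: i => [|i]; [exact: measurable_still|exact: measurable_moving].
have S0 i : hitmass (S i) x = 0.
  apply/eqP; apply: contrapT => /negP; rewrite neq_lt ltNge measure_ge0/= => Hi.
  have fin : hitmass (S i) x \is a fin_num.
    rewrite ge0_fin_numE; last exact: measure_ge0.
    apply: le_lt_trans (ltry 1); apply: probability_le1.
    by apply: measurableI; [exact: measurable_im_curves|exact: mS].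
  apply: H; exists i => //; exists (Num.truncn (fine (hitmass (S i) x))^-1) => //.
  rewrite /piece /= -/(S i) -(fineK fin) lee_fin ltW//.
  by apply: truncnV_lt; rewrite -lte_fin fineK.
apply/eqP; rewrite eq_le measure_ge0 andbT.
have -> : 0 = \sum_(i <oo) hitmass (S i) x by rewrite eseries0.
have mI i : measurable ([set g : G | im (g : Gamma K0) x] `&` S i).
  by apply: measurableI; [exact: measurable_im_curves|exact: mS].
apply: measure_sigma_subadditive => //; first exact: measurable_im_curves.
move=> g gx; have [sg|/contrapT [i _ mg]] := pselect (still g); first by exists 0%N.
by exists i.+1.
Qed.

End pos_theta_sigma_finite.

(** * Rectifiability and concentration *)

Section sections.
Local Open Scope ereal_scope.
Context d1 d2 (X : measurableType d1) (Y : measurableType d2) (R : realType).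
Variables (P : probability X R).

Lemma integral_sections (m : {sigma_finite_measure set Y -> \bar R}) (E : set (X * Y)) :
  measurable E -> \int[P]_x m (xsection E x) = \int[m]_y P (ysection E y).
Proof.
move=> mE; have := indic_fubini_tonelli P m mE.
by rewrite indic_fubini_tonelli_FE// indic_fubini_tonelli_GE.
Qed.

Lemma measurable_bigcup_xsection (E : set (X * Y)) (u : nat -> X) : measurable E ->
  measurable (\bigcup_n xsection E (u n)).
Proof. by move=> mE; apply: bigcupT_measurable => n; exact: measurable_xsection. Qed.

(* The supremum of m over countable unions of sections is attained; a maximal
   union absorbs m-almost all of every section, and Fubini concludes. *)
Lemma exhausting_sections (m : {finite_measure set Y -> \bar R}) (E : set (X * Y)) :
  measurable E -> exists u : nat -> X,
    m ([set y | P (ysection E y) != 0] `\` \bigcup_n xsection E (u n)) = 0.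
Proof.
move=> mE; pose C (u : nat -> X) := \bigcup_n xsection E (u n).
have mC u : measurable (C u) by exact: measurable_bigcup_xsection.
have fC B : measurable B -> m B \is a fin_num by move=> mB; exact: fin_num_measure.
pose S := [set m (C u) | u in [set: nat -> X]].
have Sfin : ereal_sup S \is a fin_num.
  rewrite ge0_fin_numE; last by apply: le_ereal_sup_tmp; exists (m (C (fun=> point))) => //; exists (fun=> point).
  apply: (@le_lt_trans _ _ (m setT)); last by rewrite -ge0_fin_numE// fC.
  by apply: ge_ereal_sup => _ [u _ <-]; apply: le_measure; rewrite ?inE.
have Hu n : exists u, ereal_sup S - n.+1%:R^-1%:E < m (C u).
  have [|_ [u _ <-] h] := ub_ereal_sup_adherent (e := n.+1%:R^-1) _ Sfin.
    by rewrite invr_gt0.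
  by exists u.
pose w n := sval (cid (Hu n)).
(* [v] runs through all the terms of all the near-optimal sequences, so its union attains the
   supremum. *)
pose v k := if unpickle k is Some p then w p.1 p.2 else point.
have Cv n : C (w n) `<=` C v.
  move=> y [k _ yk]; exists (pickle (n, k)) => //.
  by rewrite /v pickleK.
have Sv : ereal_sup S <= m (C v).
  apply/lee_addgt0Pr => e e0.
  have : ereal_sup S - (Num.truncn e^-1).+1%:R^-1%:E < m (C v).
    apply: lt_le_trans (svalP (cid (Hu (Num.truncn e^-1)))) _.
    by apply: le_measure; rewrite ?inE//; exact: Cv.
  rewrite lteBlDr// => /ltW/le_trans; apply; apply: leeD2l.
  by rewrite lee_fin ltW// truncnV_lt.
have Ev x : m (xsection E x `\` C v) = 0.
  (* Prepending [x] gives a competitor that cannot exceed the supremum; as [m] is finite, what it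
     adds is null. *)
  pose u k := if k is k'.+1 then v k' else x.
  have Cu : C u = C v `|` (xsection E x `\` C v).
    apply/seteqP; split => y.
      move=> [[|k] _ yk]; last by left; exists k.
      by have [?|?] := pselect (C v y); [left|right].
    by move=> [[k _ yk]|[yx _]]; [exists k.+1|exists 0%N].
  have mD : measurable (xsection E x `\` C v).
    by apply: measurableD => //; exact: measurable_xsection.
  have : m (C u) <= m (C v).
    by apply: le_trans Sv; apply: ereal_sup_ubound; exists u.
  rewrite Cu measureU//; last by rewrite setDE setICA setICr setI0.
  rewrite -[leRHS]adde0 leeD2lE ?fC// => h.
  by apply/eqP; rewrite eq_le h measure_ge0.
exists v; pose F := E `&` (setT `*` ~` C v).
have mF : measurable F by apply: measurableI => //; apply: measurableX => //; exact: measurableC.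
have := integral_sections m mF.
rewrite integral0_eq; last first.
  move=> x _; rewrite -(Ev x); congr (m _).
  by apply/seteqP; split => y; rewrite /xsection/= !inE /= ?inE; [move=> [? [_ ?]]|move=> [? ?]; split].
have mP : measurable_fun setT (fun y => P (ysection F y)) by exact: measurable_fun_ysection.
move=> /esym/(ge0_integral_eq0_ae m mP (fun y => measure_ge0 P _)) [N [mN N0 HN]].
apply/eqP; rewrite eq_le measure_ge0 andbT -[leRHS]N0; apply: le_measure; rewrite ?inE//.
  apply: measurableD; last exact: mC.
  have mPE : measurable_fun setT (fun y => P (ysection E y)) by exact: measurable_fun_ysection.
  rewrite -[X in measurable X]setTI (_ : [set _ | _] = (fun y => P (ysection E y)) @^-1` (~` [set 0])).
    by apply: mPE => //; exact: measurableC.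
  by apply/seteqP; split => y /= /eqP.
move=> y [/= /eqP PE yv]; apply: HN => /= PF; apply: PE; rewrite -PF; congr (P _).
by apply/seteqP; split => x; rewrite /ysection/= !inE /= ?inE; [move=> ?; split|move=> [? _]].
Qed.

End sections.

(** The expected length spent in [B]. The hypothesis is an argument of the term because it yields
    the finite measure instance that [exhausting_sections] requires. *)
Definition plan_measure (R : realType) (d : nat) (K : set 'rV[R]_d) (K0 : K !=set0)
    (eta : probability (borel (Gamma K0)) R) & irrigation_plan eta :
    set (borel 'rV[R]_d) -> \bar R :=
  fun B => (\int[eta]_g curve_int (fun z => (\1_B z)%:E) (g : Gamma K0))%E.

Section plan_measure.
Local Open Scope ereal_scope.
Context (R : realType) (d : nat) (K : set 'rV[R]_d) (K0 : K !=set0).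
Local Notation G := (borel (Gamma K0)).
Local Notation Z := (borel 'rV[R]_d).
Variable eta : probability G R.
Hypothesis IPeta : irrigation_plan eta.

Local Notation nu := (plan_measure IPeta).

Let nu0 : nu set0 = 0.
Proof.
rewrite /plan_measure integral0_eq// => g _; apply: integral0_eq => t _.
by rewrite indic0 mul0e.
Qed.

Let measurable_indicE (B : set Z) : measurable B ->
  measurable_fun setT (fun z : Z => (\1_B z)%:E : \bar R).
Proof. by move=> mB; apply/measurable_EFinP; exact: measurable_indic. Qed.

Let indicE_ge0 (B : set Z) z : 0 <= (\1_B z)%:E :> \bar R.
Proof. by rewrite lee_fin. Qed.

Let nu_ge0 A : 0 <= nu A.
Proof. by apply: integral_ge0 => g _; exact: curve_int_ge0. Qed.

Let nu_sigma_additive : semi_sigma_additive nu.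
Proof.
move=> F mF tF mUF.
suff -> : nu (\bigcup_n F n) = \sum_(n <oo) nu (F n).
  by apply: is_cvg_nneseries => n _ _; exact: nu_ge0.
rewrite /plan_measure -integral_nneseries//; last 2 first.
- by move=> n; apply: measurable_curve_int => //; exact: measurable_indicE.
- by move=> n g _; exact: curve_int_ge0.
apply: eq_integral => g _; rewrite /curve_int -integral_nneseries//; last 2 first.
- move=> n; exact: measurable_funTS (measurable_curve_integrand (g : Gamma K0) (measurable_indicE (mF n))).
- by move=> n t _; rewrite mule_ge0// mspeed_ge0.
apply: eq_integral => t _.
have [[i _ Fi]|NF] := pselect ((\bigcup_n F n) (curve g t)).
  rewrite (@nneseriesD1 _ _ i)//; last by move=> n; rewrite mule_ge0// mspeed_ge0.
  rewrite eseries0 ?adde0 => [|j _ ji].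
    by rewrite !indicE !mem_set//; exists i.
  rewrite indicE memNset ?mul0e// => Fj; move/eqP: ji; apply.
  by apply: tF => //; exists (curve (g : Gamma K0) t).
rewrite indicE memNset// mul0e eseries0// => j _ _.
by rewrite indicE memNset ?mul0e// => Fj; apply: NF; exists j.
Qed.

HB.instance Definition _ := isMeasure.Build _ _ _ nu nu0 nu_ge0 nu_sigma_additive.

Let nu_fin : fin_num_fun nu.
Proof.
move=> A mA.
have nuA : nu A <= \int[eta]_g length (g : Gamma K0).
  apply: ge0_le_integral_any => g _; first exact: curve_int_ge0.
  rewrite length_curve_int; apply: ge0_le_integral_any => t _.
    by rewrite mule_ge0// mspeed_ge0.
  by apply: lee_wpmul2r; rewrite ?mspeed_ge0// indicE lee_fin; case: (_ \in _).
by have := le_lt_trans nuA IPeta; rewrite (ge0_fin_numE (nu_ge0 A)).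
Qed.

HB.instance Definition _ := Measure_isFinite.Build _ _ _ nu nu_fin.

(** With [A] the exhausting union of curves, the part of [pos_theta] outside [A] has no
    [plan_measure], so almost every curve meets it in an H^1-null set; concentration disposes of the
    rest of the curve. *)
Lemma rectifiable_pos_theta : concentrated eta (pos_theta eta) -> rectifiable eta.
Proof.
move=> cA; have [u Hu] := exhausting_sections eta nu (@measurable_incidence R d K K0).
pose A : set Z := \bigcup_n im (u n : Gamma K0).
have mA : measurable A by apply: bigcupT_measurable => n; exact: measurable_im.
exists A; split => //.
- by move=> x [n _ [t + <-]]; rewrite /= in_itv/= andbT => t0; exact: curve_mem.
- exists (fun n => curve (u n : Gamma K0)); split => [n|].
    by exists 1%R => s t s0 t0; rewrite mul1r; exact: curve_lip.
  by rewrite setDv; exact: measure0.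
have mP : measurable (pos_theta eta) by exact: measurable_pos_theta.
have mB : measurable (pos_theta eta `\` A) by exact: measurableD.
have AE : \bigcup_n xsection (@incidence R d K K0) (u n) = A.
  by apply: eq_bigcup => // n _; apply/seteqP; split => x; rewrite /xsection/= inE.
have PE : [set y | eta (ysection (@incidence R d K K0) y) != 0] = pos_theta eta.
  apply/funext => x; rewrite /pos_theta /theta /=; congr (is_true (eta _ != _)).
  by apply/seteqP; split => g; rewrite /ysection/= inE.
move: Hu; rewrite AE PE => {AE PE}.
move=> /(ge0_integral_eq0_ae eta (measurable_curve_int (measurable_indicE mB) (indicE_ge0 _))
  (fun g => curve_int_ge0 _ (indicE_ge0 _))).
move: (ae_finite_length IPeta) cA; apply: filterS3; first exact: (ae_filter_ringOfSetsType eta).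
move=> g Lg gP /(curve_int_indic_eq0 mB Lg) gA.
apply/eqP; rewrite eq_le hausdorff1_ge0 andbT -[leRHS]adde0 -{1}gP -gA.
apply: le_trans (outer_measureU2 (@hausdorff1 R d) _ _).
apply: le_hausdorff1 => x [gx Ax]; have [Px|Px] := pselect (pos_theta eta x); [right|left]; by split.
Qed.

End plan_measure.

Lemma normr_max0_dist (R : realType) (s t : R) :
  `|Num.max s 0 - Num.max t 0| <= `|s - t|.
Proof.
have [h1 h2] : s - t <= `|s - t| /\ t - s <= `|s - t|.
  by rewrite -(opprB s t); split; [exact: ler_norm|rewrite -normrN; exact: ler_norm].
have h3 := normr_ge0 (s - t).
by rewrite ler_norml; have [|] := leP s 0; have [|] := leP t 0; lra.
Qed.

Section lipschitz_arcs.
Local Open Scope ereal_scope.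
Context (R : realType) (d : nat) (c : R -> 'rV[R]_d).
Hypothesis cl : forall s t, (enorm (c s - c t) <= `|s - t|)%R.
Local Notation leb := (@lebesgue_measure R).

Lemma hausdorff1_arc_lty (a b : R) : (0 <= a)%R -> (a <= b)%R ->
  hausdorff1 (c @` `[a, b]) < +oo.
Proof.
move=> a0 ab; apply: le_lt_trans (hausdorff1_image_le cl a0 ab) _.
apply: (@le_lt_trans _ _ (\int[leb]_(t in `]a, b]) 1)).
  apply: ge0_le_integral_any => t _; first exact: mspeed_ge0.
  apply: limn_einf_le => n; rewrite lee_fin /slope mulrC -ler_pdivlMr ?exp2_gt0//.
  by rewrite mul1r -(dyadicS R n (dyidx n t)) -[leRHS]ger0_norm// subr_ge0 ltW// dyadic_ltS.
by rewrite integral_cst//= mul1e lebesgue_measure_itv/= lte_fin; case: ifP => // _; rewrite -EFinB ltry.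
Qed.

Lemma measurable_arc (a b : R) : measurable (c @` `[a, b] : set (borel 'rV[R]_d)).
Proof.
have cK : compact (c @` `[a, b]).
  apply: (continuous_compact (f := c)); last exact: segment_compact.
  by apply: continuous_subspaceT; exact: lipschitz_curve_continuous.
have cc := compact_closed (@norm_hausdorff _ _) cK.
rewrite -[X in measurable X]setCK; apply: measurableC.
by apply: sub_sigma_algebra; exact: closed_openC.
Qed.

End lipschitz_arcs.

Section rectifiable_sets.
Local Open Scope ereal_scope.
Context (R : realType) (d : nat).

Lemma hausdorff1_bigcup_eq0 (F : (set 'rV[R]_d)^nat) :
  (forall n, hausdorff1 (F n) = 0) -> hausdorff1 (\bigcup_n F n) = 0.
Proof.
move=> F0; apply/eqP; rewrite eq_le hausdorff1_ge0 andbT.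
by apply: le_trans (hausdorff1_sigma_subadditive F) _; rewrite eseries0.
Qed.

Lemma hausdorff1_setU_eq0 (A B : set 'rV[R]_d) :
  hausdorff1 A = 0 -> hausdorff1 B = 0 -> hausdorff1 (A `|` B) = 0.
Proof.
move=> A0 B0; apply/eqP; rewrite eq_le hausdorff1_ge0 andbT.
by have := outer_measureU2 (@hausdorff1 R d) A B; rewrite /= A0 B0 adde0.
Qed.

(* Slowing the curves down and extending them to the left by a constant makes
   them 1-Lipschitz on the whole line. *)
Lemma rectifiable1_arcs (A : set 'rV[R]_d) : rectifiable1 A ->
  exists D : nat -> nat -> set (borel 'rV[R]_d),
    (forall n k, measurable (D n k) /\ hausdorff1 (D n k) < +oo) /\
    hausdorff1 (A `\` \bigcup_n \bigcup_k D n k) = 0.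
Proof.
move=> [c [cl A0]].
pose L n := Num.max 1%R (sval (cid (cl n))).
have L1 n : (1 <= L n)%R by rewrite le_max lexx.
have L0 n : (0 < L n)%R by exact: lt_le_trans (L1 n).
pose e n (t : R) := c n (Num.max t 0 / L n)%R.
have el n s t : (enorm (e n s - e n t) <= `|s - t|)%R.
  have := svalP (cid (cl n)) (Num.max s 0 / L n)%R (Num.max t 0 / L n)%R.
  have M0 (r : R) : (0 <= Num.max r 0 / L n)%R.
    by apply: divr_ge0; [rewrite le_max lexx orbT|exact: ltW].
  move=> /(_ (M0 s) (M0 t))/le_trans; apply.
  apply: (@le_trans _ _ (L n * `|Num.max s 0 / L n - Num.max t 0 / L n|))%R.
    by apply: ler_wpM2r => //; rewrite le_max lexx orbT.
  rewrite -mulrBl normrM [X in (_ * (_ * X))%R]ger0_norm ?invr_ge0 ?(ltW (L0 n))//.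
  rewrite mulrCA divff ?gt_eqF// mulr1.
  exact: normr_max0_dist.
exists (fun n k : nat => e n @` `[(k%:R : R)%R, (k.+1%:R : R)%R]); split => [n k|].
  split; first by apply: measurable_arc => s t; exact: el.
  by apply: hausdorff1_arc_lty; rewrite ?ler_nat// => s t; exact: el.
apply/eqP; rewrite eq_le hausdorff1_ge0 andbT -[leRHS]A0.
apply: le_hausdorff1 => x [Ax Dx]; split => // -[n _ [t + tx]].
rewrite /= in_itv/= andbT => t0; apply: Dx; exists n => //.
have Lt0 : (0 <= L n * t)%R by rewrite mulr_ge0// ltW.
exists (Num.truncn (L n * t)) => //; exists (L n * t)%R.
  by have /andP[h1 h2] := Num.Theory.truncn_itv Lt0; rewrite /= in_itv/= h1 ltW.
rewrite -tx /e; congr (c n _); rewrite max_l//.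
by rewrite mulrAC divff ?mul1r// gt_eqF.
Qed.

End rectifiable_sets.

Section rectifiable_plans.
Local Open Scope ereal_scope.
Context (R : realType) (d : nat) (K : set 'rV[R]_d) (K0 : K !=set0).
Local Notation G := (borel (Gamma K0)).
Local Notation Z := (borel 'rV[R]_d).
Local Notation H1 := (@hausdorff1 R d).
Variable eta : probability G R.

(** A point off [pos_theta] lies on eta-almost no curve. Exchanging sections turns this into a
    statement on almost every curve, and finiteness on [D] makes the exchange legitimate. *)
Lemma ae_hausdorff1_theta0 (D : set Z) : measurable D -> H1 D < +oo ->
  {ae eta, forall g : G, hausdorff1 ((im (g : Gamma K0) `\` pos_theta eta) `&` D) = 0}.
Proof.
move=> mD Doo; have mP := measurable_pos_theta eta.
pose E := @incidence R d K K0 `&` (setT `*` ~` pos_theta eta).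
have mE : measurable E.
  apply: measurableI; first exact: measurable_incidence.
  by apply: measurableX => //; exact: measurableC.
pose m : {finite_measure set Z -> \bar R} := mfrestr mD Doo.
have xE g : m (xsection E g) = hausdorff1 ((im (g : Gamma K0) `\` pos_theta eta) `&` D).
  rewrite /m /= /mfrestr /mrestr; congr (hausdorff1 (_ `&` _)).
  apply/seteqP; split => x; rewrite /xsection/= inE; first by move=> [? []].
  by move=> [? ?]; split.
have mxE : measurable_fun setT (fun g => m (xsection E g)) by exact: measurable_fun_xsection.
have := integral_sections eta m mE.
rewrite [RHS]integral0_eq; last first.
  move=> x _; have [tx|tx] := eqVneq (theta eta x) 0; last first.
    rewrite (_ : ysection E x = set0) ?measure0//.
    by apply/seteqP; split => // g; rewrite /ysection/= inE => -[_ [_ /= H]]; apply: H.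
  apply/eqP; rewrite eq_le measure_ge0 andbT -[leRHS]tx; apply: le_measure; rewrite ?inE.
  - exact: measurable_ysection.
  - exact: measurable_im_curves.
  - by move=> g; rewrite /ysection/= inE => -[].
move=> /(ge0_integral_eq0_ae eta mxE (fun g => measure_ge0 m _)).
by apply: filterS => g; rewrite xE.
Qed.

Lemma rectifiable_concentrated : rectifiable eta -> concentrated eta (pos_theta eta).
Proof.
move=> [A [mA _ rA cA]]; have [D [mD AD]] := rectifiable1_arcs rA.
have H : {ae eta, forall g : G, forall n k,
    hausdorff1 ((im (g : Gamma K0) `\` pos_theta eta) `&` D n k) = 0}.
  apply: ae_foralln => n; apply: ae_foralln => k; have [? ?] := mD n k.
  exact: ae_hausdorff1_theta0.
move: H cA; apply: filterS2 => g gD gA; apply/eqP; rewrite eq_le hausdorff1_ge0 andbT.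
rewrite -[leRHS](hausdorff1_setU_eq0 gA (hausdorff1_setU_eq0 AD
  (hausdorff1_bigcup_eq0 (fun n => hausdorff1_bigcup_eq0 (fun k => gD n k))))).
apply: le_hausdorff1 => x [gx Px].
have [Ax|] := pselect (A x); last by left.
have [[n _ [k _ Dx]]|] := pselect ((\bigcup_n \bigcup_k D n k) x); last by right; left.
by right; right; exists n => //; exists k.
Qed.

End rectifiable_plans.

(** * Comparison of the costs *)

(** The restriction of H^1 for which Tonelli is available; its sigma-finiteness rests on
    [irrigation_plan], hence the argument. *)
Definition hausdorff1_pos_theta (R : realType) (d : nat) (K : set 'rV[R]_d)
    (K0 : K !=set0) (eta : probability (borel (Gamma K0)) R) & irrigation_plan eta :
    set (borel 'rV[R]_d) -> \bar R :=
  mrestr (@hausdorff1 R d) (measurable_pos_theta eta).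

Section hausdorff1_pos_theta.
Local Open Scope ereal_scope.
Context (R : realType) (d : nat) (K : set 'rV[R]_d) (K0 : K !=set0).
Local Notation G := (borel (Gamma K0)).
Local Notation Z := (borel 'rV[R]_d).
Local Notation H1 := (@hausdorff1 R d).
Variable eta : probability G R.
Hypothesis IPeta : irrigation_plan eta.

Local Notation P := (pos_theta eta).
Local Notation HP := (hausdorff1_pos_theta IPeta).

HB.instance Definition _ := Measure.on HP.

Let HP_sigma_finite : sigma_finite setT HP.
Proof.
have mP := measurable_pos_theta eta.
(* The complement of [P] has zero restricted measure and is added so that the sets cover the whole
   space. *)
pose F k : set Z := if unpickle k is Some p then piece eta p.1 p.2 `|` ~` P else set0.
exists F => [|k]; last first.
  rewrite /F; case: unpickle => [[i j]|]/=; last by split => //; rewrite measure0.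
  have mp := measurable_piece eta i j.
  split; first by apply: measurableU => //; exact: measurableC.
  apply: le_lt_trans (hausdorff1_piece IPeta i j).
  by apply: le_hausdorff1 => z [[]].
apply/seteqP; split => // z _; have [/pos_theta_pieces [i _ [j _ zij]]|Pz] := pselect (P z).
  by exists (pickle (i, j)) => //; rewrite /F pickleK; left.
by exists (pickle (0%N, 0%N)) => //; rewrite /F pickleK; right.
Qed.

HB.instance Definition _ := Measure_isSigmaFinite.Build _ _ _ HP HP_sigma_finite.

Lemma integral_hausdorff1_pos_theta (f : Z -> \bar R) : measurable_fun setT f ->
  (forall z, 0 <= f z) -> \int[HP]_z f z = \int[H1]_z (f z * (\1_P z)%:E).
Proof.
move=> mf f0; have mP := measurable_pos_theta eta.
have m1 : measurable_fun setT (fun z : Z => (\1_P z)%:E : \bar R).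
  by apply/measurable_EFinP; exact: measurable_indic.
have p1 (z : Z) : 0 <= (\1_P z)%:E :> \bar R by rewrite lee_fin.
rewrite -(integral_density H1 m1 p1)//; apply: eq_measure_integral => A mA _.
by rewrite /= /density integral_indic// setIC.
Qed.

Lemma curve_int_pos_theta (f : Z -> \bar R) (g : Gamma K0) : measurable_fun setT f ->
  (forall z, 0 <= f z) -> length g < +oo -> hausdorff1 (im g `\` P) = 0 ->
  curve_int f g = \int[HP]_z (f z * mult z g).
Proof.
move=> mf f0 Lg gP; have mP := measurable_pos_theta eta.
have mfm : measurable_fun setT (fun z : Z => f z * mult z g).
  by apply: emeasurable_funM => //; exact: measurable_mult1.
have fm0 z : 0 <= f z * mult z g by rewrite mule_ge0// mult_ge0.
rewrite (curve_int_area Lg mf f0) (integral_hausdorff1_pos_theta mfm fm0).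
apply: ge0_ae_eq_integral => //.
- by apply: emeasurable_funM => //; apply/measurable_EFinP; exact: measurable_indic.
- by move=> z _; rewrite mule_ge0// lee_fin.
exists (im g `\` P); split => //; first by apply: measurableD => //; exact: measurable_im.
move=> z /= H; split; apply: contrapT => Hz; apply: H => _.
  by rewrite mult_out// mule0 mul0e.
by rewrite indicE mem_set ?mule1//; exact: contrapT.
Qed.

Variable a : R.
Local Notation tp := (theta_pow_pred eta a).

Lemma concentrated_I_cost_lty : I_cost a eta < +oo -> concentrated eta P.
Proof.
have mt : measurable_fun setT (tp : Z -> \bar R) by exact: measurable_theta_pow_pred.
have t0 := theta_pow_pred_ge0 eta a.
rewrite I_costE => /(ge0_integral_lty_ae (measurable_curve_int mt t0)
  (fun g => curve_int_ge0 _ t0)).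
move: (ae_finite_length IPeta); apply: filterS2; first exact: (ae_filter_ringOfSetsType eta).
move=> g Lg; rewrite curve_int_area// => /ge0_integral_lty_ae H.
have [||N [mN N0 HN]] := H.
- by apply: emeasurable_funM => //; exact: measurable_mult1.
- by move=> z; rewrite mule_ge0// mult_ge0.
apply/eqP; rewrite eq_le hausdorff1_ge0 andbT -[leRHS]N0; apply: le_hausdorff1.
move=> z [gz Pz]; apply: HN => /=; apply/negP; rewrite -leNgt.
have -> : tp z = +oo.
  by rewrite /theta_pow_pred; case: eqP => // /eqP /Pz.
by rewrite gt0_mulye//; apply: lt_le_trans (mult_ge1 gz).
Qed.

Hypothesis cP : concentrated eta P.

(** [W] is the multiplicity itself for the first identity and the indicator of incidence for the
    second. *)
Lemma I_cost_tonelli (W : G * Z -> \bar R) : measurable_fun setT W ->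
  (forall p, 0 <= W p) ->
  {ae eta, forall g : G, {ae H1, forall z, mult z (g : Gamma K0) = W (g, z)}} ->
  I_cost a eta = \int[HP]_z (tp z * \int[eta]_g W (g, z)).
Proof.
move=> mW W0 multW; have mP := measurable_pos_theta eta.
have mt : measurable_fun setT (tp : Z -> \bar R) by exact: measurable_theta_pow_pred.
have t0 := theta_pow_pred_ge0 eta a.
have mtW : measurable_fun setT (fun p : (G * Z)%type => tp p.2 * W p).
  apply: emeasurable_funM => //.
  exact: (measurableT_comp mt measurable_snd).
have tW0 p : 0 <= tp p.2 * W p by rewrite mule_ge0.
transitivity (\int[eta]_g \int[HP]_z (tp z * W (g, z))).
  rewrite I_costE; apply: ge0_ae_eq_integral_any => //.
  - by move=> g _; exact: curve_int_ge0.
  - by move=> g _; apply: integral_ge0 => z _; exact: (tW0 (g, z)).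
  - exact: (@measurable_fun_fubini_tonelli_F _ _ G Z R HP _ mtW tW0).
  move: (ae_finite_length IPeta) cP multW; apply: filterS3; first exact: (ae_filter_ringOfSetsType eta).
  move=> g Lg gP gW _.
  rewrite (curve_int_pos_theta mt t0 Lg gP).
  have mm : measurable_fun setT (fun z : Z => tp z * mult z g).
    by apply: emeasurable_funM => //; exact: measurable_mult1.
  have mw : measurable_fun setT (fun z : Z => tp z * W (g, z)).
    exact: (measurableT_comp mtW (measurable_pair1 (g : G))).
  have mm0 z : 0 <= tp z * mult z g by rewrite mule_ge0// mult_ge0.
  rewrite (integral_hausdorff1_pos_theta mm mm0).
  rewrite (integral_hausdorff1_pos_theta mw (fun z => tW0 (g, z))).
  have m1 : measurable_fun setT (fun z : Z => (\1_P z)%:E : \bar R).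
    by apply/measurable_EFinP; exact: measurable_indic.
  apply: ge0_ae_eq_integral => //.
  - exact: emeasurable_funM.
  - exact: emeasurable_funM.
  - by move=> z _; rewrite !mule_ge0 ?lee_fin// mult_ge0.
  - by move=> z _; rewrite !mule_ge0 ?lee_fin.
  move: gW; apply: filterS; first exact: (ae_filter_ringOfSetsType H1).
  by move=> z zW _; rewrite zW.
rewrite (@fubini_tonelli _ _ G Z R eta HP _ mtW tW0); apply: eq_integral => z _.
rewrite /= ge0_integralZl//.
exact: (measurableT_comp mW (measurable_pair2 (z : Z))).
Qed.

(** [f] vanishes off [pos_theta], which is contained in [K] because the curves stay in [K]. *)
Lemma integral_domain_pos_theta (f : Z -> \bar R) : measurable_fun setT f ->
  (forall z, 0 <= f z) -> (forall z, theta eta z = 0 -> f z = 0) ->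
  \int[HP]_z f z = \int[H1]_(z in K) f z.
Proof.
move=> mf f0 fz0; rewrite (integral_hausdorff1_pos_theta mf f0) [RHS]integral_mkcond.
apply: eq_integral => z _; rewrite patchE indicE.
have [tz|tz] := eqVneq (theta eta z) 0; first by rewrite fz0// mul0e; case: ifP.
rewrite mem_set// mule1 mem_set//; apply: contrapT => Kz; move/eqP: tz; apply.
rewrite /theta (_ : [set g | im g z] = set0) ?measure0//.
apply/seteqP; split => // g [t + gz]; rewrite /= in_itv/= andbT => t0; apply: Kz.
by rewrite -gz; exact: curve_mem.
Qed.

Lemma I_cost_Ebar : I_cost a eta = \int[H1]_(x in K) (tp x * mult_plan eta x).
Proof.
have mt : measurable_fun setT (tp : Z -> \bar R) by exact: measurable_theta_pow_pred.
rewrite (I_cost_tonelli (@measurable_mult R d K K0)); first last.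
- by apply: nearW => g; apply: nearW.
- by move=> p; exact: mult_ge0.
apply: integral_domain_pos_theta.
- by apply: emeasurable_funM => //; exact: measurable_mult_plan.
- move=> z; rewrite mule_ge0 ?theta_pow_pred_ge0//; apply: integral_ge0 => g _; exact: mult_ge0.
(* Here the weight is +oo but almost no curve passes through [z], so the convention that +oo times 0
   is 0 applies. *)
- move=> z tz; rewrite /mult_plan (_ : \int[eta]_g _ = 0) ?mule0//.
  apply/(ge0_integral_eq0_ae eta (measurableT_comp (@measurable_mult R d K K0) (measurable_pair2 (z : Z)))).
    by move=> g; exact: mult_ge0.
  exists [set g : G | im (g : Gamma K0) z]; split => //; first exact: measurable_im_curves.
  by move=> g /= H; apply: contrapT => zg; apply: H; exact: mult_out.
Qed.

(** For an essentially simple curve the multiplicity agrees H^1-almost everywhere with the indicator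
    of the image, whose average over eta is [theta]. *)
Lemma I_cost_E : essentially_simple eta ->
  I_cost a eta = \int[H1]_(x in K) theta_pow eta a x.
Proof.
move=> es; have mt : measurable_fun setT (tp : Z -> \bar R) by exact: measurable_theta_pow_pred.
rewrite (@I_cost_tonelli (fun p => (\1_(@incidence R d K K0) p)%:E)); first last.
- move: es; apply: filterS; first exact: (ae_filter_ringOfSetsType eta).
  move=> g gs.
  exists (im g `&` [set x | mult x g != 1]); split.
  - apply: measurableI; first exact: measurable_im.
    rewrite -[X in measurable X]setTI.
    rewrite (_ : [set x | _] = (fun z : Z => mult z g) @^-1` (~` [set 1])).
      by apply: measurable_mult1 => //; exact: measurableC.
    by apply/seteqP; split => x /= /eqP.
  - apply/eqP; rewrite eq_le hausdorff1_ge0 andbT -[leRHS]gs.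
    by apply: le_hausdorff1 => x [gx /= /eqP xg].
  move=> z /=; rewrite indicE => H; split.
    apply: contrapT => gz; apply: H; rewrite mult_out// memNset//.
  apply/eqP => m1; apply: H; rewrite m1 mem_set// /incidence /=.
  by apply: contrapT => gz; move: m1; rewrite mult_out// => /eqP; rewrite eq_sym onee_eq0.
- by move=> p; rewrite lee_fin.
- by apply/measurable_EFinP; apply: measurable_indic; exact: measurable_incidence.
have E z : \int[eta]_g (\1_(@incidence R d K K0) (g, z))%:E = theta eta z.
  have mz := @measurable_im_curves R d K K0 z.
  by rewrite /theta -[in RHS](setIT [set g | im g z]) -integral_indic.
under eq_integral do rewrite E.
rewrite integral_domain_pos_theta.
- apply: eq_integral => z _; have [tz|tz] := eqVneq (theta eta z) 0.
    by rewrite tz mule0 /theta_pow tz eqxx.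
  exact: theta_pow_predM.
- by apply: emeasurable_funM => //; exact: measurable_theta.
- by move=> z; rewrite mule_ge0 ?theta_pow_pred_ge0 ?theta_ge0.
- by move=> z ->; rewrite mule0.
Qed.

End hausdorff1_pos_theta.

Unset Implicit Arguments.
Set Strict Implicit.
Set Printing Implicit Defensive.

Theorem theorem2p8 (R : realType) (d : nat) (K : set 'rV[R]_d)
    (K0 : K !=set0) (cK : compact K) (a : R) (a01 : 0 <= a < 1)
    (eta : probability (borel (Gamma K0)) R) (IPeta : irrigation_plan eta) :
  I_cost a eta = Ebar_cost a eta /\
  (essentially_simple eta -> I_cost a eta = E_cost a eta).
Proof.
have [cP|ncP] := pselect (concentrated eta (pos_theta eta)).
  have rect := rectifiable_pos_theta IPeta cP.
  rewrite /Ebar_cost /E_cost !asboolT//; split; first exact: (I_cost_Ebar IPeta).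
  exact: (I_cost_E IPeta).
rewrite /Ebar_cost /E_cost !asboolF; last by move=> /rectifiable_concentrated.
have -> : I_cost a eta = +oo%E; last by split.
apply/eqP; rewrite -leye_eq leNgt; apply/negP => Ioo; apply: ncP.
exact: (concentrated_I_cost_lty IPeta Ioo).
Qed.
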